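(* Let $N=\ell_{(p_n)}$ be a Nakano sequence space with exponent sequence $(p_n)$, where $p_n\ne2$ for all $n$ and $p_n$ converges to $2$. Let $(E_n)$ be a sequence of nonzero finite dimensional normed spaces whose Jordan–von Neumann constants $a(E_n)$ converge to $1$. Then the elementary class of the Nakano direct sum $E=\big(\bigoplus_nE_n\big)_N$ is equal (up to linear isometry) to the class of all modular direct sums $E\oplus_mH$ of $E$ with arbitrary Hilbert spaces $H$, and hence it is uncountably categorical.
   Context: Scalars are $\mathbb K\in\{\mathbb R,\mathbb C\}$. Hilbert spaces may have any dimension (including finite or $0$). Modulars. A convex modular on a linear space $X$ is a convex function $\Theta:X\to[0,\infty)$ with $\Theta(0)=0$, $\Theta(\lambda x)=\Theta(x)$ for $|\lambda|=1$, and $\Theta(x)=0\Rightarrow x=0$; its Luxemburg norm is $\|x\|=\inf\{\lambda>0:\Theta(x/\lambda)\le1\}$. The modular direct sum $X_1\oplus_mX_2$ is $X_1\oplus X_2$ with modular $\Theta(x_1+x_2)=\Theta_1(x_1)+\Theta_2(x_2)$ and its Luxemburg norm. Hilbert spaces carry the modular $\|x\|^2$. Nakano spaces. Given a bounded sequence of exponents $p_n\in[1,\infty)$, $n\in\mathbb N$, $N=\ell_{(p_n)}$ is the space of scalar sequences $x=(x(n))$ with $\Theta(x)=\sum_n|x(n)|^{p_n}<\infty$, with the Luxemburg norm. The Nakano direct sum $\big(\bigoplus_nE_n\big)_N$ is the space of $x=(x(n))\in\prod_nE_n$ with $(\|x(n)\|_{E_n})\in N$, with modular $\Theta(x)=\sum_n\|x(n)\|_{E_n}^{p_n}$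 and its Luxemburg norm. Jordan–von Neumann constant of a nonzero normed space $X$: $a(X)=\tfrac12\sup\{\|x+y\|^2+\|x-y\|^2: x,y\in X,\ \|x\|^2+\|y\|^2=1\}$. Elementary classes. Banach spaces $X,Y$ are elementarily equivalent if there are ultrafilters $\mathcal U,\mathcal V$ (on some sets) such that the Banach space ultrapowers $X_{\mathcal U}$ and $Y_{\mathcal V}$ are linearly isometric (this is an equivalence relation). The elementary class of $X$ is the class of all Banach spaces elementarily equivalent to $X$. The elementary class of an infinite dimensional Banach space is uncountably categorical if for some uncountable cardinal $\kappa$ it contains, up to linear isometry, exactly one space of density character $\kappa$. *)

(* Defs.v *)
From HB Require Import structures.
From mathcomp Require Import all_boot all_order all_algebra.
From mathcomp Require Import sesquilinear complex.
From mathcomp Require Import all_classical all_reals all_analysis.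

Set Implicit Arguments.
Unset Strict Implicit.
Unset Printing Implicit Defensive.

Import Order.TTheory GRing.Theory Num.Theory.
Import numFieldNormedType.Exports.

Local Open Scope classical_set_scope.
Local Open Scope ring_scope.

Inductive scalar_kind := RealScalars | ComplexScalars.

Definition scalars (R : realType) (k : scalar_kind) : numFieldType :=
  match k with
  | RealScalars => R : numFieldType
  | ComplexScalars => R[i] : numFieldType
  end.

Section Scalars.
Context {R : realType} {k : scalar_kind}.

Definition scalar_re : scalars R k -> R :=
  match k return scalars R k -> R with
  | RealScalars => fun x => x
  | ComplexScalars => fun z => complex.Re z
  end.

Definition scalar_of_real : R -> scalars R k :=
  match k return R -> scalars R k with
  | RealScalars => fun x => x
  | ComplexScalars => fun x => real_complex R x
  end.

Definition scalar_conj : scalars R k -> scalars R k :=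
  match k return scalars R k -> scalars R k with
  | RealScalars => fun x => x
  | ComplexScalars => fun z => conjc z
  end.

Lemma scalar_of_realK (a : R) : scalar_re (scalar_of_real a) = a.
Proof. by rewrite /scalar_re /scalar_of_real; case: k. Qed.

Lemma scalar_reK (z : scalars R k) :
  0 <= z -> scalar_of_real (scalar_re z) = z.
Proof.
rewrite /scalar_re /scalar_of_real; case: k z => //= z z0.
by rewrite RRe_real // ger0_real.
Qed.

Lemma scalar_of_real_le (a b : R) :
  (scalar_of_real a <= scalar_of_real b) = (a <= b).
Proof. by rewrite /scalar_of_real; case: k => //; rewrite lecR. Qed.

Lemma scalar_of_realD (a b : R) :
  scalar_of_real (a + b) = scalar_of_real a + scalar_of_real b.
Proof. by rewrite /scalar_of_real; case: k => //; rewrite rmorphD. Qed.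

Lemma scalar_of_realM (a b : R) :
  scalar_of_real (a * b) = scalar_of_real a * scalar_of_real b.
Proof. by rewrite /scalar_of_real; case: k => //; rewrite rmorphM. Qed.

Lemma scalar_of_real0 : scalar_of_real 0 = 0.
Proof. by rewrite /scalar_of_real; case: k. Qed.

Lemma scalar_of_real1 : scalar_of_real 1 = 1.
Proof. by rewrite /scalar_of_real; case: k. Qed.

Lemma scalar_of_realV (a : R) :
  scalar_of_real a^-1 = (scalar_of_real a)^-1.
Proof. by rewrite /scalar_of_real; case: k => //; rewrite fmorphV. Qed.

Lemma scalar_of_real_inj : injective scalar_of_real.
Proof. exact: can_inj scalar_of_realK. Qed.

(* Norms in a [normedModType (scalars R k)] take values in the scalars, hence in
   [R[i]] for complex spaces; [rnorm] is the same norm as a real number. *)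
Definition rnorm (V : normedZmodType (scalars R k)) (x : V) : R :=
  scalar_re `|x|.

Lemma rnormE (V : normedZmodType (scalars R k)) (x : V) :
  scalar_of_real (rnorm x) = `|x|.
Proof. exact: scalar_reK. Qed.

Lemma rnorm_ge0 (V : normedZmodType (scalars R k)) (x : V) : 0 <= rnorm x.
Proof. by rewrite -scalar_of_real_le rnormE scalar_of_real0. Qed.

Lemma rnorm0 (V : normedZmodType (scalars R k)) : rnorm (0 : V) = 0.
Proof. by apply: scalar_of_real_inj; rewrite rnormE normr0 scalar_of_real0. Qed.

Lemma rnorm_eq0 (V : normedZmodType (scalars R k)) (x : V) :
  rnorm x = 0 -> x = 0.
Proof.
by move=> x0; apply/normr0_eq0; rewrite -rnormE x0 scalar_of_real0.
Qed.

Lemma rnormN (V : normedZmodType (scalars R k)) (x : V) : rnorm (- x) = rnorm x.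
Proof. by rewrite /rnorm normrN. Qed.

Lemma ler_rnormD (V : normedZmodType (scalars R k)) (x y : V) :
  rnorm (x + y) <= rnorm x + rnorm y.
Proof. by rewrite -scalar_of_real_le scalar_of_realD !rnormE ler_normD. Qed.

Lemma rnormZ (V : normedModType (scalars R k)) (l : scalars R k) (x : V) :
  rnorm (l *: x) = rnorm l * rnorm x.
Proof.
by apply: scalar_of_real_inj; rewrite scalar_of_realM !rnormE normrZ.
Qed.

Lemma rnormr_id (V : normedZmodType (scalars R k)) (x : V) :
  rnorm (`|x| : scalars R k) = rnorm x.
Proof. by rewrite /rnorm normr_id. Qed.

Lemma rnorm_scalar (a : R) : rnorm (scalar_of_real a) = `|a|.
Proof.
apply: scalar_of_real_inj; rewrite rnormE; case: (leP 0 a) => [a0|/ltW a0].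
  by rewrite !ger0_norm // -scalar_of_real0 scalar_of_real_le.
rewrite ler0_norm -?scalar_of_real0 ?scalar_of_real_le// (ler0_norm a0).
apply/eqP; rewrite eq_sym -addr_eq0 -scalar_of_realD addNr.
by rewrite scalar_of_real0.
Qed.

End Scalars.

HB.mixin Record Lmodule_isModular (R : realType) (k : scalar_kind) V
    & GRing.Lmodule (scalars R k) V := {
  modular : V -> R;
  modular_ge0 : forall x, 0 <= modular x;
  modular0 : modular 0 = 0;
  modular_unit : forall (l : scalars R k) (x : V),
    `|l| = 1 -> modular (l *: x) = modular x;
  modular_eq0 : forall x, modular x = 0 -> x = 0;
  modular_convex : forall (t : R) (x y : V), 0 <= t <= 1 ->
    modular (scalar_of_real t *: x + scalar_of_real (1 - t) *: y)
      <= t * modular x + (1 - t) * modular y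
}.

#[short(type="modularType")]
HB.structure Definition Modular (R : realType) (k : scalar_kind) :=
  {V of GRing.Lmodule (scalars R k) V & Lmodule_isModular R k V}.

Section Luxemburg.
Context {R : realType} {k : scalar_kind}.

Definition luxemburg_norm (X : modularType R k) (x : X) : R :=
  inf [set l : R | 0 < l /\ modular ((scalar_of_real l)^-1 *: x) <= 1].

(* An alias carrying the Luxemburg norm, because a modular space may already have
   a norm of its own, as in [square_modular] below. *)
Definition luxemburg (X : modularType R k) : Type := X.

Variable X : modularType R k.
Implicit Types (x y : X).

Let S x := [set l : R | 0 < l /\ modular ((scalar_of_real l)^-1 *: x) <= 1].

Let modular_contract (t : R) x : 0 <= t <= 1 ->
  modular (scalar_of_real t *: x) <= t * modular x.
Proof.
move=> t01; have := modular_convex t x 0 t01.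
by rewrite scaler0 addr0 modular0 mulr0 addr0.
Qed.

Let S_neq0 x : S x !=set0.
Proof.
pose l := modular x + 1.
have l0 : 0 < l by rewrite ltr_wpDl ?modular_ge0.
exists l; split => //; rewrite -scalar_of_realV.
apply: le_trans (modular_contract _ _) _.
  by rewrite invr_ge0 (ltW l0) /= invf_le1 // lerDr modular_ge0.
by rewrite ler_pdivrMl // mulr1 lerDl ler01.
Qed.

Let S_lb x : has_lbound (S x).
Proof. by exists 0 => l [/ltW]. Qed.

Let S_has_inf x : has_inf (S x). Proof. by split; [exact: S_neq0|exact: S_lb]. Qed.

Lemma luxemburg_norm_ge0 x : 0 <= luxemburg_norm x.
Proof. by apply: lb_le_inf => [|l [/ltW]]; [exact: S_neq0|]. Qed.

Let S_add x y a b : S x a -> S y b -> S (x + y) (a + b).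
Proof.
move=> [a0 xa] [b0 yb]; have ab0 : 0 < a + b by rewrite addr_gt0.
split => //.
have abn : a + b != 0 by rewrite gt_eqF.
pose t := a / (a + b).
have t1 : 1 - t = b / (a + b).
  by rewrite /t -{1}(divff abn) -mulrBl addrAC subrr add0r.
have t01 : 0 <= t <= 1.
  rewrite /t divr_ge0 ?(ltW a0) ?(ltW ab0) //=.
  by rewrite ler_pdivrMr // mul1r lerDl (ltW b0).
have -> : (scalar_of_real (a + b))^-1 *: (x + y) =
    scalar_of_real t *: ((scalar_of_real a)^-1 *: x) +
    scalar_of_real (1 - t) *: ((scalar_of_real b)^-1 *: y).
  rewrite t1 /t !scalerA -!scalar_of_realV -!scalar_of_realM scalerDr.
  by rewrite mulrAC divff ?gt_eqF // mul1r mulrAC divff ?gt_eqF // mul1r.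
apply: le_trans (modular_convex _ _ _ t01) _.
rewrite [leRHS](_ : 1 = t + (1 - t)); last by rewrite addrC subrK.
rewrite lerD //.
  by rewrite ler_piMr //; case/andP: t01.
by rewrite ler_piMr // subr_ge0; case/andP: t01.
Qed.

Lemma ler_luxemburgD x y :
  luxemburg_norm (x + y) <= luxemburg_norm x + luxemburg_norm y.
Proof.
apply/ler_addgt0Pr => e e0.
have e20 : 0 < e / 2 by rewrite divr_gt0.
have [a Sa ax] := inf_adherent e20 (S_has_inf x).
have [b Sb yb] := inf_adherent e20 (S_has_inf y).
apply: (@le_trans _ _ (a + b)); first exact: (ge_inf (S_lb _) (S_add Sa Sb)).
apply: ltW; apply: lt_le_trans (ltrD ax yb) _.
by rewrite addrACA -splitr.
Qed.

Let S_scale (m : scalars R k) x a : m != 0 -> S x a -> S (m *: x) (rnorm m * a).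
Proof.
move=> m0 [a0 xa].
have rm0 : 0 < rnorm m.
  by rewrite lt0r rnorm_ge0 andbT; apply: contraNneq m0 => /rnorm_eq0 ->.
split; first by rewrite mulr_gt0.
rewrite scalerA scalar_of_realM invfM mulrAC -scalerA modular_unit //.
by rewrite rnormE normrM normfV normr_id mulVf // normr_eq0.
Qed.

Lemma luxemburg_normZ (m : scalars R k) x :
  luxemburg_norm (m *: x) = rnorm m * luxemburg_norm x.
Proof.
have le m' y : m' != 0 -> luxemburg_norm (m' *: y) <= rnorm m' * luxemburg_norm y.
  move=> m0.
  have rm0 : 0 < rnorm m'.
    by rewrite lt0r rnorm_ge0 andbT; apply: contraNneq m0 => /rnorm_eq0 ->.
  rewrite mulrC -ler_pdivrMr //; apply: lb_le_inf => [|a Sa]; first exact: S_neq0.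
  by rewrite ler_pdivrMr // mulrC; exact: (ge_inf (S_lb _) (S_scale m0 Sa)).
have [->|m0] := eqVneq m 0.
  rewrite scale0r rnorm0 mul0r; apply/eqP; rewrite eq_le luxemburg_norm_ge0 andbT.
  apply/ler_addgt0Pr => e e0; rewrite add0r; apply: (ge_inf (S_lb _)).
  by split => //; rewrite scaler0 modular0.
apply/eqP; rewrite eq_le le //=.
have rm0 : 0 < rnorm m.
  by rewrite lt0r rnorm_ge0 andbT; apply: contraNneq m0 => /rnorm_eq0 ->.
have := @le m^-1 (m *: x); rewrite invr_eq0 => /(_ m0).
rewrite scalerA mulVf // scale1r.
have -> : rnorm m^-1 = (rnorm m)^-1.
  by apply: (@scalar_of_real_inj R k); rewrite scalar_of_realV !rnormE normfV.
by rewrite mulrC ler_pdivlMr // mulrC.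
Qed.

Lemma luxemburg_norm_eq0 x : luxemburg_norm x = 0 -> x = 0.
Proof.
move=> x0; apply: modular_eq0; apply/eqP; rewrite eq_le modular_ge0 andbT.
apply/ler_addgt0Pr => e e0; rewrite add0r.
pose d := Num.min e 1.
have d0 : 0 < d by rewrite lt_min e0 ltr01.
have [a [a0 xa]] := inf_adherent d0 (S_has_inf x).
rewrite -/(luxemburg_norm x) x0 add0r lt_min => /andP[ae a1].
have -> : x = scalar_of_real a *: ((scalar_of_real a)^-1 *: x).
  by rewrite scalerA -scalar_of_realV -scalar_of_realM divff ?gt_eqF //
     scalar_of_real1 scale1r.
apply: le_trans (modular_contract _ _) _; first by rewrite (ltW a0) (ltW a1).
by apply: le_trans (ltW ae); rewrite ler_piMr // ltW.
Qed.

HB.instance Definition _ := GRing.Lmodule.on (luxemburg X).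

Let norm (x : luxemburg X) : scalars R k := scalar_of_real (@luxemburg_norm X x).

Let normD (x y : luxemburg X) : norm (x + y) <= norm x + norm y.
Proof. by rewrite -scalar_of_realD scalar_of_real_le ler_luxemburgD. Qed.

Let normZ (l : scalars R k) (x : luxemburg X) : norm (l *: x) = `|l| * norm x.
Proof. by rewrite /norm luxemburg_normZ scalar_of_realM rnormE. Qed.

Let norm_eq0 (x : luxemburg X) : norm x = 0 -> x = 0.
Proof.
by rewrite -scalar_of_real0 => /scalar_of_real_inj /luxemburg_norm_eq0.
Qed.

HB.instance Definition _ :=
  @Lmodule_isNormed.Build (scalars R k) (luxemburg X) norm normD normZ norm_eq0.

Lemma rnorm_luxemburg (x : luxemburg X) : rnorm x = @luxemburg_norm X x.
Proof. by apply: (@scalar_of_real_inj R k); rewrite rnormE. Qed.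

End Luxemburg.

Section ModularSum.
Context {R : realType} {k : scalar_kind}.
Variables X1 X2 : modularType R k.

Definition modular_sum : Type := (X1 * X2)%type.

HB.instance Definition _ := GRing.Lmodule.copy modular_sum (X1 * X2)%type.

Let Theta (x : modular_sum) : R := modular x.1 + modular x.2.

Let Theta_ge0 x : 0 <= Theta x.
Proof. by rewrite addr_ge0 ?modular_ge0. Qed.

Let Theta0 : Theta 0 = 0.
Proof. by rewrite /Theta !modular0 addr0. Qed.

Let Theta_unit (l : scalars R k) (x : modular_sum) :
  `|l| = 1 -> Theta (l *: x) = Theta x.
Proof. by move=> l1; rewrite /Theta !modular_unit. Qed.

Let Theta_eq0 x : Theta x = 0 -> x = 0.
Proof.
move=> /eqP; rewrite paddr_eq0 ?modular_ge0// => /andP[/eqP x1 /eqP x2].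
by case: x x1 x2 => a b /= /modular_eq0 -> /modular_eq0 ->.
Qed.

Let Theta_convex (t : R) (x y : modular_sum) : 0 <= t <= 1 ->
  Theta (scalar_of_real t *: x + scalar_of_real (1 - t) *: y)
    <= t * Theta x + (1 - t) * Theta y.
Proof. by move=> t01; rewrite !mulrDr addrACA lerD // modular_convex. Qed.

HB.instance Definition _ := @Lmodule_isModular.Build R k modular_sum
  Theta Theta_ge0 Theta0 Theta_unit Theta_eq0 Theta_convex.

Lemma modular_sumE (x : modular_sum) : modular x = modular x.1 + modular x.2.
Proof. by []. Qed.

End ModularSum.

Section PowRConvex.
Context {R : realType}.

Lemma powR_convex (p t a b : R) : 1 <= p -> 0 <= t <= 1 -> 0 <= a -> 0 <= b ->
  (t * a + (1 - t) * b) `^ p <= t * a `^ p + (1 - t) * b `^ p.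
Proof.
move=> p1 /andP[t0 t1] a0 b0.
by apply: (convex_powR p1 (Itv01 t0 t1)); rewrite inE /= in_itv /= andbT.
Qed.

End PowRConvex.

Section SquareModular.
Context {R : realType} {k : scalar_kind}.

Lemma rnorm_powR_convex (V : normedModType (scalars R k)) (p t : R) (x y : V) :
  1 <= p -> 0 <= t <= 1 ->
  rnorm (scalar_of_real t *: x + scalar_of_real (1 - t) *: y) `^ p
    <= t * rnorm x `^ p + (1 - t) * rnorm y `^ p.
Proof.
move=> p1 t01; have /andP[t0 t1] := t01.
apply: le_trans (powR_convex p1 t01 (rnorm_ge0 x) (rnorm_ge0 y)).
apply: ge0_ler_powR; rewrite ?nnegrE ?rnorm_ge0 //; first exact: le_trans p1.
  by rewrite addr_ge0 // mulr_ge0 ?rnorm_ge0 // subr_ge0.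
apply: le_trans (ler_rnormD _ _) _.
by rewrite !rnormZ !rnorm_scalar !ger0_norm // subr_ge0.
Qed.

Definition square_modular (V : normedModType (scalars R k)) : Type := V.

Variable V : normedModType (scalars R k).

HB.instance Definition _ := GRing.Lmodule.copy (square_modular V) V.

Let Theta (x : square_modular V) : R := rnorm (x : V) ^+ 2.

Let Theta_ge0 x : 0 <= Theta x.
Proof. by rewrite exprn_ge0 // rnorm_ge0. Qed.

Let Theta0 : Theta 0 = 0.
Proof. by rewrite /Theta rnorm0 expr0n. Qed.

Let Theta_unit (l : scalars R k) (x : square_modular V) :
  `|l| = 1 -> Theta (l *: x) = Theta x.
Proof.
move=> l1; rewrite /Theta rnormZ (_ : rnorm l = 1) ?mul1r //.
by apply: (@scalar_of_real_inj R k); rewrite rnormE l1 scalar_of_real1.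
Qed.

Let Theta_eq0 x : Theta x = 0 -> x = 0.
Proof. by move=> /eqP; rewrite sqrf_eq0 => /eqP /rnorm_eq0. Qed.

Let Theta_convex (t : R) (x y : square_modular V) : 0 <= t <= 1 ->
  Theta (scalar_of_real t *: x + scalar_of_real (1 - t) *: y)
    <= t * Theta x + (1 - t) * Theta y.
Proof.
move=> t01; rewrite /Theta -!powR_mulrn ?rnorm_ge0 //.
by apply: rnorm_powR_convex => //; rewrite ler1n.
Qed.

HB.instance Definition _ := @Lmodule_isModular.Build R k (square_modular V)
  Theta Theta_ge0 Theta0 Theta_unit Theta_eq0 Theta_convex.

Lemma square_modularE (x : square_modular V) : modular x = rnorm (x : V) ^+ 2.
Proof. by []. Qed.

End SquareModular.

Record exponents (R : realType) := Exponents {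
  exponent :> nat -> R;
  exponent_ge1 : forall n, 1 <= exponent n;
  exponent_bounded : exists M : R, forall n, exponent n <= M
}.

Section Nakano.
Context {R : realType} {k : scalar_kind}.
Variable p : exponents R.

Definition nakano_modular (x : nat -> scalars R k) : \bar R :=
  (\sum_(0 <= n <oo) (rnorm (x n) `^ p n)%:E)%E.

Definition nakano : set (nat -> scalars R k) :=
  [set x | (nakano_modular x < +oo)%E].

(* The norms [`|x n|] are scalars, so they form a scalar sequence as required. *)
Record nakano_sum (E : nat -> normedModType (scalars R k)) : Type := NakanoSum {
  nakano_val :> forall n, E n;
  nakano_valP : nakano (fun n => `|nakano_val n|)
}.

Variable E : nat -> normedModType (scalars R k).

Let T (x : forall n, E n) : \bar R := nakano_modular (fun n => `|x n|).

Let TE x : T x = (\sum_(0 <= n <oo) (rnorm (x n) `^ p n)%:E)%E.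
Proof. by apply: eq_eseriesr => n _; rewrite rnormr_id. Qed.

Let T_ge0 x : (0 <= T x)%E.
Proof. by apply: nneseries_ge0 => n _ _; rewrite lee_fin powR_ge0. Qed.

Let T_convex (t : R) (x y : forall n, E n) : 0 <= t <= 1 ->
  (T (fun n => (scalar_of_real t *: x n + scalar_of_real (1 - t) *: y n)%R)
    <= t%:E * T x + (1 - t)%:E * T y)%E.
Proof.
move=> t01; have /andP[t0 t1] := t01; rewrite !TE.
rewrite -!nneseriesZl; do ?by move=> n _; rewrite lee_fin powR_ge0.
rewrite -nneseriesD; first last.
- by move=> n _ _; rewrite -EFinM lee_fin mulr_ge0 ?powR_ge0 ?subr_ge0.
- by move=> n _ _; rewrite -EFinM lee_fin mulr_ge0 ?powR_ge0.
apply: lee_nneseries => n _; first by rewrite lee_fin powR_ge0.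
by rewrite -!EFinM -EFinD lee_fin rnorm_powR_convex // exponent_ge1.
Qed.

Let T_scale (l : scalars R k) (x : forall n, E n) : (T x < +oo)%E ->
  (T (fun n => (l *: x n)%R) < +oo)%E.
Proof.
have [M pM] := exponent_bounded p.
pose c := Num.max 1 (rnorm l).
have c1 : 1 <= c by rewrite le_max lexx.
move=> Tx; apply: (@le_lt_trans _ _ ((c `^ M)%:E * T x)%E); last first.
  by rewrite lte_mul_pinfty // lee_fin powR_ge0.
rewrite !TE -nneseriesZl; last by move=> n _; rewrite lee_fin powR_ge0.
apply: lee_nneseries => n _; first by rewrite lee_fin powR_ge0.
rewrite -EFinM lee_fin rnormZ powRM ?rnorm_ge0 // ler_wpM2r ?powR_ge0 //.
apply: (@le_trans _ _ (c `^ p n)); last by rewrite ler_powR.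
apply: ge0_ler_powR; rewrite ?nnegrE ?rnorm_ge0 //.
- exact: le_trans (exponent_ge1 p n).
- exact: le_trans c1.
- by rewrite le_max lexx orbT.
Qed.

Let T_add (x y : forall n, E n) : (T x < +oo)%E -> (T y < +oo)%E ->
  (T (fun n => (x n + y n)%R) < +oo)%E.
Proof.
move=> Tx Ty; pose h : R := 2^-1.
have h01 : 0 <= h <= 1 by rewrite /h invr_ge0 ler0n /= invf_le1 // ler1n.
have h1 : 1 - h = h by rewrite /h {1}(splitr 1) mul1r addrK.
have -> : (fun n => x n + y n) = (fun n =>
    scalar_of_real h *: ((scalar_of_real h)^-1 *: x n)
    + scalar_of_real (1 - h) *: ((scalar_of_real h)^-1 *: y n)).
  apply: functional_extensionality_dep => n; rewrite h1 !scalerA -scalar_of_realV.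
  by rewrite -scalar_of_realM divff ?scalar_of_real1 ?scale1r // invr_eq0.
apply: le_lt_trans (T_convex _ _ h01) _.
have /andP[h0 h1'] := h01.
rewrite lte_add_pinfty // lte_mul_pinfty ?lee_fin ?subr_ge0 //; exact: T_scale.
Qed.

Let T0 : T (fun=> 0) = 0%E.
Proof.
rewrite TE eseries0 // => n _ _; rewrite rnorm0 powR0 //.
by rewrite gt_eqF // (lt_le_trans _ (exponent_ge1 p n)).
Qed.

Lemma nakano_sumP (x y : nakano_sum E) : (forall n, x n = y n) -> x = y.
Proof.
case: x y => [x xP] [y yP] /= xy.
have {}xy : x = y by exact: functional_extensionality_dep.
by subst y; congr NakanoSum; exact: Prop_irrelevance.
Qed.

HB.instance Definition _ := gen_eqMixin (nakano_sum E).
HB.instance Definition _ := gen_choiceMixin (nakano_sum E).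

Let zeroP : nakano (fun n => `|0 : E n|).
Proof. by rewrite /nakano /= -/(T _) T0. Qed.

Definition nakano_zero : nakano_sum E := @NakanoSum E (fun=> 0) zeroP.

Definition nakano_scale (l : scalars R k) (x : nakano_sum E) : nakano_sum E :=
  @NakanoSum E (fun n => l *: x n) (T_scale l (nakano_valP x)).

Definition nakano_add (x y : nakano_sum E) : nakano_sum E :=
  @NakanoSum E (fun n => x n + y n) (T_add (nakano_valP x) (nakano_valP y)).

Definition nakano_opp : nakano_sum E -> nakano_sum E := nakano_scale (-1).

Let addA : associative nakano_add.
Proof. by move=> x y z; apply: nakano_sumP => n /=; rewrite addrA. Qed.
Let addC : commutative nakano_add.
Proof. by move=> x y; apply: nakano_sumP => n /=; rewrite addrC. Qed.
Let add0 : left_id nakano_zero nakano_add.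
Proof. by move=> x; apply: nakano_sumP => n /=; rewrite add0r. Qed.
Let addN : left_inverse nakano_zero nakano_opp nakano_add.
Proof. by move=> x; apply: nakano_sumP => n /=; rewrite scaleN1r addNr. Qed.

HB.instance Definition _ :=
  GRing.isZmodule.Build (nakano_sum E) addA addC add0 addN.

Let scaleA (a b : scalars R k) (x : nakano_sum E) :
  nakano_scale a (nakano_scale b x) = nakano_scale (a * b) x.
Proof. by apply: nakano_sumP => n /=; rewrite scalerA. Qed.
Let scale1 : left_id 1 nakano_scale.
Proof. by move=> x; apply: nakano_sumP => n /=; rewrite scale1r. Qed.
Let scaleDr : right_distributive nakano_scale +%R.
Proof. by move=> a x y; apply: nakano_sumP => n /=; rewrite scalerDr. Qed.
Let scaleDl (x : nakano_sum E) : {morph nakano_scale^~ x : a b / a + b}.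
Proof. by move=> a b; apply: nakano_sumP => n /=; rewrite scalerDl. Qed.

HB.instance Definition _ := GRing.Zmodule_isLmodule.Build
  (scalars R k) (nakano_sum E) scaleA scale1 scaleDr scaleDl.

Let Theta (x : nakano_sum E) : R := fine (nakano_modular (fun n => `|x n|)).

Let ThetaE x : (Theta x)%:E = T x.
Proof. by rewrite fineK // ge0_fin_numE ?T_ge0 //; exact: nakano_valP. Qed.

Let Theta_ge0 x : 0 <= Theta x. Proof. exact: fine_ge0 (T_ge0 _). Qed.

Let Theta0 : Theta 0 = 0. Proof. by rewrite /Theta -/(T _) T0. Qed.

Let Theta_unit (l : scalars R k) (x : nakano_sum E) :
  `|l| = 1 -> Theta (l *: x) = Theta x.
Proof.
move=> l1; rewrite /Theta; congr (fine (nakano_modular _)).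
by apply/funext => n; rewrite normrZ l1 mul1r.
Qed.

Let Theta_eq0 x : Theta x = 0 -> x = 0.
Proof.
move=> x0; have := ThetaE x; rewrite x0 TE => /esym s0.
apply: nakano_sumP => n /=; apply: rnorm_eq0.
have /eqP : rnorm (x n) `^ p n = 0.
  apply/eqP; rewrite eq_le powR_ge0 andbT -lee_fin -s0.
  rewrite (@nneseriesD1 R _ n xpredT) //; last by move=> i _; rewrite lee_fin powR_ge0.
  by rewrite leeDl // nneseries_ge0 // => i _ _; rewrite lee_fin powR_ge0.
by rewrite powR_eq0 => /andP[/eqP].
Qed.

Let Theta_convex (t : R) (x y : nakano_sum E) : 0 <= t <= 1 ->
  Theta (scalar_of_real t *: x + scalar_of_real (1 - t) *: y)
    <= t * Theta x + (1 - t) * Theta y.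
Proof.
by move=> t01; rewrite -lee_fin EFinD !EFinM !ThetaE; exact: T_convex.
Qed.

HB.instance Definition _ := @Lmodule_isModular.Build R k (nakano_sum E)
  Theta Theta_ge0 Theta0 Theta_unit Theta_eq0 Theta_convex.

Lemma nakano_sum_modularE (x : nakano_sum E) :
  (modular x)%:E = (\sum_(0 <= n <oo) (rnorm (x n) `^ p n)%:E)%E.
Proof. by rewrite -TE -ThetaE. Qed.

End Nakano.

Section UltraLimit.
Context {R : realType} {I : Type}.

Lemma ultra_fmap (T : Type) (U : set_system I) (f : I -> T) :
  UltraFilter U -> UltraFilter (f @ U).
Proof.
move=> UU; split=> [|G PG UG]; first exact: fmap_proper_filter.
rewrite eqEsubset; split => // A GA.
have [//|UnA] := in_ultra_setVsetC (f @^-1` A) UU.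
have GnA : G (~` A) by apply: UG.
by exfalso; apply: (@filter_not_empty _ G); rewrite -(setICr A); exact: filterI.
Qed.

Lemma ultra_bounded_cvg (U : set_system I) (f : I -> R) :
  UltraFilter U -> (exists M : R, forall i, `|f i| <= M) -> cvg (f @ U).
Proof.
move=> UU [M fM]; have := @segment_compact R (- M) M.
rewrite compact_ultra => /(_ _ (ultra_fmap f UU)) [].
  by apply: (@filterE _ U) => i /=; rewrite in_itv /= -ler_norml.
by move=> l [_ fl]; apply/cvg_ex; exists l.
Qed.

End UltraLimit.

Section Ultrapower.
Context {R : realType} {k : scalar_kind} {I : Type}.

Record bounded_family (X : normedModType (scalars R k)) : Type := BoundedFamily {
  family_val :> I -> X;
  family_valP : exists M : R, forall i, rnorm (family_val i) <= M
}.

Section BoundedFamily.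
Variable X : normedModType (scalars R k).

Lemma bounded_familyP (x y : bounded_family X) : (forall i, x i = y i) -> x = y.
Proof.
case: x y => [x xP] [y yP] /= xy.
have {}xy : x = y by exact/funext.
by subst y; congr BoundedFamily; exact: Prop_irrelevance.
Qed.

HB.instance Definition _ := gen_eqMixin (bounded_family X).
HB.instance Definition _ := gen_choiceMixin (bounded_family X).

Let zeroP : exists M : R, forall i : I, rnorm (0 : X) <= M.
Proof. by exists 0 => i; rewrite rnorm0. Qed.

Let scaleP (l : scalars R k) (x : bounded_family X) :
  exists M : R, forall i, rnorm (l *: x i) <= M.
Proof.
have [M xM] := family_valP x; exists (rnorm l * M) => i.
by rewrite rnormZ ler_wpM2l ?rnorm_ge0.
Qed.

Let addP (x y : bounded_family X) :
  exists M : R, forall i, rnorm (x i + y i) <= M.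
Proof.
have [M xM] := family_valP x; have [N yN] := family_valP y; exists (M + N) => i.
by apply: le_trans (ler_rnormD _ _) _; rewrite lerD.
Qed.

Definition family_zero : bounded_family X := BoundedFamily zeroP.
Definition family_scale (l : scalars R k) (x : bounded_family X) :=
  BoundedFamily (scaleP l x).
Definition family_add (x y : bounded_family X) := BoundedFamily (addP x y).
Definition family_opp : bounded_family X -> bounded_family X :=
  family_scale (-1).

Let addA : associative family_add.
Proof. by move=> x y z; apply: bounded_familyP => n /=; rewrite addrA. Qed.
Let addC : commutative family_add.
Proof. by move=> x y; apply: bounded_familyP => n /=; rewrite addrC. Qed.
Let add0 : left_id family_zero family_add.
Proof. by move=> x; apply: bounded_familyP => n /=; rewrite add0r. Qed.
Let addN : left_inverse family_zero family_opp family_add.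
Proof. by move=> x; apply: bounded_familyP => n /=; rewrite scaleN1r addNr. Qed.

HB.instance Definition _ :=
  GRing.isZmodule.Build (bounded_family X) addA addC add0 addN.

Let scaleA (a b : scalars R k) (x : bounded_family X) :
  family_scale a (family_scale b x) = family_scale (a * b) x.
Proof. by apply: bounded_familyP => n /=; rewrite scalerA. Qed.
Let scale1 : left_id 1 family_scale.
Proof. by move=> x; apply: bounded_familyP => n /=; rewrite scale1r. Qed.
Let scaleDr : right_distributive family_scale +%R.
Proof. by move=> a x y; apply: bounded_familyP => n /=; rewrite scalerDr. Qed.
Let scaleDl (x : bounded_family X) : {morph family_scale^~ x : a b / a + b}.
Proof. by move=> a b; apply: bounded_familyP => n /=; rewrite scalerDl. Qed.

HB.instance Definition _ := GRing.Zmodule_isLmodule.Build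
  (scalars R k) (bounded_family X) scaleA scale1 scaleDr scaleDl.

Lemma familyDE (x y : bounded_family X) i : (x + y) i = x i + y i.
Proof. by []. Qed.
Lemma familyZE (l : scalars R k) (x : bounded_family X) i : (l *: x) i = l *: x i.
Proof. by []. Qed.
Lemma familyNE (x : bounded_family X) i : (- x) i = - x i.
Proof. by rewrite -scaleN1r familyZE scaleN1r. Qed.

End BoundedFamily.

Variables (U : set_system I) (UU : UltraFilter U).
Variable X : normedModType (scalars R k).
Implicit Types x y : bounded_family X.

Definition ultranorm x : R := lim (rnorm (x i) @[i --> U]).

Lemma ultranorm_cvg x : rnorm (x i) @[i --> U] --> ultranorm x.
Proof.
apply: ultra_bounded_cvg; have [M xM] := family_valP x; exists M => i.
by rewrite ger0_norm ?rnorm_ge0.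
Qed.

Lemma ultranormD x y : ultranorm (x + y) <= ultranorm x + ultranorm y.
Proof.
rewrite -subr_ge0.
apply: (cvgr_to_ge (cvgB (cvgD (@ultranorm_cvg x) (@ultranorm_cvg y))
  (@ultranorm_cvg (x + y)))).
by apply: (@filterE _ U) => i /=; rewrite subr_ge0 ler_rnormD.
Qed.

Lemma ultranormZ (l : scalars R k) x : ultranorm (l *: x) = rnorm l * ultranorm x.
Proof.
apply: (@cvg_lim _ (@Rhausdorff R)).
under eq_fun do rewrite familyZE rnormZ.
exact: cvgMr (@ultranorm_cvg x).
Qed.

Lemma ultranormN x : ultranorm (- x) = ultranorm x.
Proof.
by rewrite /ultranorm; under eq_fun do rewrite familyNE rnormN.
Qed.

Lemma ultranorm0 : ultranorm 0 = 0.
Proof. by rewrite -(scale0r 0) ultranormZ rnorm0 mul0r. Qed.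

Lemma ultranorm_ge0 x : 0 <= ultranorm x.
Proof.
have := ultranormD x (- x); rewrite subrr ultranorm0 ultranormN -mulr2n.
by rewrite pmulrn_lge0.
Qed.

(* The ultrapower is the quotient of the space of bounded families by the families
   whose norms tend to 0 along [U], with the norm [ultranorm]. *)
Definition ultra_equiv x y : bool := ultranorm (x - y) == 0.

Let ultra_equiv_refl : reflexive ultra_equiv.
Proof. by move=> x; rewrite /ultra_equiv subrr ultranorm0. Qed.

Let ultra_equiv_sym : symmetric ultra_equiv.
Proof. by move=> x y; rewrite /ultra_equiv -ultranormN opprB. Qed.

Let ultra_equiv_trans : transitive ultra_equiv.
Proof.
move=> y x z /eqP xy /eqP yz; rewrite /ultra_equiv eq_le ultranorm_ge0 andbT.
by have := ultranormD (x - y) (y - z); rewrite xy yz addr0 subrKA.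
Qed.

Canonical ultra_equiv_rel :=
  EquivRel ultra_equiv ultra_equiv_refl ultra_equiv_sym ultra_equiv_trans.

Local Open Scope quotient_scope.

Definition ultrapower : Type := {eq_quot ultra_equiv_rel}.

HB.instance Definition _ := Choice.on ultrapower.
HB.instance Definition _ := EqQuotient.on ultrapower.

Definition ultra_class x : ultrapower := \pi_ultrapower x.

Lemma ultra_classP x y : ultra_class x = ultra_class y <-> ultranorm (x - y) = 0.
Proof.
by split=> [/eqP|xy]; [rewrite eqmodE => /eqP|apply/eqP; rewrite eqmodE; exact/eqP].
Qed.

Let repr_class x : ultranorm (repr (ultra_class x) - x) = 0.
Proof. by apply/ultra_classP; rewrite /ultra_class reprK. Qed.

Let classK (q : ultrapower) : ultra_class (repr q) = q.
Proof. by rewrite /ultra_class reprK. Qed.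

Definition ultra_add (q r : ultrapower) := ultra_class (repr q + repr r).
Definition ultra_opp (q : ultrapower) := ultra_class (- repr q).
Definition ultra_scale (l : scalars R k) (q : ultrapower) :=
  ultra_class (l *: repr q).

Let class_add x y : ultra_add (ultra_class x) (ultra_class y) = ultra_class (x + y).
Proof.
apply/ultra_classP/eqP; rewrite eq_le ultranorm_ge0 andbT.
have := ultranormD (repr (ultra_class x) - x) (repr (ultra_class y) - y).
by rewrite !repr_class addr0 addrACA opprD.
Qed.

Let class_scale (l : scalars R k) x :
  ultra_scale l (ultra_class x) = ultra_class (l *: x).
Proof.
by apply/ultra_classP; rewrite -scalerBr ultranormZ repr_class mulr0.
Qed.

Let class_opp x : ultra_opp (ultra_class x) = ultra_class (- x).
Proof.
by apply/ultra_classP; rewrite -opprD ultranormN repr_class.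
Qed.

Let addA : associative ultra_add.
Proof.
move=> q r s; rewrite -(classK q) -(classK r) -(classK s) !class_add.
by rewrite addrA.
Qed.
Let addC : commutative ultra_add.
Proof. by move=> q r; rewrite /ultra_add addrC. Qed.
Let add0 : left_id (ultra_class 0) ultra_add.
Proof. by move=> q; rewrite -(classK q) class_add add0r. Qed.
Let addN : left_inverse (ultra_class 0) ultra_opp ultra_add.
Proof. by move=> q; rewrite -(classK q) class_opp class_add addNr. Qed.

HB.instance Definition _ :=
  GRing.isZmodule.Build ultrapower addA addC add0 addN.

Lemma ultra_classD x y : ultra_class (x + y) = ultra_class x + ultra_class y.
Proof. by rewrite -class_add. Qed.

Let scaleA (a b : scalars R k) (q : ultrapower) :
  ultra_scale a (ultra_scale b q) = ultra_scale (a * b) q.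
Proof. by rewrite -(classK q) !class_scale scalerA. Qed.
Let scale1 : left_id 1 ultra_scale.
Proof. by move=> q; rewrite -(classK q) class_scale scale1r. Qed.
Let scaleDr : right_distributive ultra_scale +%R.
Proof.
move=> a q r; rewrite -(classK q) -(classK r) -ultra_classD !class_scale.
by rewrite -ultra_classD scalerDr.
Qed.
Let scaleDl (q : ultrapower) : {morph ultra_scale^~ q : a b / a + b}.
Proof.
by move=> a b; rewrite -(classK q) !class_scale -ultra_classD scalerDl.
Qed.

HB.instance Definition _ := GRing.Zmodule_isLmodule.Build
  (scalars R k) ultrapower scaleA scale1 scaleDr scaleDl.

Lemma ultra_classZ (l : scalars R k) x : ultra_class (l *: x) = l *: ultra_class x.
Proof. by rewrite -class_scale. Qed.

Let norm (q : ultrapower) : scalars R k := scalar_of_real (ultranorm (repr q)).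

Let norm_class x : ultranorm (repr (ultra_class x)) = ultranorm x.
Proof.
apply/eqP; rewrite eq_le; apply/andP; split.
  by have := ultranormD (repr (ultra_class x) - x) x; rewrite subrK repr_class add0r.
have := ultranormD (x - repr (ultra_class x)) (repr (ultra_class x)).
by rewrite subrK -[ultranorm (x - _)]ultranormN opprB repr_class add0r.
Qed.

Let normD (q r : ultrapower) : norm (q + r) <= norm q + norm r.
Proof.
rewrite -scalar_of_realD scalar_of_real_le [X in X <= _]norm_class.
exact: ultranormD.
Qed.

Let normZ (l : scalars R k) (q : ultrapower) : norm (l *: q) = `|l| * norm q.
Proof.
by rewrite /norm [ultranorm _]norm_class ultranormZ scalar_of_realM rnormE.
Qed.

Let norm_eq0 (q : ultrapower) : norm q = 0 -> q = 0.
Proof.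
rewrite -scalar_of_real0 => /scalar_of_real_inj q0.
by rewrite -(classK q); apply/ultra_classP; rewrite subr0.
Qed.

HB.instance Definition _ :=
  @Lmodule_isNormed.Build (scalars R k) ultrapower norm normD normZ norm_eq0.

Lemma rnorm_ultra_class x : rnorm (ultra_class x) = ultranorm x.
Proof.
by apply: (@scalar_of_real_inj R k); rewrite rnormE -norm_class.
Qed.

End Ultrapower.

Section Banach.
Context {R : realType} {k : scalar_kind}.
Implicit Types X Y E H : normedModType (scalars R k).

(* Completeness is a predicate here, with the same content as the axiom of
   [completeNormedModType], so that membership of a constructed space in an
   elementary class asserts its completeness. *)
Definition banach X : Prop :=
  forall F : set_system X, ProperFilter F -> cauchy F -> cvg F.

(* [ip] is linear on the left and conjugate linear on the right. *)
Definition hilbert H : Prop :=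
  banach H /\ exists ip : {dot H for scalar_conj}, forall x, ip x x = `|x| ^+ 2.

Definition finite_dim X : Prop :=
  exists (n : nat) (e : 'I_n -> X), forall x, exists c : 'I_n -> scalars R k,
    x = \sum_(i < n) c i *: e i.

Definition isometric X Y : Prop :=
  exists f : {linear X -> Y}, bijective f /\ forall x, `|f x| = `|x|.

Definition jordan_von_neumann X : R :=
  2^-1 * sup [set r : R | exists x y : X, rnorm x ^+ 2 + rnorm y ^+ 2 = 1 /\
                                r = rnorm (x + y) ^+ 2 + rnorm (x - y) ^+ 2].

Definition elementarily_equivalent X Y : Prop :=
  exists (I J : Type) (U : set_system I) (V : set_system J)
         (UU : UltraFilter U) (VV : UltraFilter V),
    isometric (ultrapower UU X) (ultrapower VV Y).

Definition elementary_class X Y : Prop :=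
  banach Y /\ elementarily_equivalent Y X.

(* The cardinal is that of the type [kappa]; the density character is the least
   cardinality of a dense subset. *)
Definition has_density X (kappa : Type) : Prop :=
  (exists D : set X, dense D /\ (D #= [set: kappa])%card) /\
  (forall D : set X, dense D -> ([set: kappa] #<= D)%card).

Definition uncountably_categorical X : Prop :=
  [/\ banach X, ~ finite_dim X &
    exists kappa : Type, ~ countable [set: kappa] /\
      exists Y, [/\ elementary_class X Y, has_density Y kappa &
        forall Z, elementary_class X Z -> has_density Z kappa -> isometric Z Y]].

Definition nakano_direct_sum (p : exponents R)
    (E : nat -> normedModType (scalars R k)) : normedModType (scalars R k) :=
  luxemburg (nakano_sum p E).

Definition nakano_sum_hilbert (p : exponents R)
    (E : nat -> normedModType (scalars R k)) H : normedModType (scalars R k) :=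
  luxemburg (modular_sum (nakano_sum p E) (square_modular H)).

End Banach.

(* Main.v *)
(* Write E +m H for the modular direct sum.  Since p_n -> 2 and a(E_n) -> 1, the
   tails of E are asymptotically Hilbertian.  In an ultrapower of E +m H the classes
   of families tending to 0 in every coordinate of E therefore satisfy the
   parallelogram law, and the modular splits along them (Brezis-Lieb), so that the
   ultrapower is E +m H' with H' a Hilbert space.

   Conversely let an ultrapower of X be E +m H', and let W be the image of X in it.
   If W is everything, X is E +m H'; otherwise some bounded sequence of W is null
   and separated from 0.  Let e in E_n be the class of (x_i).  In a further
   ultrapower e and the class of the images of the x_i have the same distances to the
   multiples of that sequence, hence the same modular at all small scales, and as
   p_n <> 2 this class has no Hilbert part.  So (x_i) converges, E is contained in W,
   and X is E +m (W :&: H').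

   E and E +m H have isometric ultrapowers because, over a rich enough ultrafilter,
   the Hilbert parts of both ultrapowers have orthonormal bases of the same
   cardinality.  When it is the first uncountable cardinal, the density character
   of E +m H is the Hilbert dimension of H, which determines H. *)

Require Import Defs.
From HB Require Import structures.
From mathcomp Require Import all_boot all_order all_algebra.
From mathcomp Require Import sesquilinear complex.
From mathcomp Require Import ring lra.
From mathcomp Require wochoice.
From mathcomp Require Import all_classical all_reals all_analysis.

Set Implicit Arguments.
Unset Strict Implicit.
Unset Printing Implicit Defensive.

Import Order.TTheory GRing.Theory Num.Theory.
Import numFieldNormedType.Exports.

Local Open Scope classical_set_scope.
Local Open Scope ring_scope.

(** * Luxemburg norms and Nakano sums *)

(** The obstacle is that an isometry between ultrapowers preserves norms only. It need not respect
    the modular or the splitting into E and a Hilbert part, so both must be recovered from norms,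
    and the norm shows only where the modular equals 1. If h is a nonzero vector of the Hilbert
    part, the modular of z + t h is a quadratic polynomial in t with leading coefficient ||h||^2.
    When the modular of z is below 1 this polynomial takes the value 1 at two points t, and these
    points determine the modular of z. A vector supported on coordinate n has modular C c^(p_n) at
    scale c, whereas a Hilbert component contributes a multiple of c^2; the three scales 1, 1/2, 1/4
    suffice to tell these apart when p_n <> 2. The first uncountable cardinal K serves for
    categoricity because of its order: initial segments are countable, so a union of K countable
    sets embeds into K, and every finite set of basis indices lies below one element of K. *)

Section ScalarFacts.
Context {R : realType} {k : scalar_kind}.
Implicit Types (a b : R).

Lemma scalar_of_realN a : scalar_of_real (- a) = - scalar_of_real a :> scalars R k.
Proof.
by apply/eqP; rewrite -addr_eq0 -scalar_of_realD addNr scalar_of_real0.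
Qed.

Lemma scalar_of_real_lt a b :
  (scalar_of_real a < scalar_of_real b :> scalars R k) = (a < b).
Proof.
by rewrite !lt_def scalar_of_real_le (inj_eq (@scalar_of_real_inj R k)).
Qed.

Lemma scalar_gt0_real (e : scalars R k) : 0 < e ->
  exists2 r : R, 0 < r & e = scalar_of_real r.
Proof.
move=> e0; exists (scalar_re e); last by rewrite scalar_reK // ltW.
by rewrite -(@scalar_of_real_lt _ _) scalar_reK ?ltW // scalar_of_real0.
Qed.

Lemma normr_lt_real (V : normedZmodType (scalars R k)) (x : V) (r : R) :
  (`|x| < scalar_of_real r) = (rnorm x < r).
Proof. by rewrite -rnormE scalar_of_real_lt. Qed.

Lemma rnormZr (V : normedModType (scalars R k)) a (x : V) :
  rnorm (scalar_of_real a *: x) = `|a| * rnorm x.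
Proof. by rewrite rnormZ rnorm_scalar. Qed.

Lemma ler_rnormB (V : normedZmodType (scalars R k)) (x y : V) :
  rnorm (x - y) <= rnorm x + rnorm y.
Proof. by rewrite (le_trans (ler_rnormD _ _)) // rnormN. Qed.

Lemma rnormB_sym (V : normedZmodType (scalars R k)) (x y : V) :
  rnorm (x - y) = rnorm (y - x).
Proof. by rewrite -rnormN opprB. Qed.

Lemma ler_rnorm_dist (V : normedZmodType (scalars R k)) (x y : V) :
  `|rnorm x - rnorm y| <= rnorm (x - y).
Proof.
have := ler_rnormD (y - x) x; have := ler_rnormD (x - y) y.
rewrite !subrK (rnormB_sym y) ler_norml => h1 h2.
by apply/andP; split; lra.
Qed.

Lemma rnorm_gt0 (V : normedZmodType (scalars R k)) (x : V) :
  x != 0 -> 0 < rnorm x.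
Proof. by move=> x0; rewrite lt0r rnorm_ge0 andbT; apply: contra_neq x0 => /rnorm_eq0. Qed.

End ScalarFacts.

Section LuxemburgFacts.
Context {R : realType} {k : scalar_kind}.
Implicit Types X Y : modularType R k.

Lemma modular_contract X (t : R) (x : X) : 0 <= t <= 1 ->
  modular (scalar_of_real t *: x) <= t * modular x.
Proof.
move=> t01; have := modular_convex t x 0 t01.
by rewrite scaler0 addr0 modular0 mulr0 addr0.
Qed.

Lemma luxemburg_norm_le X (c : R) (x : X) : 0 <= c ->
  modular (scalar_of_real c *: x) <= 1 -> c * luxemburg_norm x <= 1.
Proof.
rewrite le0r => /predU1P[->|c0] x1; first by rewrite mul0r ler01.
rewrite mulrC -ler_pdivlMr // mul1r; apply: ge_inf; first by exists 0 => l [/ltW].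
by split; rewrite ?invr_gt0 // scalar_of_realV invrK.
Qed.

(** Strictness comes from convexity: some admissible [l] has [c * l < 1], and contracting by [c * l]
    multiplies the modular by at most this factor. *)
Lemma modular_lt1 X (c : R) (x : X) : 0 <= c ->
  c * luxemburg_norm x < 1 -> modular (scalar_of_real c *: x) < 1.
Proof.
rewrite le0r => /predU1P[-> _|c0]; first by rewrite scalar_of_real0 scale0r modular0 ltr01.
rewrite mulrC -ltr_pdivlMr // mul1r => xc.
have [l [l0 lx] lc] : exists2 l : R,
    0 < l /\ modular ((scalar_of_real l)^-1 *: x) <= 1 & l < c^-1.
  have [|l] := inf_lt _ xc; last by exists l.
  have l0 : 0 < modular x + 1 by rewrite ltr_wpDl ?modular_ge0.
  exists (modular x + 1); split => //; rewrite -scalar_of_realV.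
  apply: le_trans (modular_contract _ _) _.
    by rewrite invr_ge0 (ltW l0) /= invf_le1 // lerDr modular_ge0.
  by rewrite ler_pdivrMl // mulr1 lerDl.
have cl1 : c * l < 1 by rewrite mulrC -ltr_pdivlMr // mul1r.
have -> : scalar_of_real c *: x =
    scalar_of_real (c * l) *: ((scalar_of_real l)^-1 *: x).
  by rewrite scalerA -scalar_of_realV -scalar_of_realM mulfK // gt_eqF.
apply: le_lt_trans (modular_contract _ _) _; first by rewrite mulr_ge0 ?ltW.
by apply: le_lt_trans cl1; rewrite ler_piMr // mulr_ge0 // ltW.
Qed.

Lemma luxemburg_norm_le1 X (x : X) : modular x <= 1 -> luxemburg_norm x <= 1.
Proof.
move=> x1; rewrite -[leLHS]mul1r; apply: luxemburg_norm_le => //.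
by rewrite scalar_of_real1 scale1r.
Qed.

Lemma modular_lt1_id X (x : X) : luxemburg_norm x < 1 -> modular x < 1.
Proof.
move=> x1; have := @modular_lt1 X 1 x ler01.
by rewrite mul1r scalar_of_real1 scale1r; exact.
Qed.

(** The norm is located by where the modular crosses 1. For [n] the norm of [y], the modular of [y]
    is strictly below 1 at scale [1 / (n + e)] and strictly above 1 at scale [1 / (n - e)]; strict
    inequalities pass to [v i]. *)
Lemma cvg_luxemburg_norm X Y (T : Type) (F : set_system T) {FF : Filter F}
    (v : T -> X) (y : Y) :
  (forall c : R, 0 < c ->
    modular (scalar_of_real c *: v i) @[i --> F] --> modular (scalar_of_real c *: y)) ->
  luxemburg_norm (v i) @[i --> F] --> luxemburg_norm y.
Proof.
move=> vy; apply/cvgrPdist_le => e e0.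
set n := luxemburg_norm y.
have n0 : 0 <= n := luxemburg_norm_ge0 y.
have up : \forall i \near F, luxemburg_norm (v i) <= n + e.
  have ne0 : 0 < n + e by rewrite ltr_wpDl.
  have c0 : 0 < (n + e)^-1 by rewrite invr_gt0.
  have lt1 : modular (scalar_of_real (n + e)^-1 *: y) < 1.
    by apply: modular_lt1; rewrite ?ltW // mulrC ltr_pdivrMr // mul1r ltrDl.
  near=> i.
  have : (n + e)^-1 * luxemburg_norm (v i) <= 1.
    apply: luxemburg_norm_le; rewrite ?ltW //.
    by near: i; exact: (cvgr_lt _ (vy _ c0)).
  by rewrite ler_pdivrMl // mulr1.
have lo : \forall i \near F, n - e <= luxemburg_norm (v i).
  have [ne|ne] := leP (n - e) 0.
    by near=> i; apply: le_trans ne (luxemburg_norm_ge0 _).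
  have c0 : 0 < (n - e)^-1 by rewrite invr_gt0.
  have lt1 : 1 < modular (scalar_of_real (n - e)^-1 *: y).
    rewrite ltNge; apply/negP => /(luxemburg_norm_le (ltW c0)).
    by rewrite ler_pdivrMl // mulr1 lerBrDr leNgt -/n ltrDl e0.
  near=> i; rewrite leNgt; apply/negP => vi.
  have : modular (scalar_of_real (n - e)^-1 *: v i) < 1.
    by apply: modular_lt1; rewrite ?ltW // ltr_pdivrMl // mulr1.
  by apply/negP; rewrite -leNgt ltW //; near: i; exact: (cvgr_gt _ (vy _ c0)).
near=> i; rewrite ler_norml; apply/andP; split.
  by rewrite lerBrDr addrC lerBlDr; near: i.
by rewrite lerBlDr addrC -lerBlDr; near: i.
Unshelve. all: by end_near. Qed.

Lemma luxemburg_norm_modular X Y (x : X) (y : Y) :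
  (forall c : R, modular (scalar_of_real c *: x) = modular (scalar_of_real c *: y)) ->
  luxemburg_norm x = luxemburg_norm y.
Proof.
move=> xy; rewrite /luxemburg_norm; congr inf; apply/seteqP.
by split=> l /= []; rewrite -scalar_of_realV => l0; rewrite ?xy -?xy.
Qed.

(* A uniform [Delta_2] condition: it makes the unit spheres of the modular and of
   its Luxemburg norm coincide. *)
Definition doubling X := exists M : nat,
  forall (c : R) (x : X), 1 <= c -> modular (scalar_of_real c *: x) <= c ^+ M * modular x.

(** Supplies the scale for the doubling arguments. The root of order [M + 1] avoids a separate case
    [M = 0]. *)
Lemma root_gt1 (M : nat) (m : R) : 1 < m -> exists2 c : R, 1 < c & c ^+ M <= m.
Proof.
move=> m1; have m0 : 0 <= m by rewrite ltW // (lt_trans ltr01).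
pose c := m `^ (M.+1%:R)^-1.
have cM : c ^+ M.+1 = m.
  by rewrite -powR_mulrn ?powR_ge0 // -powRrM mulVf ?powRr1.
have c1 : 1 < c.
  rewrite ltNge; apply/negP => c1; have := m1.
  by rewrite ltNge -cM exprn_ile1 // powR_ge0.
by exists c => //; rewrite -cM exprS ler_peMl ?exprn_ge0 ?powR_ge0 // ltW.
Qed.

(** If the modular exceeded 1, it would be at least [c ^+ M] for some [c > 1]. But [x / c] has norm,
    hence modular, below 1, and doubling brings this back to a modular of [x] below [c ^+ M]. *)
Lemma doubling_modular_le1 X (x : X) : doubling X ->
  luxemburg_norm x <= 1 -> modular x <= 1.
Proof.
move=> [M XM] x1; rewrite leNgt; apply/negP => /(root_gt1 M)[c c1].
rewrite leNgt => /negP; apply; have c0 : 0 < c by rewrite (lt_trans ltr01).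
have -> : x = scalar_of_real c *: (scalar_of_real c^-1 *: x).
  by rewrite scalerA -scalar_of_realM divff ?gt_eqF // scalar_of_real1 scale1r.
apply: le_lt_trans (XM _ _ (ltW c1)) _; rewrite gtr_pMr ?exprn_gt0 //.
apply/modular_lt1; first by rewrite invr_ge0 ltW.
by rewrite ltr_pdivrMl // mulr1 (le_lt_trans x1).
Qed.

Lemma doubling_modular_eq1 X (x : X) : doubling X ->
  (luxemburg_norm x = 1) <-> (modular x = 1).
Proof.
move=> XD; split=> x1; last first.
  apply/eqP; rewrite eq_le luxemburg_norm_le1 ?x1 //= leNgt.
  by apply/negP => /modular_lt1_id; rewrite x1 ltxx.
apply/eqP; rewrite eq_le doubling_modular_le1 ?x1 //= leNgt; apply/negP => m1.
have [M XM] := XD.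
have m0 : 0 < modular x.
  rewrite lt0r modular_ge0 andbT; apply/eqP => /modular_eq0 x0.
  have := x1; rewrite x0 -[0](scale0r x) luxemburg_normZ rnorm0 mul0r => /eqP.
  by rewrite eq_sym oner_eq0.
have [|c c1 cM] := @root_gt1 M (modular x)^-1; first by rewrite invf_gt1.
have c0 : 0 < c := lt_trans ltr01 c1.
suff : luxemburg_norm (scalar_of_real c *: x) <= 1.
  by rewrite luxemburg_normZ x1 mulr1 rnorm_scalar gtr0_norm // leNgt c1.
apply: luxemburg_norm_le1; apply: le_trans (XM _ _ (ltW c1)) _.
by rewrite -ler_pdivlMr // mul1r.
Qed.

(** The bound is uniform on balls, so the modulars of a bounded family have a limit along an
    ultrafilter. *)
Lemma doubling_modular_bounded X (C : R) : doubling X ->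
  exists D : R, forall x : X, luxemburg_norm x <= C -> modular x <= D.
Proof.
move=> XD; have [M XM] := XD.
pose c := Num.max 1 C; have c1 : 1 <= c by rewrite le_max lexx.
have c0 : 0 < c := lt_le_trans ltr01 c1.
exists (c ^+ M) => y yC.
have -> : y = scalar_of_real c *: (scalar_of_real c^-1 *: y).
  by rewrite scalerA -scalar_of_realM divff ?gt_eqF // scalar_of_real1 scale1r.
apply: le_trans (XM _ _ c1) _; rewrite ler_piMr ?exprn_ge0 ?(ltW c0) //.
apply: doubling_modular_le1 => //.
rewrite luxemburg_normZ rnorm_scalar ger0_norm ?invr_ge0 ?(ltW c0) //.
by rewrite ler_pdivrMl // mulr1 (le_trans yC) // le_max lexx orbT.
Qed.

End LuxemburgFacts.

Section NakanoSums.
Context {R : realType} {k : scalar_kind} (p : exponents R).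
Variable E : nat -> normedModType (scalars R k).
Implicit Types x y : nakano_sum p E.

(** Defined on arbitrary families, so that it applies to a coordinatewise limit before this is known
    to lie in the Nakano sum. *)
Definition nakano_head N (x : forall n, E n) : R :=
  \sum_(0 <= n < N) rnorm (x n) `^ p n.

Let psum_ge0 (x : forall n, E n) n : 0 <= rnorm (x n) `^ p n.
Proof. exact: powR_ge0. Qed.

Lemma exponent_gt0 n : 0 < p n.
Proof. exact: lt_le_trans (exponent_ge1 p n). Qed.

Lemma exponent_le_nat : exists M : nat, (2 <= M)%N /\ forall n, p n <= M%:R.
Proof.
have [C pC] := exponent_bounded p.
exists (Num.bound C).+2; split => // n; apply: le_trans (pC n) _.
have [C0|/ltW C0] := leP 0 C; last exact: le_trans C0 _.
by apply: le_trans (ltW (archi_boundP C0)) _; rewrite ler_nat -addn2 leq_addr.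
Qed.

Lemma cvg_nakano_head x : nakano_head N x @[N --> \oo] --> modular x.
Proof.
suff /fine_cvgP[] : (nakano_head N x)%:E @[N --> \oo] --> (modular x)%:E by [].
have -> : (fun N => (nakano_head N x)%:E) =
    (fun N => \sum_(0 <= n < N) (rnorm (x n) `^ p n)%:E)%E.
  by apply/funext => N; rewrite /nakano_head sumEFin.
rewrite nakano_sum_modularE; apply: is_cvg_nneseries => n _ _.
by rewrite lee_fin.
Qed.

Lemma nakano_head_nd x N M : (N <= M)%N -> nakano_head N x <= nakano_head M x.
Proof.
by move=> NM; rewrite /nakano_head (big_cat_nat (leq0n N) NM) //= lerDl sumr_ge0.
Qed.

Lemma nakano_head_ge0 N (x : forall n, E n) : 0 <= nakano_head N x.
Proof. exact: sumr_ge0. Qed.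

Lemma nakano_head_le N x : nakano_head N x <= modular x.
Proof.
apply: (cvgr_to_ge (@cvg_nakano_head x)); near=> M.
by apply: nakano_head_nd; near: M; exists N.
Unshelve. all: by end_near. Qed.

Lemma modular_le_head x C : (forall N, nakano_head N x <= C) -> modular x <= C.
Proof. by move=> xC; apply: (cvgr_to_le (@cvg_nakano_head x)); near=> M.
Unshelve. all: by end_near. Qed.

Lemma nakano_bounded (x : forall n, E n) C : (forall N, nakano_head N x <= C) ->
  nakano p (fun n => `|x n|).
Proof.
move=> xC; rewrite /nakano /= /nakano_modular.
apply: (@le_lt_trans _ _ C%:E); last exact: ltry.
under eq_eseriesr do rewrite rnormr_id.
apply: lime_le; first by apply: is_cvg_nneseries => n _ _; rewrite lee_fin.
by near=> N; rewrite sumEFin lee_fin; exact: xC.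
Unshelve. all: by end_near. Qed.

Lemma nakano_coord_modular n x : rnorm (x n) `^ p n <= modular x.
Proof.
apply: le_trans (nakano_head_le n.+1 x).
by rewrite /nakano_head big_nat_recr //= lerDr sumr_ge0.
Qed.

Lemma nakano_coord_le n x : rnorm (x n) <= luxemburg_norm x.
Proof.
apply/ler_addgt0Pr => e e0.
have le0 : 0 < luxemburg_norm x + e by rewrite ltr_wpDl ?luxemburg_norm_ge0.
have : modular (scalar_of_real (luxemburg_norm x + e)^-1 *: x) <= 1.
  apply/ltW/modular_lt1; first by rewrite invr_ge0 ltW.
  by rewrite ltr_pdivrMl // mulr1 ltrDl.
move=> /(le_trans (nakano_coord_modular n _)) /=.
rewrite rnormZr ger0_norm ?invr_ge0 ?(ltW le0) // => h.
rewrite -[leRHS]mulr1 -ler_pdivrMl //.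
rewrite leNgt; apply/negP => h1; move: h; rewrite leNgt => /negP; apply.
have {1}-> : 1 = 1 `^ p n :> R by rewrite powR1.
by rewrite gt0_ltr_powR ?exponent_gt0 // nnegrE ?mulr_ge0 ?invr_ge0 ?rnorm_ge0 ?(ltW le0).
Qed.

(** Termwise estimates beyond [N] pass to tails of modulars. Two weighted terms on each side cover
    the Brezis-Lieb, scaling and parallelogram estimates alike; spare places get coefficient 0. *)
Lemma nakano_tail_le N (a1 a2 b1 b2 : R) x1 x2 y1 y2 :
  (forall n, (N <= n)%N ->
     a1 * rnorm (x1 n) `^ p n + a2 * rnorm (x2 n) `^ p n <=
     b1 * rnorm (y1 n) `^ p n + b2 * rnorm (y2 n) `^ p n) ->
  a1 * (modular x1 - nakano_head N x1) + a2 * (modular x2 - nakano_head N x2) <=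
  b1 * (modular y1 - nakano_head N y1) + b2 * (modular y2 - nakano_head N y2).
Proof.
move=> xy.
have c a x : a * (nakano_head M x - nakano_head N x) @[M --> \oo] -->
    a * (modular x - nakano_head N x).
  by apply: cvgMr; apply: cvgB; [exact: cvg_nakano_head|exact: cvg_cst].
pose d a x M := a * (nakano_head M x - nakano_head N x).
apply: (@ler_cvg_to _ _ _ _ (fun M => d a1 x1 M + d a2 x2 M)
  (fun M => d b1 y1 M + d b2 y2 M) _ _
  (cvgD (c a1 x1) (c a2 x2)) (cvgD (c b1 y1) (c b2 y2))).
near=> M; have NM : (N <= M)%N by near: M; exists N.
have hE x : nakano_head M x - nakano_head N x = \sum_(N <= n < M) rnorm (x n) `^ p n.
  by rewrite /nakano_head (big_cat_nat (leq0n N) NM) //= addrC addrK.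
rewrite /d !hE !mulr_sumr -!big_split /=.
rewrite big_nat_cond [leRHS]big_nat_cond.
by apply: ler_sum => n /andP[/andP[Nn _] _]; exact: xy.
Unshelve. all: by end_near. Qed.

Lemma nakano_doubling : doubling (nakano_sum p E).
Proof.
have [M [_ pM]] := exponent_le_nat; exists M => c x c1.
have := @nakano_tail_le 0 1 0 (c ^+ M) 0 (scalar_of_real c *: x) 0 x 0.
rewrite /nakano_head !big_geq // !subr0 !mul0r !addr0 mul1r; apply => n _.
have c0 : 0 < c := lt_le_trans ltr01 c1.
rewrite !mul0r !addr0 mul1r rnormZr powRM ?rnorm_ge0 // ler_wpM2r //.
by rewrite gtr0_norm // -powR_mulrn ?(ltW c0) // ler_powR.
Qed.

End NakanoSums.

Section DoublingSums.
Context {R : realType} {k : scalar_kind}.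

Lemma square_doubling (H : normedModType (scalars R k)) : doubling (square_modular H).
Proof.
exists 2 => c x c1; rewrite !square_modularE [rnorm _]rnormZr exprMn.
by rewrite ler_wpM2r ?exprn_ge0 ?rnorm_ge0 // real_normK // num_real.
Qed.

Lemma sum_doubling (X Y : modularType R k) :
  doubling X -> doubling Y -> doubling (modular_sum X Y).
Proof.
move=> [M XM] [N YN]; exists (maxn M N) => c [x y] c1.
rewrite !modular_sumE /= mulrDr lerD //.
  apply: le_trans (XM _ _ c1) _; rewrite ler_wpM2r ?modular_ge0 //.
  by rewrite ler_weXn2l // leq_maxl.
apply: le_trans (YN _ _ c1) _; rewrite ler_wpM2r ?modular_ge0 //.
by rewrite ler_weXn2l // leq_maxr.
Qed.

End DoublingSums.

(** * Inequalities for powers with bounded exponents and with exponents near 2 *)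

Section PowerInequalities.
Context {R : realType}.
Implicit Types (a b c r e : R).

Lemma ler_powR2 a b r : 0 <= r -> 0 <= a -> a <= b -> a `^ r <= b `^ r.
Proof. by move=> r0 a0 ab; rewrite ge0_ler_powR ?nnegrE // (le_trans a0). Qed.

(** Either [b <= h * a], and then [a + b <= c * a] with [c ^+ M <= 1 + e]; or [a < b / h], and then
    [a + b <= d * b]. What matters later is that [C] is uniform in the exponents and that the factor
    of the first power is as close to 1 as desired. *)
Lemma powRD_le (M : nat) e : 0 < e -> exists2 C : R, 0 <= C &
  forall r a b, 0 <= r <= M%:R -> 0 <= a -> 0 <= b ->
    (a + b) `^ r <= (1 + e) * a `^ r + C * b `^ r.
Proof.
move=> e0; have [|c c1 cM] := @root_gt1 R M (1 + e); first by rewrite ltrDl.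
pose h := c - 1; have h0 : 0 < h by rewrite subr_gt0.
have c0 : 0 < c := lt_trans ltr01 c1.
pose d := 1 + h^-1; have d1 : 1 <= d by rewrite lerDl invr_ge0 ltW.
have d0 : 0 < d := lt_le_trans ltr01 d1.
exists (d ^+ M) => [|r a b /andP[r0 rM] a0 b0]; first by rewrite exprn_ge0 ?ltW.
have cr : c `^ r <= 1 + e.
  by apply: le_trans cM; rewrite -powR_mulrn ?(ltW c0) // ler_powR // ltW.
have dr : d `^ r <= d ^+ M by rewrite -powR_mulrn ?(ltW d0) // ler_powR.
have [ba|ab] := leP b (h * a).
  apply: (@le_trans _ _ ((1 + e) * a `^ r)); last first.
    by rewrite lerDl mulr_ge0 ?powR_ge0 // exprn_ge0 // ltW.
  apply: (@le_trans _ _ ((c * a) `^ r)).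
    by rewrite ler_powR2 ?addr_ge0 //; rewrite /h in ba; lra.
  by rewrite powRM ?(ltW c0) // ler_wpM2r ?powR_ge0.
apply: (@le_trans _ _ (d ^+ M * b `^ r)); last first.
  by rewrite lerDr mulr_ge0 ?powR_ge0 // addr_ge0 // ltW.
apply: (@le_trans _ _ ((d * b) `^ r)).
  rewrite ler_powR2 ?addr_ge0 // mulrDl mul1r addrC lerD2l.
  by rewrite ler_pdivlMl // ltW.
by rewrite powRM ?(ltW d0) // ler_wpM2r ?powR_ge0.
Qed.

Lemma powR_superadd r a b : 1 <= r -> 0 <= a -> 0 <= b ->
  a `^ r + b `^ r <= (a + b) `^ r.
Proof.
move=> r1 a0 b0; have r0 : 0 < r := lt_le_trans ltr01 r1.
rewrite -(mulr_powRB1 a0 r0) -(mulr_powRB1 b0 r0) -(mulr_powRB1 (addr_ge0 a0 b0) r0).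
rewrite mulrDl lerD // ler_wpM2l //;
  by apply: ler_powR2; rewrite ?subr_ge0 ?lerDl ?lerDr.
Qed.

Lemma powR_mid r a b : 1 <= r -> 0 <= a -> 0 <= b ->
  ((a + b) / 2) `^ r <= (a `^ r + b `^ r) / 2.
Proof.
move=> r1 a0 b0; have := @powR_convex R r 2^-1 a b r1 _ a0 b0.
have -> : 1 - 2^-1 = 2^-1 :> R by lra.
by rewrite -!mulrDr ![2^-1 * _]mulrC; apply; lra.
Qed.

(* A quadratic parallelogram bound for the norms of [x + y], [x - y] against those
   of [x], [y] passes to powers [r] close to 2, by comparing [l_2] and [l_r] norms
   on pairs. *)
Lemma powR_parallelogram (r al A B a b : R) : 1 <= r -> 0 <= al ->
  0 <= A -> 0 <= B -> 0 <= a -> 0 <= b ->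
  A ^+ 2 + B ^+ 2 <= 2 * al * (a ^+ 2 + b ^+ 2) ->
  A `^ r + B `^ r <= al `^ (r / 2) * (2 * 2 `^ `|r - 2|) * (a `^ r + b `^ r).
Proof.
move=> r1 al0 A0 B0 a0 b0 ABab.
have r0 : 0 < r := lt_le_trans ltr01 r1.
have sq z : 0 <= z -> (z ^+ 2) `^ (r / 2) = z `^ r.
  by move=> z0; rewrite -powR_mulrn // -powRrM mulrC divfK.
have s0 (z w : R) : 0 <= z ^+ 2 + w ^+ 2 by rewrite addr_ge0 ?sqr_ge0.
have [r2|r2] := leP r 2.
  apply: (@le_trans _ _ (al `^ (r / 2) * 2 * (a `^ r + b `^ r))); last first.
    rewrite ler_wpM2r ?addr_ge0 ?powR_ge0 // ler_wpM2l ?powR_ge0 // ler_peMr //.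
    by rewrite -[leLHS](powRr0 2) ler_powR ?ler1n.
  have i1 : 1 <= 2 / r by rewrite ler_pdivlMr // mul1r.
  have inv z : 0 <= z -> z = (z `^ (2 / r)) `^ (r / 2).
    move=> z0; rewrite -powRrM mulrA divfK ?gt_eqF // divff ?powRr1 //.
  have sq' z : 0 <= z -> (z `^ r) `^ (2 / r) = z ^+ 2.
    by move=> z0; rewrite -powRrM mulrC divfK ?gt_eqF // powR_mulrn.
  have h0 : 0 <= A `^ r + B `^ r by rewrite addr_ge0 ?powR_ge0.
  rewrite [_ * 2]mulrC -mulrA -ler_pdivrMl // mulrC.
  rewrite (inv ((A `^ r + B `^ r) / 2)) ?divr_ge0 //.
  rewrite [in leRHS](inv (a `^ r + b `^ r)) ?addr_ge0 ?powR_ge0 //.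
  rewrite -powRM ?powR_ge0 // ler_powR2 ?divr_ge0 ?powR_ge0 // ?(ltW r0) //.
  apply: le_trans (powR_mid i1 _ _) _; rewrite ?powR_ge0 // !sq' //.
  apply: (@le_trans _ _ (al * (a ^+ 2 + b ^+ 2))); first by lra.
  rewrite ler_wpM2l // -(sq' a) // -(sq' b) //.
  by apply: powR_superadd; rewrite ?powR_ge0.
have i1 : 1 <= r / 2 by rewrite ler_pdivlMr // mul1r ltW.
have i0 : 0 <= r / 2 by rewrite divr_ge0 // ltW.
rewrite -!sq //.
apply: le_trans (powR_superadd i1 (sqr_ge0 _) (sqr_ge0 _)) _.
apply: le_trans (ler_powR2 i0 _ ABab) _; rewrite ?addr_ge0 ?sqr_ge0 //.
have -> : 2 * al * (a ^+ 2 + b ^+ 2) = al * 4 * ((a ^+ 2 + b ^+ 2) / 2) by field.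
rewrite powRM ?mulr_ge0 ?divr_ge0 // (powRM _ al0) //.
have -> : (4 : R) `^ (r / 2) = 2 * 2 `^ `|r - 2| * 2.
  have -> : (4 : R) = 2 ^+ 2 by lra.
  rewrite sq // gtr0_norm ?subr_gt0 // powRB ?pnatr_eq0 ?implybT //.
  by rewrite powR_mulrn //; field.
rewrite -!mulrA ler_wpM2l ?powR_ge0 // !ler_wpM2l ?powR_ge0 //.
rewrite -ler_pdivlMl // mulrC.
by rewrite ![2^-1 * _]mulrC; apply: powR_mid; rewrite ?sqr_ge0.
Qed.

Lemma cvg_powR (T : Type) (F : set_system T) {FF : Filter F} (f g : T -> R) a b :
  0 < a -> f x @[x --> F] --> a -> g x @[x --> F] --> b ->
  f x `^ g x @[x --> F] --> a `^ b.
Proof.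
move=> a0 fa gb; rewrite /powR gt_eqF //.
apply: (@cvg_trans _ (expR (g x * ln (f x)) @[x --> F])); last first.
  apply: continuous_cvg; first exact: continuous_expR.
  apply: cvgM gb _; apply: continuous_cvg fa; exact: continuous_ln.
apply: near_eq_cvg; near=> x; rewrite gt_eqF //.
by near: x; exact: (cvgr_gt _ fa).
Unshelve. all: by end_near. Qed.

End PowerInequalities.

Section AsymptoticParallelogram.
Context {R : realType} {k : scalar_kind} (p : exponents R).
Variable E : nat -> normedModType (scalars R k).
Hypothesis p_cvg2 : p n @[n --> \oo] --> (2 : R).

Lemma jordan_von_neumann_le (X : normedModType (scalars R k)) (x y : X) :
  rnorm (x + y) ^+ 2 + rnorm (x - y) ^+ 2 <=
  2 * jordan_von_neumann X * (rnorm x ^+ 2 + rnorm y ^+ 2).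
Proof.
set s := rnorm x ^+ 2 + rnorm y ^+ 2.
have [s0|s0] := eqVneq s 0.
  move: (s0) => /eqP; rewrite paddr_eq0 ?sqr_ge0 // !sqrf_eq0 => /andP[/eqP x0 /eqP y0].
  by rewrite (rnorm_eq0 x0) (rnorm_eq0 y0) addr0 subr0 s0 rnorm0 expr0n addr0 mulr0.
have sp : 0 < s by rewrite lt0r s0 addr_ge0 ?sqr_ge0.
pose c := (Num.sqrt s)^-1.
have c2 : c ^+ 2 = s^-1 by rewrite exprVn sqr_sqrtr // ltW.
have sqc z : rnorm (scalar_of_real c *: z : X) ^+ 2 = s^-1 * rnorm z ^+ 2.
  by rewrite rnormZr exprMn real_normK ?num_real // c2.
rewrite -ler_pdivrMr // mulrC mulrDr -!sqc scalerDr scalerBr.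
rewrite -ler_pdivrMl // mulrC; rewrite /jordan_von_neumann mulrC.
rewrite ler_wpM2l ?invr_ge0 //; apply: ub_le_sup; last first.
  by exists (scalar_of_real c *: x), (scalar_of_real c *: y); rewrite !sqc -mulrDr mulVf.
(* A supremum bounds its members only when the set is bounded. The triangle inequality and
   [(a + b)^2 <= 2 (a^2 + b^2)] give the bound 4. *)
exists 4 => _ [u [v [uv1 ->]]].
have n0 (z : X) := rnorm_ge0 z.
have le z : rnorm (u + z) <= rnorm u + rnorm z by exact: ler_rnormD.
have h1 : rnorm (u + v) ^+ 2 <= (rnorm u + rnorm v) ^+ 2.
  by rewrite ler_pXn2r ?nnegrE ?addr_ge0.
have h2 : rnorm (u - v) ^+ 2 <= (rnorm u + rnorm v) ^+ 2.
  by rewrite ler_pXn2r ?nnegrE ?addr_ge0 // ler_rnormB.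
have := sqr_ge0 (rnorm u - rnorm v); move: h1 h2; rewrite sqrrB !sqrrD; lra.
Qed.

(** The constant of [powR_parallelogram] tends to [1 ^ 1 * (2 * 2 ^ 0) = 2] along the
    coordinates. *)
Lemma nakano_tail_parallelogram (d : R) : 0 < d ->
  jordan_von_neumann (E n) @[n --> \oo] --> (1 : R) ->
  \forall N \near \oo, forall n, (N <= n)%N -> forall x y : E n,
    rnorm (x + y) `^ p n + rnorm (x - y) `^ p n <=
    (2 + d) * (rnorm x `^ p n + rnorm y `^ p n).
Proof.
move=> d0 a1.
pose K n : R := jordan_von_neumann (E n) `^ (p n / 2) * (2 * 2 `^ `|p n - 2|).
have cK : K n @[n --> \oo] --> (2 : R).
  have -> : 2 = 1 `^ (2 / 2) * (2 * 2 `^ `|2 - 2|) :> R.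
    by rewrite subrr normr0 powRr0 powR1 mul1r mulr1.
  apply: cvgM; first by apply: cvg_powR => //; exact: cvgMl.
  apply: cvgMr; apply: cvg_powR => //; first exact: cvg_cst.
  by apply: cvg_norm; apply: cvgB => //; exact: cvg_cst.
have : \forall n \near \oo, K n <= 2 + d /\ 0 <= jordan_von_neumann (E n).
  near=> n; split; near: n; first by apply: (cvgr_le _ cK); rewrite ltrDl.
  exact: (cvgr_ge _ a1).
move=> [N _ NK]; exists N => // n Nn m nm x y.
have [Km am] := NK m (leq_trans Nn nm).
apply: le_trans (powR_parallelogram _ am _ _ _ _ (jordan_von_neumann_le x y)) _;
  rewrite ?rnorm_ge0 ?exponent_ge1 //.
by rewrite ler_wpM2r ?addr_ge0 ?powR_ge0.
Unshelve. all: by end_near. Qed.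

Lemma near_powR_sqr (c d : R) : 0 < c -> 0 < d ->
  \forall N \near \oo, forall n, (N <= n)%N -> c `^ p n <= c ^+ 2 + d.
Proof.
move=> c0 d0; have cc : c `^ p n @[n --> \oo] --> c ^+ 2.
  rewrite -powR_mulrn ?(ltW c0) //; apply: cvg_powR => //; exact: cvg_cst.
have [N _ cN] : \forall n \near \oo, c `^ p n <= c ^+ 2 + d.
  by apply: (cvgr_le _ cc); rewrite ltrDl.
exists N => // n Nn m nm.
exact: cN (leq_trans Nn nm).
Qed.

End AsymptoticParallelogram.

Section NormConvergence.
Context {R : realType} {k : scalar_kind} {I : Type}.
Context (F : set_system I) {FF : ProperFilter F}.
Implicit Type V : normedModType (scalars R k).

(** Convergence is tested on the real-valued norm, so that real and complex scalars are treated
    alike. *)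
Definition norm_cvg V (x : I -> V) (l : V) := rnorm (x i - l) @[i --> F] --> (0 : R).

Lemma cvg0_le (f g : I -> R) : (forall i, 0 <= f i <= g i) ->
  g i @[i --> F] --> (0 : R) -> f i @[i --> F] --> (0 : R).
Proof.
move=> fg g0; apply: (squeeze_cvgr _ (cvg_cst 0) g0).
by apply: (@filterE _ F) => i; exact: fg.
Qed.

Lemma cvg_le (f g : I -> R) (a b : R) : f i @[i --> F] --> a ->
  g i @[i --> F] --> b -> (forall i, f i <= g i) -> a <= b.
Proof.
move=> fa gb fg; rewrite -subr_ge0; apply: (cvgr_to_ge (cvgB gb fa)).
by apply: (@filterE _ F) => i; rewrite /= subr_ge0.
Qed.

Lemma cvg_mulc (c : R) (f : I -> R) (a : R) : f i @[i --> F] --> a ->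
  c * f i @[i --> F] --> c * a.
Proof. by move=> fa; apply: cvgM => //; exact: cvg_cst. Qed.

Lemma norm_cvg_cst V (l : V) : norm_cvg (fun=> l) l.
Proof. by rewrite /norm_cvg subrr rnorm0; exact: cvg_cst. Qed.

Lemma norm_cvgD V (x y : I -> V) l m : norm_cvg x l -> norm_cvg y m ->
  norm_cvg (fun i => x i + y i) (l + m).
Proof.
move=> xl ym; have := cvgD xl ym; rewrite addr0 => h; apply: cvg0_le (h _) => i.
by rewrite rnorm_ge0 /= opprD addrACA ler_rnormD.
Qed.

Lemma norm_cvgZ V (c : scalars R k) (x : I -> V) l : norm_cvg x l ->
  norm_cvg (fun i => c *: x i) (c *: l).
Proof.
move=> xl; have h : rnorm c * rnorm (x i - l) @[i --> F] --> (0 : R).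
  by rewrite -(mulr0 (rnorm c)); exact: cvgMr.
apply: cvg0_le h => i.
by rewrite rnorm_ge0 /= -scalerBr rnormZ.
Qed.

Lemma norm_cvgN V (x : I -> V) l : norm_cvg x l -> norm_cvg (fun i => - x i) (- l).
Proof.
move=> /(norm_cvgZ (-1)); rewrite /norm_cvg scaleN1r.
by under eq_fun do rewrite scaleN1r.
Qed.

Lemma norm_cvgB V (x y : I -> V) l m : norm_cvg x l -> norm_cvg y m ->
  norm_cvg (fun i => x i - y i) (l - m).
Proof. by move=> xl ym; exact: norm_cvgD xl (norm_cvgN ym). Qed.

Lemma norm_cvg_scale V (c : I -> scalars R k) (d : scalars R k) (v : V) :
  norm_cvg (V := scalars R k) c d -> norm_cvg (fun i => c i *: v) (d *: v).
Proof.
move=> cd; have h : rnorm (c i - d) * rnorm v @[i --> F] --> (0 : R).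
  by rewrite -(mul0r (rnorm v)); exact: cvgMl.
apply: cvg0_le h => i.
by rewrite rnorm_ge0 /= -scalerBl rnormZ.
Qed.

Lemma norm_cvg_rnorm V (x : I -> V) l : norm_cvg x l ->
  rnorm (x i) @[i --> F] --> rnorm l.
Proof.
move=> xl; apply/cvgrPdist_le => e e0; near=> i.
rewrite (le_trans (ler_rnorm_dist _ _)) // rnormB_sym.
have : rnorm (x i - l) <= e by near: i; exact: (cvgr_le _ xl).
by [].
Unshelve. all: by end_near. Qed.

Lemma norm_cvg_unique V (x : I -> V) l m : norm_cvg x l -> norm_cvg x m -> l = m.
Proof.
move=> xl xm; apply/eqP; rewrite -subr_eq0; apply/eqP/rnorm_eq0.
have := norm_cvg_rnorm (norm_cvgB xl xm).
have -> : (fun i => rnorm (x i - x i)) = cst 0.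
  by apply/funext => i; rewrite subrr rnorm0.
by move=> h; apply: (cvg_unique (@Rhausdorff R) h); exact: cvg_cst.
Qed.

Lemma norm_cvg_near V (x : I -> V) l (e : R) : 0 < e -> norm_cvg x l ->
  \forall i \near F, rnorm (x i - l) < e.
Proof. by move=> e0 xl; exact: (cvgr_lt _ xl). Qed.

Lemma near_norm_cvg V (x : I -> V) l :
  (forall e : R, 0 < e -> \forall i \near F, rnorm (x i - l) <= e) -> norm_cvg x l.
Proof.
move=> xl; apply/cvgrPdist_le => e e0; near=> i.
by rewrite sub0r normrN ger0_norm ?rnorm_ge0 //; near: i; exact: xl.
Unshelve. all: by end_near. Qed.

End NormConvergence.

(** * Compactness of bounded sets in finite dimension, along ultrafilters *)

Section UltraCompactness.
Context {R : realType} {k : scalar_kind}.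
Implicit Type V : normedModType (scalars R k).

Lemma ultra_nat : exists2 V : set_system nat, UltraFilter V & \oo `<=` V.
Proof. by have [V [VU sV]] := ultraFilterLemma (@eventually_filter); exists V. Qed.

Lemma ultra_scalar_compact (I : Type) (U : set_system I) (c : I -> scalars R k) (M : R) :
  UltraFilter U -> (forall i, rnorm (c i) <= M) ->
  exists d : scalars R k, norm_cvg U (V := scalars R k) c d.
Proof.
move=> UU; have real (f : I -> R) : (forall i, `|f i| <= M) ->
    exists d : R, `|f i - d| @[i --> U] --> (0 : R).
  move=> fM; have /cvg_ex[/= d fd] := ultra_bounded_cvg UU (ex_intro _ M fM).
  exists d; rewrite -(normr0 R) -(subrr d); apply: cvg_norm.
  by apply: cvgB => //; exact: cvg_cst.
case: k c => c cM; first exact: real.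
have cE (z : R[i]) : `|complex.Re z| <= @rnorm R ComplexScalars R[i] z /\
    `|complex.Im z| <= @rnorm R ComplexScalars R[i] z.
  rewrite /rnorm; case: z => a b /=; rewrite -!sqrtr_sqr.
  by split; rewrite ler_sqrt ?addr_ge0 ?sqr_ge0 // ?lerDl ?lerDr sqr_ge0.
have [i|a ca] := real (fun i => complex.Re (c i)).
  exact: le_trans (cE _).1 (cM i).
have [i|b cb] := real (fun i => complex.Im (c i)).
  exact: le_trans (cE _).2 (cM i).
exists (Complex a b); have := cvgD ca cb; rewrite addr0 => h.
apply: cvg0_le (h _) => i; rewrite rnorm_ge0 /rnorm; case: (c i) => u v /=.
rewrite -[leRHS]ger0_norm ?addr_ge0 // -[leRHS]sqrtr_sqr ler_sqrt ?sqr_ge0 //.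
rewrite [leRHS]sqrrD !real_normK ?num_real // -addrA lerD2l lerDr.
by rewrite mulrn_wge0 // mulr_ge0.
Qed.

(** The recursive form lets compactness go by induction on the generators. *)
Fixpoint list_span V (s : seq V) (x : V) : Prop :=
  if s is v :: s' then exists c y, list_span s' y /\ x = y + c *: v else x = 0.

Lemma list_spanZ V (s : seq V) a x : list_span s x -> list_span s (a *: x).
Proof.
elim: s x => [|v s IH] x /=; first by move=> ->; rewrite scaler0.
move=> [c [y [sy ->]]]; exists (a * c), (a *: y).
by rewrite scalerDr scalerA; split => //; exact: IH.
Qed.

Lemma list_spanD V (s : seq V) x y :
  list_span s x -> list_span s y -> list_span s (x + y).
Proof.
elim: s x y => [|v s IH] x y /=; first by move=> -> ->; rewrite addr0.
move=> [c [x' [sx ->]]] [d [y' [sy ->]]]; exists (c + d), (x' + y').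
by rewrite scalerDl addrACA; split => //; exact: IH.
Qed.

Lemma list_span_sum V (T : Type) (r : seq T) (c : T -> scalars R k) (e : T -> V) :
  list_span [seq e i | i <- r] (\sum_(i <- r) c i *: e i).
Proof.
elim: r => [|i r IH] /=; first by rewrite big_nil.
by rewrite big_cons; exists (c i), (\sum_(j <- r) c j *: e j); rewrite addrC.
Qed.

Lemma finite_dim_list V : finite_dim V -> exists s : seq V, forall x, list_span s x.
Proof.
move=> [n [e eV]]; exists [seq e i | i <- enum 'I_n] => x.
have [c ->] := eV x; rewrite -big_enum; exact: list_span_sum.
Qed.

(** A generator [v] in the span of the others is dropped. Otherwise its distance [d] to that span is
    positive, which bounds the coefficient of [v] by [M / d], and coefficients and remainders
    converge separately. The induction ranges over all index sets because the positivity of [d] uses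
    an ultrafilter on [nat]. *)
Lemma list_span_compact V (s : seq V) (I : Type) (U : set_system I) (x : I -> V) (M : R) :
  UltraFilter U -> (forall i, rnorm (x i) <= M) -> (forall i, list_span s (x i)) ->
  exists2 l, list_span s l & norm_cvg U x l.
Proof.
elim: s I U x M => [|v s IH] I U x M UU xM xs.
  exists 0 => //=; have -> : x = fun=> 0 by apply/funext => i; exact: xs i.
  exact: norm_cvg_cst.
have [vs|vs] := pselect (list_span s v).
  have ss y : list_span (v :: s) y -> list_span s y.
    by move=> [c [z [sz ->]]]; apply: list_spanD => //; exact: list_spanZ.
  have [l sl xl] := IH _ _ _ _ UU xM (fun i => ss _ (xs i)).
  by exists l => //; exists 0, l; rewrite scale0r addr0.
have [d d0 dv] : exists2 d : R, 0 < d & forall y, list_span s y -> d <= rnorm (v - y).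
  apply: contrapT => nd; apply: vs.
  (* If the distance were zero, these approximants of [v] would be bounded, so by induction they
     would converge within the span of [s], and [v] would lie in it. *)
  have /choice[y ys] : forall n : nat, exists y, list_span s y /\ rnorm (v - y) < n.+1%:R^-1.
    move=> n; apply: contrapT => ny; apply: nd; exists n.+1%:R^-1 => // y sy.
    by rewrite leNgt; apply/negP => vy; apply: ny; exists y.
  have [G GU oG] := ultra_nat.
  have yM n : rnorm (y n) <= rnorm v + 1.
    have [_ /ltW vy] := ys n; have -> : y n = v - (v - y n) by rewrite opprB addrC subrK.
    apply: le_trans (ler_rnormB _ _) _; rewrite lerD2l (le_trans vy) //.
    by rewrite invf_le1 // ler1n.
  have [l sl yl] := IH _ _ _ _ GU yM (fun n => (ys n).1).
  suff -> : v = l by [].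
  apply: norm_cvg_unique yl; apply: near_norm_cvg => e e0.
  apply: oG; near=> n; rewrite rnormB_sym; apply: le_trans (ltW (ys n).2) _.
  by apply: ltW; near: n; exact: (near_infty_natSinv_lt (PosNum e0)).
have /choice[cy cyx] i : exists cy : scalars R k * V, list_span s cy.2 /\ x i = cy.2 + cy.1 *: v.
  by have [c [y [sy ->]]] := xs i; exists (c, y).
have cM i : rnorm (cy i).1 <= M / d.
  rewrite ler_pdivlMr //; apply: le_trans (xM i); have [sy ->] := cyx i.
  have [->|c0] := eqVneq (cy i).1 0; first by rewrite rnorm0 mul0r rnorm_ge0.
  have -> : (cy i).2 + (cy i).1 *: v = (cy i).1 *: (v - (- (cy i).1^-1) *: (cy i).2).
    by rewrite scalerBr scaleNr scalerN opprK scalerA divff // scale1r addrC.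
  by rewrite rnormZ ler_wpM2l ?rnorm_ge0 // dv //; exact: list_spanZ.
have [c cc] := ultra_scalar_compact UU cM.
have yM i : rnorm (cy i).2 <= M + M / d * rnorm v.
  have -> : (cy i).2 = x i - (cy i).1 *: v by have [_ ->] := cyx i; rewrite addrK.
  apply: le_trans (ler_rnormB _ _) _; rewrite lerD // rnormZ ler_wpM2r ?rnorm_ge0 //.
have [l sl yl] := IH _ _ _ _ UU yM (fun i => (cyx i).1).
exists (l + c *: v); first by exists c, l.
have -> : x = fun i => (cy i).2 + (cy i).1 *: v.
  by apply/funext => i; have [_] := cyx i.
by apply: norm_cvgD => //; exact: norm_cvg_scale.
Unshelve. all: by end_near. Qed.

Lemma finite_dim_compact V (I : Type) (U : set_system I) (x : I -> V) (M : R) :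
  finite_dim V -> UltraFilter U -> (forall i, rnorm (x i) <= M) ->
  exists l, norm_cvg U x l.
Proof.
move=> /finite_dim_list[s sV] UU xM.
by have [l _ xl] := list_span_compact UU xM (fun i => sV (x i)); exists l.
Qed.

End UltraCompactness.

(** * Limits of the modular along an ultrafilter *)

Section RealCombinations.
Variable R : realFieldType.

(** In this and the next two lemmas, modulars, their heads and squared Hilbert norms are plain
    variables: an estimate of tails and one of Hilbert parts combine to an estimate of whole
    modulars. *)
Lemma real_comb1 (a b c d e f g h : R) : 0 <= e * h ->
  1 * (a - b) + 0 * c <= (1 + e) * (f - g) + d ->
  a + h <= b + ((1 + e) * (f + h - g) + d).
Proof. by lra. Qed.

Lemma real_comb2 (a b m h z s q c r : R) : 0 <= s * h -> 0 <= r * q ->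
  1 * (a - b) + 0 * z <= s * (m - h) + 0 * z ->
  s = c + r -> a + c * q <= b + s * (m + q).
Proof. by move=> ? ? ? sE; subst s; lra. Qed.

Lemma real_comb3 (a b a' b' m h m' h' q q' r r' s d : R) :
  0 <= s * h -> 0 <= s * h' -> 0 <= d * (r + r') ->
  1 * (a - b) + 1 * (a' - b') <= s * (m - h) + s * (m' - h') ->
  q + q' = 2 * (r + r') -> s = 2 + d ->
  a + q + (a' + q') <= b + b' + s * (m + r + (m' + r')).
Proof. by move=> ? ? ? ? ? sE; subst s; lra. Qed.

End RealCombinations.

Definition parallelogram {R : realType} {k : scalar_kind}
    (V : normedModType (scalars R k)) := forall x y : V,
  rnorm (x + y) ^+ 2 + rnorm (x - y) ^+ 2 = 2 * (rnorm x ^+ 2 + rnorm y ^+ 2).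

Lemma luxemburg_square {R : realType} {k : scalar_kind}
    (V : normedModType (scalars R k)) (x : V) :
  luxemburg_norm (x : square_modular V) = rnorm x.
Proof.
have [->|x0] := eqVneq x 0.
  by rewrite rnorm0 -[0](scale0r (0 : square_modular V)) luxemburg_normZ rnorm0 mul0r.
have n0 := rnorm_gt0 x0.
have : luxemburg_norm (scalar_of_real (rnorm x)^-1 *: x : square_modular V) = 1.
  apply/(doubling_modular_eq1 _ (square_doubling V)).
  rewrite square_modularE [rnorm _]rnormZr ger0_norm ?invr_ge0 ?rnorm_ge0 //.
  by rewrite mulVf ?gt_eqF // expr1n.
rewrite luxemburg_normZ rnorm_scalar ger0_norm ?invr_ge0 ?rnorm_ge0 // => h.
by rewrite -[LHS](mulVKf (lt0r_neq0 n0)) h mulr1.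
Qed.

Section NakanoSumHilbert.
Context {R : realType} {k : scalar_kind} (p : exponents R).
Variables (E : nat -> normedModType (scalars R k)) (H : normedModType (scalars R k)).
Local Notation Z := (nakano_sum_hilbert p E H).

Definition npart (z : Z) : nakano_sum p E :=
  fst (z : modular_sum (nakano_sum p E) (square_modular H)).

Definition hpart (z : Z) : H :=
  snd (z : modular_sum (nakano_sum p E) (square_modular H)).

Definition npair (e : nakano_sum p E) (h : H) : Z := (e, h).

Definition theta (z : Z) : R :=
  modular (z : modular_sum (nakano_sum p E) (square_modular H)).

Lemma thetaE z : theta z = modular (npart z) + rnorm (hpart z) ^+ 2.
Proof. by []. Qed.

Lemma theta_ge0 z : 0 <= theta z.
Proof. exact: modular_ge0. Qed.

Lemma npairK z : npair (npart z) (hpart z) = z.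
Proof. by case: z. Qed.

Lemma npartD x y : npart (x + y) = npart x + npart y. Proof. by []. Qed.
Lemma hpartD x y : hpart (x + y) = hpart x + hpart y. Proof. by []. Qed.
Lemma npartZ a x : npart (a *: x) = a *: npart x. Proof. by []. Qed.
Lemma hpartZ a x : hpart (a *: x) = a *: hpart x. Proof. by []. Qed.
Lemma npartN x : npart (- x) = - npart x. Proof. by []. Qed.
Lemma hpartN x : hpart (- x) = - hpart x. Proof. by []. Qed.
Lemma npairD e h e' h' : npair (e + e') (h + h') = npair e h + npair e' h'.
Proof. by []. Qed.
Lemma npairZ a e h : npair (a *: e) (a *: h) = a *: npair e h.
Proof. by []. Qed.

Lemma nakanoDE (x y : nakano_sum p E) n : (x + y) n = x n + y n. Proof. by []. Qed.
Lemma nakanoZE a (x : nakano_sum p E) n : (a *: x) n = a *: x n. Proof. by []. Qed.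
Lemma nakanoNE (x : nakano_sum p E) n : (- x) n = - x n.
Proof. by rewrite -scaleN1r nakanoZE scaleN1r. Qed.

Lemma theta_doubling :
  doubling (modular_sum (nakano_sum p E) (square_modular H)).
Proof. by apply: sum_doubling; [exact: nakano_doubling|exact: square_doubling]. Qed.

Lemma rnorm_eq1 (z : Z) : rnorm z = 1 <-> theta z = 1.
Proof. by rewrite rnorm_luxemburg; apply: doubling_modular_eq1; exact: theta_doubling. Qed.

Lemma theta_lt1 (z : Z) : rnorm z < 1 -> theta z < 1.
Proof. by rewrite rnorm_luxemburg => /modular_lt1_id. Qed.

Lemma theta_bounded (C : R) : exists D : R, forall z : Z, rnorm z <= C -> theta z <= D.
Proof.
have [D CD] := doubling_modular_bounded C theta_doubling.
by exists D => z zC; apply: CD; rewrite -rnorm_luxemburg.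
Qed.

Lemma npart_le (z : Z) n : rnorm (npart z n) <= rnorm z.
Proof.
apply: le_trans (nakano_coord_le n (npart z)) _.
rewrite rnorm_luxemburg; apply/ler_addgt0Pr => e e0.
set l := luxemburg_norm _ + e.
have l0 : 0 < l by rewrite ltr_wpDl ?luxemburg_norm_ge0.
have : theta (scalar_of_real l^-1 *: z) < 1.
  apply: modular_lt1; first by rewrite invr_ge0 ltW.
  by rewrite ltr_pdivrMl // mulr1 ltrDl.
rewrite thetaE => /ltW le1.
have /luxemburg_norm_le : modular (scalar_of_real l^-1 *: npart z) <= 1.
  by apply: le_trans le1; rewrite lerDl sqr_ge0.
by rewrite invr_ge0 => /(_ (ltW l0)); rewrite ler_pdivrMl // mulr1.
Qed.

Section UltraTheta.
Context {I : Type} (U : set_system I) {UU : UltraFilter U}.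
Implicit Types x y : @bounded_family R k I Z.

Definition coord_cvg (x : I -> Z) (e : forall n, E n) :=
  forall n, norm_cvg U (fun i => npart (x i) n) (e n).

Definition utheta x : R := lim (theta (x i) @[i --> U]).

Lemma utheta_cvg x : theta (x i) @[i --> U] --> utheta x.
Proof.
apply: ultra_bounded_cvg; have [M xM] := family_valP x.
have [D MD] := theta_bounded M; exists D => i.
by rewrite ger0_norm ?theta_ge0 // MD.
Qed.

Lemma utheta_ge0 x : 0 <= utheta x.
Proof.
by apply: (cvgr_to_ge (@utheta_cvg x)); apply: (@filterE _ U) => i; exact: theta_ge0.
Qed.

Lemma cvg_powR0 (f : I -> R) (a r : R) : (forall i, 0 <= f i) -> 0 <= a -> 0 < r ->
  f i @[i --> U] --> a -> f i `^ r @[i --> U] --> a `^ r.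
Proof.
move=> f0; rewrite le0r => /predU1P[->|a0] r0 fa; last first.
  by apply: cvg_powR => //; exact: cvg_cst.
rewrite powR0 ?gt_eqF //; apply/cvgrPdist_le => e e0; near=> i.
rewrite sub0r normrN ger0_norm ?powR_ge0 //.
have -> : e = (e `^ r^-1) `^ r by rewrite -powRrM mulVf ?gt_eqF // powRr1 // ltW.
apply: ler_powR2; rewrite ?(ltW r0) //; near: i.
by apply: (cvgr_le _ fa); exact: powR_gt0.
Unshelve. all: by end_near. Qed.

Lemma cvg_coord_head (x : I -> Z) (e : forall n, E n) N : coord_cvg x e ->
  nakano_head p N (npart (x i)) @[i --> U] --> nakano_head p N e.
Proof.
move=> xe; rewrite /nakano_head; elim: N => [|n IH].
  have h (g : nat -> R) : \sum_(0 <= n < 0) g n = 0 by rewrite big_geq.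
  by rewrite h; under eq_fun do rewrite h; exact: cvg_cst.
have h (g : nat -> R) : \sum_(0 <= i < n.+1) g i = \sum_(0 <= i < n) g i + g n.
  by rewrite big_nat_recr.
rewrite h; under eq_fun do rewrite h.
apply: cvgD => //; apply: cvg_powR0; rewrite ?rnorm_ge0 ?exponent_gt0 //.
  by move=> i; exact: rnorm_ge0.
exact: norm_cvg_rnorm (xe n).
Qed.

(* Brezis-Lieb: the part of the modular that escapes to infinity is not affected
   by a fixed translation. *)
Let utheta_shift_le x y (e f d : nakano_sum p E) :
  coord_cvg x e -> coord_cvg y f ->
  (forall i, npart (x i) = npart (y i) + d) -> (forall i, hpart (x i) = hpart (y i)) ->
  utheta x - modular e <= utheta y - modular f.
Proof.
move=> xe yf nxy hxy.
have [M [_ pM]] := exponent_le_nat p.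
(* A factor [1 + eps] may be lost, as [utheta y - modular f] is a fixed nonnegative number. *)
suff main eps : 0 < eps ->
    utheta x - modular e <= (1 + eps) * (utheta y - modular f).
  have y0 : 0 <= utheta y - modular f.
    rewrite subr_ge0; apply: modular_le_head => N.
    apply: (cvg_le (cvg_coord_head (N := N) yf) (@utheta_cvg y)).
    move=> i; apply: le_trans (nakano_head_le N _) _.
    by rewrite thetaE lerDl sqr_ge0.
  apply/ler_addgt0Pr => t t0; pose s := utheta y - modular f; rewrite -/s in y0 main *.
  have s10 : 0 < s + 1 by rewrite ltr_wpDl.
  apply: le_trans (main (t / (s + 1)) _) _; first by rewrite divr_gt0.
  rewrite mulrDl mul1r lerD2l mulrAC ler_pdivrMr //.
  by rewrite ler_wpM2l ?ltW // ltrDl.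
move=> e0; have [C C0 powC] := powRD_le M e0.
(* For fixed [N] the first [N] coordinates converge along [U], and the error comes only from the
   tail of the fixed vector [d], which vanishes as [N] grows. *)
suff main N : utheta x <= nakano_head p N e +
    ((1 + eps) * (utheta y - nakano_head p N f) + C * (modular d - nakano_head p N d)).
  rewrite lerBlDl.
  have -> : modular e + (1 + eps) * (utheta y - modular f) =
     modular e + ((1 + eps) * (utheta y - modular f) + C * (modular d - modular d)).
    by rewrite subrr mulr0 addr0.
  apply: (@cvg_le _ _ \oo _ (cst (utheta x)) (fun N => nakano_head p N e +
    ((1 + eps) * (utheta y - nakano_head p N f) +
     C * (modular d - nakano_head p N d)))) => //; first exact: cvg_cst.
  apply: cvgD; first exact: cvg_nakano_head.
  apply: cvgD; apply: cvg_mulc; apply: cvgB; try exact: cvg_nakano_head;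
    exact: cvg_cst.
apply: (@cvg_le _ _ U _ (theta \o x) (fun i => nakano_head p N (npart (x i)) +
    ((1 + eps) * (theta (y i) - nakano_head p N (npart (y i))) +
     C * (modular d - nakano_head p N d)))); first exact: utheta_cvg.
  apply: cvgD; first exact: cvg_coord_head.
  apply: cvgD; last exact: cvg_cst.
  by apply: cvg_mulc; apply: cvgB; [exact: utheta_cvg|exact: cvg_coord_head].
move=> i /=.
have tl : 1 * (modular (npart (x i)) - nakano_head p N (npart (x i))) +
    0 * (modular d - nakano_head p N d) <=
    (1 + eps) * (modular (npart (y i)) - nakano_head p N (npart (y i))) +
    C * (modular d - nakano_head p N d).
  apply: nakano_tail_le => n _; rewrite mul1r mul0r addr0 nxy nakanoDE.
  apply: le_trans (powC (p n) _ _ _ (rnorm_ge0 _) (rnorm_ge0 _)); last first.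
    by rewrite ltW ?exponent_gt0 //= pM.
  by apply: ler_powR2; rewrite ?rnorm_ge0 ?ler_rnormD // ltW ?exponent_gt0.
rewrite !thetaE hxy.
by apply: (real_comb1 _ tl); apply: mulr_ge0 (sqr_ge0 _); exact: ltW.
Qed.

Lemma utheta_shift x y (e f d : nakano_sum p E) :
  coord_cvg x e -> coord_cvg y f ->
  (forall i, npart (x i) = npart (y i) + d) -> (forall i, hpart (x i) = hpart (y i)) ->
  utheta x - modular e = utheta y - modular f.
Proof.
move=> xe yf nxy hxy; apply/eqP; rewrite eq_le (utheta_shift_le xe yf nxy hxy) /=.
by apply: (utheta_shift_le (d := - d) yf xe) => i; rewrite ?hxy ?nxy ?addrK.
Qed.

Definition null (x : I -> Z) := coord_cvg x (fun=> 0).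

Lemma coord_cvgD (x y : I -> Z) (e f : nakano_sum p E) :
  coord_cvg x e -> coord_cvg y f -> coord_cvg (fun i => x i + y i) (e + f).
Proof. by move=> xe yf n; exact: norm_cvgD (xe n) (yf n). Qed.

Lemma coord_cvgZ a (x : I -> Z) (e : nakano_sum p E) :
  coord_cvg x e -> coord_cvg (fun i => a *: x i) (a *: e).
Proof. by move=> xe n; exact: norm_cvgZ (xe n). Qed.

Lemma coord_cvg_cst (x : Z) : coord_cvg (fun=> x) (npart x).
Proof. by move=> n; exact: norm_cvg_cst. Qed.

Lemma nullD (x y : I -> Z) : null x -> null y -> null (fun i => x i + y i).
Proof.
by move=> x0 y0; have := coord_cvgD (e := 0) (f := 0) x0 y0; rewrite addr0.
Qed.

Lemma nullZ a (x : I -> Z) : null x -> null (fun i => a *: x i).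
Proof. by move=> x0; have := coord_cvgZ a (e := 0) x0; rewrite scaler0. Qed.

Lemma cvg_null_head (x : I -> Z) N : null x ->
  nakano_head p N (npart (x i)) @[i --> U] --> (0 : R).
Proof.
move=> x0; have -> : 0 = nakano_head p N (fun n => 0 : E n) :> R.
  rewrite /nakano_head big1 // => n _.
  by rewrite rnorm0 powR0 // gt_eqF ?exponent_gt0.
exact: cvg_coord_head.
Qed.

(** Compactness in each [E n] gives the coordinates. The heads of the limit family are bounded by
    [utheta x], which puts it into the Nakano sum. *)
Lemma coord_cvg_exists x : (forall n, finite_dim (E n)) ->
  exists e : nakano_sum p E, coord_cvg x e.
Proof.
move=> Efin; have [M xM] := family_valP x.
have xl n : exists l : E n, norm_cvg U (fun i => npart (x i) n) l.
  apply: (@finite_dim_compact _ _ _ _ U _ M) => // i.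
  exact: le_trans (npart_le _ _) (xM i).
pose e n := sval (cid (xl n)); have xe : coord_cvg x e by move=> n; rewrite /e; case: cid.
have en : nakano p (fun n => `|e n|).
  apply: (@nakano_bounded _ _ _ _ _ (utheta x)) => N.
  apply: (cvg_le (cvg_coord_head (N := N) xe) (@utheta_cvg x)).
  move=> i; apply: le_trans (nakano_head_le N _) _.
  by rewrite thetaE lerDl sqr_ge0.
by exists (NakanoSum en).
Qed.

Section NullFamilies.
Hypothesis p_cvg2 : p n @[n --> \oo] --> (2 : R).

(** For a null family the heads vanish in the limit, and on the tails [c ^ p n] is close to [c ^ 2],
    the factor by which the Hilbert part scales. *)
Let utheta_scale_le (c : R) x : 0 < c -> null x ->
  utheta (scalar_of_real c *: x) <= c ^+ 2 * utheta x.
Proof.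
move=> c0 x0; have xc0 := nullZ (scalar_of_real c) x0.
have x_ge0 := utheta_ge0 x.
suff main d : 0 < d -> utheta (scalar_of_real c *: x) <= (c ^+ 2 + d) * utheta x.
  apply/ler_addgt0Pr => t t0.
  have s10 : 0 < utheta x + 1 by rewrite ltr_wpDl.
  apply: le_trans (main (t / (utheta x + 1)) _) _; first by rewrite divr_gt0.
  rewrite mulrDl lerD2l mulrAC ler_pdivrMr //.
  by rewrite ler_wpM2l ?ltW // ltrDl.
move=> d0; have [N _ /(_ N (leqnn N)) NP] := near_powR_sqr p_cvg2 c0 d0.
apply: (@cvg_le _ _ U _ (theta \o (scalar_of_real c *: x)) (fun i =>
  nakano_head p N (npart (scalar_of_real c *: x i)) + (c ^+ 2 + d) * theta (x i))).
- exact: utheta_cvg.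
- rewrite -[_ * utheta x]add0r; apply: cvgD; first exact: cvg_null_head.
  by apply: cvg_mulc; exact: utheta_cvg.
move=> i /=.
have tl : 1 * (modular (npart (scalar_of_real c *: x i)) -
      nakano_head p N (npart (scalar_of_real c *: x i))) +
    0 * (modular (0 : nakano_sum p E) - nakano_head p N (0 : nakano_sum p E)) <=
    (c ^+ 2 + d) * (modular (npart (x i)) - nakano_head p N (npart (x i))) +
    0 * (modular (0 : nakano_sum p E) - nakano_head p N (0 : nakano_sum p E)).
  apply: nakano_tail_le => n Nn; rewrite mul1r !mul0r !addr0.
  rewrite npartZ nakanoZE rnormZr powRM ?rnorm_ge0 // ler_wpM2r ?powR_ge0 //.
  by rewrite gtr0_norm // NP.
rewrite !thetaE hpartZ rnormZr exprMn real_normK ?num_real //.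
have cd0 : 0 <= c ^+ 2 + d by rewrite addr_ge0 ?sqr_ge0 // ltW.
apply: (real_comb2 _ _ tl (erefl _)) => //; first exact: mulr_ge0 (nakano_head_ge0 _ _ _).
by rewrite mulr_ge0 ?sqr_ge0 // ltW.
Qed.

Lemma utheta_scale (c : R) x : 0 < c -> null x ->
  utheta (scalar_of_real c *: x) = c ^+ 2 * utheta x.
Proof.
move=> c0 x0; apply/eqP; rewrite eq_le utheta_scale_le //=.
have ci0 : 0 < c^-1 by rewrite invr_gt0.
have xc0 : null (scalar_of_real c *: x : bounded_family Z) by exact: nullZ.
have := utheta_scale_le ci0 xc0.
rewrite scalerA -scalar_of_realM mulVf ?gt_eqF // scalar_of_real1 scale1r.
by rewrite exprVn ler_pdivlMl ?exprn_gt0.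
Qed.

Lemma utheta_parallelogram_le x y :
  jordan_von_neumann (E n) @[n --> \oo] --> (1 : R) -> parallelogram H ->
  null x -> null y -> utheta (x + y) + utheta (x - y) <= 2 * (utheta x + utheta y).
Proof.
move=> jvn Hpar x0 y0; have yN0 : null (- y).
  by rewrite -scaleN1r; exact: nullZ.
have xy0 : 0 <= utheta x + utheta y by rewrite addr_ge0 ?utheta_ge0.
suff main d : 0 < d ->
    utheta (x + y) + utheta (x - y) <= (2 + d) * (utheta x + utheta y).
  apply/ler_addgt0Pr => t t0; move: main xy0; set s := utheta x + utheta y => main s0.
  have s10 : 0 < s + 1 by rewrite ltr_wpDl.
  apply: le_trans (main (t / (s + 1)) _) _; first by rewrite divr_gt0.
  rewrite mulrDl lerD2l mulrAC ler_pdivrMr //.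
  by rewrite ler_wpM2l ?ltW // ltrDl.
move=> d0.
have [N _ /(_ N (leqnn N)) NP] := nakano_tail_parallelogram p_cvg2 d0 jvn.
apply: (@cvg_le _ _ U _ (fun i => theta ((x + y) i) + theta ((x - y) i)) (fun i =>
  nakano_head p N (npart ((x + y) i)) + nakano_head p N (npart ((x - y) i)) +
  (2 + d) * (theta (x i) + theta (y i)))).
- by apply: cvgD; exact: utheta_cvg.
- have -> : (2 + d) * (utheta x + utheta y) =
    0 + 0 + (2 + d) * (utheta x + utheta y) by rewrite !add0r.
  apply: cvgD.
    apply: cvgD; apply: cvg_null_head; first exact: nullD.
    exact: nullD x0 yN0.
  by apply: cvg_mulc; apply: cvgD; exact: utheta_cvg.
move=> i; rewrite !familyDE familyNE.
have tl : 1 * (modular (npart (x i + y i)) - nakano_head p N (npart (x i + y i))) +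
    1 * (modular (npart (x i - y i)) - nakano_head p N (npart (x i - y i))) <=
    (2 + d) * (modular (npart (x i)) - nakano_head p N (npart (x i))) +
    (2 + d) * (modular (npart (y i)) - nakano_head p N (npart (y i))).
  apply: nakano_tail_le => n Nn; rewrite !mul1r -mulrDr npartD npartD npartN.
  by rewrite !nakanoDE nakanoNE; exact: NP.
have Hxy := Hpar (hpart (x i)) (hpart (y i)).
rewrite !thetaE !hpartD hpartN.
have d20 : 0 <= 2 + d by rewrite addr_ge0 // ltW.
apply: (real_comb3 _ _ _ tl Hxy (erefl _)) => //; first exact: mulr_ge0 (nakano_head_ge0 _ _ _).
  exact: mulr_ge0 (nakano_head_ge0 _ _ _).
by rewrite mulr_ge0 ?addr_ge0 ?sqr_ge0 // ltW.
Qed.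

(** By [utheta_scale] the modulars of [c *: x i] tend to [(c * s) ^ 2], the square modular of [c]
    times the scalar [s]. Convergence of modulars at every scale gives convergence of the norms to
    [s]. *)
Lemma utheta_null x : null x -> utheta x = ultranorm U x ^+ 2.
Proof.
move=> x0; pose s := Num.sqrt (utheta x).
have s2 : s ^+ 2 = utheta x by rewrite sqr_sqrtr // utheta_ge0.
rewrite -s2; congr (_ ^+ 2).
apply: (cvg_unique (@Rhausdorff R) _ (@ultranorm_cvg _ _ _ U _ _ x)).
have -> : (fun i => rnorm (x i)) = (fun i =>
    luxemburg_norm (x i : modular_sum (nakano_sum p E) (square_modular H))).
  by apply/funext => i; rewrite rnorm_luxemburg.
have -> : s = @luxemburg_norm R k (square_modular (scalars R k)) (scalar_of_real s).
  by rewrite luxemburg_square rnorm_scalar ger0_norm // sqrtr_ge0.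
apply: cvg_luxemburg_norm => c c0; rewrite square_modularE.
have -> : rnorm (scalar_of_real c *: scalar_of_real s : scalars R k) ^+ 2 =
    utheta (scalar_of_real c *: x).
  by rewrite utheta_scale // -s2 rnormZr rnorm_scalar !exprMn !real_normK ?num_real.
have -> : (fun i => modular (scalar_of_real c *:
      (x i : modular_sum (nakano_sum p E) (square_modular H)))) =
    (fun i => theta ((scalar_of_real c *: x) i)).
  by apply/funext => i; rewrite familyZE.
exact: utheta_cvg.
Qed.

End NullFamilies.
End UltraTheta.
End NakanoSumHilbert.

(** * Subspaces, completeness and inner products *)

Section Subspaces.
Context {R : realType} {k : scalar_kind}.
Variable V : normedModType (scalars R k).

Record linear_subspace := LinearSubspace {
  carrier :> V -> Prop;
  carrier0 : carrier 0;
  carrierP : forall a x y, carrier x -> carrier y -> carrier (a *: x + y)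
}.

Variable S : linear_subspace.

Record subspace : Type := Subspace { subval :> V; subvalP : S subval }.

Lemma subspaceP (x y : subspace) : subval x = subval y -> x = y.
Proof.
case: x y => [x xP] [y yP] /= xy; subst y; congr Subspace; exact: Prop_irrelevance.
Qed.

Lemma carrierZ a x : S x -> S (a *: x).
Proof. by move=> Sx; rewrite -[_ *: _]addr0; apply: carrierP => //; exact: carrier0. Qed.

Lemma carrierD x y : S x -> S y -> S (x + y).
Proof. by move=> Sx; rewrite -[x]scale1r; exact: carrierP. Qed.

Lemma carrierN x : S x -> S (- x).
Proof. by rewrite -scaleN1r; exact: carrierZ. Qed.

HB.instance Definition _ := gen_eqMixin subspace.
HB.instance Definition _ := gen_choiceMixin subspace.

Definition subspace_zero := Subspace (carrier0 S).
Definition subspace_add (x y : subspace) := Subspace (carrierD (subvalP x) (subvalP y)).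
Definition subspace_opp (x : subspace) := Subspace (carrierN (subvalP x)).
Definition subspace_scale a (x : subspace) := Subspace (carrierZ a (subvalP x)).

Let addA : associative subspace_add.
Proof. by move=> x y z; apply: subspaceP; rewrite /= addrA. Qed.
Let addC : commutative subspace_add.
Proof. by move=> x y; apply: subspaceP; rewrite /= addrC. Qed.
Let add0 : left_id subspace_zero subspace_add.
Proof. by move=> x; apply: subspaceP; rewrite /= add0r. Qed.
Let addN : left_inverse subspace_zero subspace_opp subspace_add.
Proof. by move=> x; apply: subspaceP; rewrite /= addNr. Qed.

HB.instance Definition _ := GRing.isZmodule.Build subspace addA addC add0 addN.

Let scaleA a b (x : subspace) :
  subspace_scale a (subspace_scale b x) = subspace_scale (a * b) x.
Proof. by apply: subspaceP; rewrite /= scalerA. Qed.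
Let scale1 : left_id 1 subspace_scale.
Proof. by move=> x; apply: subspaceP; rewrite /= scale1r. Qed.
Let scaleDr : right_distributive subspace_scale +%R.
Proof. by move=> a x y; apply: subspaceP; rewrite /= scalerDr. Qed.
Let scaleDl (x : subspace) : {morph subspace_scale^~ x : a b / a + b}.
Proof. by move=> a b; apply: subspaceP; rewrite /= scalerDl. Qed.

HB.instance Definition _ := GRing.Zmodule_isLmodule.Build
  (scalars R k) subspace scaleA scale1 scaleDr scaleDl.

Let norm (x : subspace) : scalars R k := `|subval x|.

Let normD (x y : subspace) : norm (x + y) <= norm x + norm y.
Proof. exact: ler_normD. Qed.
Let normZ (l : scalars R k) (x : subspace) : norm (l *: x) = `|l| * norm x.
Proof. exact: normrZ. Qed.
Let norm_eq0 (x : subspace) : norm x = 0 -> x = 0.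
Proof. by move=> /normr0_eq0 x0; apply: subspaceP. Qed.

HB.instance Definition _ :=
  @Lmodule_isNormed.Build (scalars R k) subspace norm normD normZ norm_eq0.

Lemma subvalD (x y : subspace) : subval (x + y) = subval x + subval y.
Proof. by []. Qed.
Lemma subvalN (x : subspace) : subval (- x) = - subval x.
Proof. by []. Qed.
Lemma subvalZ a (x : subspace) : subval (a *: x) = a *: subval x.
Proof. by []. Qed.
Lemma rnorm_subval (x : subspace) : rnorm (subval x) = rnorm x.
Proof. by []. Qed.

End Subspaces.

Section BanachFacts.
Context {R : realType} {k : scalar_kind}.
Implicit Types X Y V : normedModType (scalars R k).

Definition norm_cauchy X (F : set_system X) := forall e : R, 0 < e ->
  exists2 A, F A & forall x y, A x -> A y -> rnorm (x - y) < e.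

Definition norm_limit X (F : set_system X) (l : X) := forall e : R, 0 < e ->
  F [set x | rnorm (l - x) < e].

Lemma ball_rnorm X (x y : X) (e : R) :
  ball x (scalar_of_real e) y <-> rnorm (x - y) < e.
Proof. by rewrite -ball_normE /= /ball_ /= normr_lt_real. Qed.

Lemma banachP X : banach X <-> forall F : set_system X, ProperFilter F ->
  norm_cauchy F -> exists l, norm_limit F l.
Proof.
split=> BX F FF.
  move=> Fc; have : cauchy F.
    apply/cauchy_ballP => _ /scalar_gt0_real[e e0 ->].
    have [A FA Ae] := Fc e e0; exists (A, A) => //= -[x y] /= [Ax Ay].
    by apply/ball_rnorm; exact: Ae.
  move=> /(BX F FF)/cvg_ex[l Fl]; exists l => e e0.
  move/fcvg_ballP : Fl => /(_ (scalar_of_real e)); rewrite -scalar_of_real0 scalar_of_real_lt.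
  by move=> /(_ e0); apply: filterS => x /ball_rnorm.
move=> /cauchy_ballP Fc; have [l Fl] : exists l, norm_limit F l.
  apply: BX => // e e0; have [|[A B] /= [FA FB] AB] := Fc (scalar_of_real e).
    by rewrite -scalar_of_real0 scalar_of_real_lt.
  exists (A `&` B); first exact: filterI.
  by move=> x y [Ax _] [_ By]; apply/ball_rnorm/(AB (x, y)).
apply/cvg_ex; exists l; apply/fcvg_ballP => _ /scalar_gt0_real[e e0 ->].
by apply: filterS (Fl e e0) => x /ball_rnorm.
Qed.

Lemma banach_seq_limit X (u : nat -> X) : banach X ->
  (forall e : R, 0 < e -> exists N, forall n, (N <= n)%N -> rnorm (u N - u n) < e) ->
  exists l, norm_cvg \oo u l.
Proof.
move=> /banachP BX uc; have [|l ul] := BX (u @ \oo) _.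
  move=> e e0; have [|N uN] := uc (e / 2); first by rewrite divr_gt0.
  exists [set x | rnorm (u N - x) < e / 2]; first by exists N.
  move=> x y /= xN yN; have -> : x - y = (u N - y) - (u N - x).
    by rewrite opprB [RHS]addrC addrA subrK.
  by apply: le_lt_trans (ler_rnormB _ _) _; rewrite (splitr e) ltrD.
exists l; apply: near_norm_cvg => e e0; near=> n.
by rewrite rnormB_sym ltW //; near: n; exact: ul.
Unshelve. all: by end_near. Qed.

Lemma expr_half_gt0 n : 0 < 2^-1 ^+ n :> R.
Proof. by rewrite exprn_gt0 // invr_gt0. Qed.

Lemma near_expr_half (e : R) : 0 < e -> exists n, 2^-1 ^+ n < e.
Proof.
move=> e0; have : (2^-1 : R) ^+ n @[n --> \oo] --> (0 : R).
  by apply: cvg_expr; rewrite ger0_norm ?invr_ge0 //; lra.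
move=> h; have [N _ NP] : \forall n \near \oo, (2^-1 : R) ^+ n < e by exact: (cvgr_lt _ h).
by exists N; exact: (NP N (leqnn N)).
Qed.

Lemma geometric_tail X (u : nat -> X) (C : R) :
  (forall n, rnorm (u n.+1 - u n) <= C * 2^-1 ^+ n) ->
  forall m n, rnorm (u (n + m)%N - u n) <= 2 * C * 2^-1 ^+ n.
Proof.
move=> uC m n.
(* The exact partial sum of the geometric series makes the induction on [m] go through. *)
suff : rnorm (u (n + m)%N - u n) <= 2 * C * (2^-1 ^+ n - 2^-1 ^+ (n + m)).
  move=> /le_trans; apply; have C0 : 0 <= C.
    by have := le_trans (rnorm_ge0 _) (uC 0%N); rewrite expr0 mulr1.
  by rewrite ler_wpM2l ?mulr_ge0 // gerBl ltW // expr_half_gt0.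
elim: m => [|m IH]; first by rewrite addn0 !subrr rnorm0 mulr0.
rewrite addnS; have -> : u (n + m).+1 - u n = (u (n + m).+1 - u (n + m)%N) + (u (n + m)%N - u n).
  by rewrite addrA subrK.
apply: le_trans (ler_rnormD _ _) _; apply: le_trans (lerD (uC _) IH) _.
by rewrite exprS; lra.
Qed.

Lemma banach_geometric X (u : nat -> X) (C : R) : banach X ->
  (forall n, rnorm (u n.+1 - u n) <= C * 2^-1 ^+ n) ->
  exists l, forall n, rnorm (l - u n) <= 2 * C * 2^-1 ^+ n.
Proof.
move=> BX uC; have tl := geometric_tail uC.
have C0 : 0 <= C by have := le_trans (rnorm_ge0 _) (uC 0%N); rewrite expr0 mulr1.
have [e e0|l ul] := banach_seq_limit (u := u) BX.
  have C10 : 0 < 2 * C + 1 by rewrite ltr_wpDl ?mulr_ge0.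
  have [|N Ne] := @near_expr_half (e / (2 * C + 1)); first by rewrite divr_gt0.
  exists N => n /subnKC <-; rewrite rnormB_sym; apply: le_lt_trans (tl _ _) _.
  move: Ne; rewrite ltr_pdivlMr // => /(le_lt_trans _); apply.
  by rewrite mulrC ler_wpM2l ?(ltW (expr_half_gt0 _)) // lerDl.
exists l => n; 
have ul' : rnorm (u n - u m) @[m --> \oo] --> rnorm (u n - l).
  by apply: norm_cvg_rnorm; apply: norm_cvgB ul; exact: norm_cvg_cst.
rewrite rnormB_sym; apply: (cvgr_to_le ul'); near=> m.
have nm : (n <= m)%N by near: m; exists n.
by rewrite rnormB_sym -(subnKC nm) tl.
Unshelve. all: by end_near. Qed.

(** A Cauchy filter contains decreasing sets [B n] of diameter at most [2^-n], and points chosen in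
    them form a sequence of the required kind. The factor 4 leaves room for the constants lost in
    the applications. *)
Lemma geometric_banach X :
  (forall u : nat -> X, (forall n, rnorm (u n.+1 - u n) <= 2^-1 ^+ n) ->
     exists l, forall n, rnorm (l - u n) <= 4 * 2^-1 ^+ n) -> banach X.
Proof.
move=> Xu; apply/banachP => F FF Fc.
have /choice[A AP] n : exists A, F A /\
    forall x y, A x -> A y -> rnorm (x - y) < 2^-1 ^+ n.
  by have [A] := Fc _ (expr_half_gt0 n); exists A.
pose fix B n := if n is m.+1 then B m `&` A n else A 0%N.
have FB n : F (B n) by elim: n => [|n IH] /=; [|apply: filterI IH _]; exact: (AP _).1.
have BA n : B n `<=` A n by case: n => [|n] //= x [].
have /choice[u uB] n : exists x, B n x by exact: filter_ex (FB n).
have [n|l lu] := Xu u.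
  apply/ltW/(AP n).2; last exact: BA.
  by have [/BA] := uB n.+1.
(* Of the five parts, four bound the distance from [l] to [u n] and one the diameter of [A n]. *)
exists l => e e0; have [|n ne] := @near_expr_half (e / 5); first by rewrite divr_gt0.
apply: filterS (AP n).1 => y Ay /=.
have -> : l - y = (l - u n) + (u n - y) by rewrite addrA subrK.
apply: le_lt_trans (ler_rnormD _ _) _.
have := lu n; have := (AP n).2 _ _ (BA _ _ (uB n)) Ay; move: ne.
by rewrite ltr_pdivlMr //; lra.
Qed.

End BanachFacts.

Section Isometries.
Context {R : realType} {k : scalar_kind}.
Implicit Types X Y V : normedModType (scalars R k).

Lemma isometricI X Y (f : X -> Y) :
  (forall a x y, f (a *: x + y) = a *: f x + f y) ->
  (forall y, exists x, f x = y) -> (forall x, rnorm (f x) = rnorm x) -> isometric X Y.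
Proof.
move=> lf sf nf.
pose mlin := GRing.isLinear.Build (scalars R k) X Y *:%R f lf.
pose F : {linear X -> Y} := HB.pack f mlin.
exists F; split=> [|x]; last by rewrite -!rnormE [rnorm (F x)]nf.
have injf x y : f x = f y -> x = y.
  move=> xy; apply/eqP; rewrite -subr_eq0; apply/eqP/rnorm_eq0.
  have -> : x - y = -1 *: y + x by rewrite scaleN1r addrC.
  by rewrite -nf lf xy scaleN1r addNr rnorm0.
have /choice[g fg] := sf.
by exists g => [x|y]; [apply: injf; rewrite fg|exact: fg].
Qed.

Lemma isometricE X Y : isometric X Y -> exists (f : X -> Y) (g : Y -> X),
  [/\ forall a x y, f (a *: x + y) = a *: f x + f y, cancel f g, cancel g f,
      forall a x y, g (a *: x + y) = a *: g x + g y &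
      (forall x, rnorm (f x) = rnorm x) /\ (forall y, rnorm (g y) = rnorm y)].
Proof.
move=> [f [[g fK gK] fn]]; exists f, g; have fn' x : rnorm (f x) = rnorm x by rewrite /rnorm fn.
split=> //; first exact: linearP.
  by move=> a x y; apply: (can_inj fK); rewrite gK linearP !gK.
by split=> // y; rewrite -fn' gK.
Qed.

Lemma isometric_sym X Y : isometric X Y -> isometric Y X.
Proof.
move=> /isometricE[f [g [_ fK gK gl [_ gn]]]].
by apply: (isometricI gl) => // x; exists (f x).
Qed.

Lemma isometric_refl X : isometric X X.
Proof. by apply: (@isometricI X X id) => // y; exists y. Qed.

Lemma isometric_trans X Y V : isometric X Y -> isometric Y V -> isometric X V.
Proof.
move=> /isometricE[f [f' [fl fK f'K _ [fn _]]]] /isometricE[g [g' [gl gK g'K _ [gn _]]]].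
apply: (@isometricI X V (g \o f)) => /=.
- by move=> a x y; rewrite fl gl.
- by move=> v; exists (f' (g' v)); rewrite f'K g'K.
- by move=> x; rewrite gn fn.
Qed.

Lemma isometric_banach X Y : isometric X Y -> banach X -> banach Y.
Proof.
move=> /isometricE[f [g [fl fK gK gl [fn gn]]]] BX.
have fB x y : f (x - y) = f x - f y.
  by rewrite -[x - y]addrC -scaleN1r fl scaleN1r addrC.
have gB x y : g (x - y) = g x - g y.
  by rewrite -[x - y]addrC -scaleN1r gl scaleN1r addrC.
apply: geometric_banach => u uc.
have [n|l lu] := @banach_geometric _ _ X (g \o u) 1 BX.
  by rewrite /= -gB gn mul1r.
exists (f l) => n; have := lu n; rewrite -fn fB /= gK mulr1.
move=> /le_trans; apply; by rewrite ler_wpM2r ?ler_nat.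
Qed.

End Isometries.

Section UltrapowerFacts.
Context {R : realType} {k : scalar_kind} {I : Type}.
Context (U : set_system I) (UU : UltraFilter U).
Implicit Types X : normedModType (scalars R k).

Lemma ultra_classK X (q : ultrapower UU X) : exists x, q = ultra_class UU x.
Proof. by exists (repr q); rewrite /ultra_class reprK. Qed.

Lemma const_familyP X (x : X) : exists M : R, forall i : I, rnorm x <= M.
Proof. by exists (rnorm x). Qed.

Definition const_family X (x : X) : @bounded_family R k I X :=
  BoundedFamily (const_familyP x).

Definition udiag X (x : X) : ultrapower UU X := ultra_class UU (const_family x).

Lemma udiagP X a (x y : X) : udiag (a *: x + y) = a *: udiag x + udiag y.
Proof.
by rewrite /udiag -ultra_classZ -ultra_classD; congr ultra_class; exact: bounded_familyP.
Qed.

Lemma ultranorm_lim X (x : @bounded_family R k I X) (l : R) :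
  rnorm (x i) @[i --> U] --> l -> ultranorm U x = l.
Proof. by move=> xl; apply: (cvg_lim (@Rhausdorff R)). Qed.

Lemma rnorm_udiag X (x : X) : rnorm (udiag x) = rnorm x.
Proof. by rewrite rnorm_ultra_class; apply: ultranorm_lim; exact: cvg_cst. Qed.

Lemma ultra_classB X (x y : @bounded_family R k I X) :
  ultra_class UU (x - y) = ultra_class UU x - ultra_class UU y.
Proof. by rewrite -scaleN1r ultra_classD ultra_classZ scaleN1r. Qed.

Lemma ultranorm_le X (x : @bounded_family R k I X) (C : R) :
  (\forall i \near U, rnorm (x i) <= C) -> ultranorm U x <= C.
Proof. by move=> xC; apply: (cvgr_to_le (@ultranorm_cvg _ _ _ _ _ _ x)). Qed.

(** Representatives are corrected index by index, so that consecutive ones are close at every index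
    and completeness of [X] applies there. Each correction only affects indices outside a set of
    [U]: a class of norm at most [2^-n] has entries of norm at most [2 * 2^-n] on a set of [U]. *)
Lemma ultrapower_banach X : banach X -> banach (ultrapower UU X).
Proof.
move=> BX; apply: geometric_banach => q qc.
have /choice[x qx] n : exists x, q n = ultra_class UU x := ultra_classK (q n).
pose close n i (y : X) := rnorm (x n.+1 i - y) <= 2 * 2^-1 ^+ n.
pose fix y (n : nat) (i : I) {struct n} : X := if n is m.+1 then
  if close m i (y m i) then x m.+1 i else y m i else x 0%N i.
have yc i n : rnorm (y n.+1 i - y n i) <= 2 * 2^-1 ^+ n.
  rewrite /=; case: ifP => // _.
  by rewrite subrr rnorm0 mulr_ge0 // ltW // expr_half_gt0.
have yx n : \forall i \near U, y n i = x n i.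
  elim: n => [|n IH] /=; first exact: nearW.
  have xc : \forall i \near U, rnorm ((x n.+1 - x n) i) <= 2 * 2^-1 ^+ n.
    apply: (cvgr_le _ (@ultranorm_cvg _ _ _ U _ _ (x n.+1 - x n))).
    rewrite -(rnorm_ultra_class UU) ultra_classB -!qx; apply: le_lt_trans (qc n) _.
    by rewrite ltr_pMl ?expr_half_gt0 // ltr1n.
  near=> i; have -> : y n i = x n i by near: i.
  by rewrite ifT // /close -familyNE -familyDE; near: i.
have /choice[l ly] i := @banach_geometric _ _ X (y ^~ i) 2 BX (yc i).
have [M xM] := family_valP (x 0%N).
have lM i : rnorm (l i) <= 4 + M.
  have -> : l i = (l i - y 0%N i) + x 0%N i by rewrite subrK.
  apply: le_trans (ler_rnormD _ _) _; rewrite lerD //.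
  by apply: le_trans (ly i 0%N) _; rewrite expr0; lra.
exists (ultra_class UU (BoundedFamily (ex_intro _ _ lM))) => n.
rewrite qx -ultra_classB rnorm_ultra_class; apply: ultranorm_le.
near=> i; rewrite familyDE familyNE /=; have <- : y n i = x n i by near: i.
by have := ly i n; rewrite -natrM.
Unshelve. all: by end_near. Qed.

End UltrapowerFacts.

Section ScalarConj.
Context {R : realType} {k : scalar_kind}.
Implicit Types a b : scalars R k.

Lemma scalar_conjD a b : scalar_conj (a + b) = scalar_conj a + scalar_conj b.
Proof. by case: k a b => //= a b; rewrite rmorphD. Qed.

Lemma scalar_conjN a : scalar_conj (- a) = - scalar_conj a.
Proof. by case: k a => //= a; rewrite rmorphN. Qed.

Lemma scalar_conjM a b : scalar_conj (a * b) = scalar_conj a * scalar_conj b.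
Proof. by case: k a b => //= a b; rewrite rmorphM. Qed.

Lemma scalar_conj_real (r : R) : scalar_conj (scalar_of_real r) = scalar_of_real r :> scalars R k.
Proof. by case: k => //=; rewrite /real_complex_def /= oppr0. Qed.

Lemma scalar_of_real_nat n : scalar_of_real n%:R = n%:R :> scalars R k.
Proof.
elim: n => [|n IH]; first exact: scalar_of_real0.
by rewrite -!natr1 scalar_of_realD IH scalar_of_real1.
Qed.

Lemma scalar_mul_conj a : a * scalar_conj a = `|a| ^+ 2.
Proof.
case: k a => [a|[x y]]; first by rewrite /= -expr2 real_normK ?num_real.
rewrite /= sqr_normc //.
Qed.

End ScalarConj.

Section InnerProducts.
Context {R : realType} {k : scalar_kind}.
Variable V : normedModType (scalars R k).

Lemma dot_of_form (ip : V -> V -> scalars R k) :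
  (forall a x y z, ip (a *: x + y) z = a * ip x z + ip y z) ->
  (forall x y, ip x y = scalar_conj (ip y x)) ->
  (forall x, ip x x = `|x| ^+ 2) ->
  exists2 f : {dot V for scalar_conj}, forall x, f x x = `|x| ^+ 2 & forall x y, f x y = ip x y.
Proof.
move=> ipl ipC ipx.
have D x y z : ip (x + y) z = ip x z + ip y z by rewrite -[x]scale1r ipl mul1r scale1r.
have z0 z : ip 0 z = 0 by apply: (addrI (ip 0 z)); rewrite -D !addr0.
have Z a x z : ip (a *: x) z = a * ip x z by rewrite -[a *: x]addr0 ipl z0 addr0.
have B x y z : ip (x - y) z = ip x z - ip y z by rewrite D -scaleN1r Z mulN1r.
pose m1 := isBilinear.Build (scalars R k) V V (scalars R k) *%R
  ((@scalar_conj R k) \; *%R) ip (fun z x y => B x y z)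
  (fun x y z => etrans (ipC x (y - z))
     (etrans (congr1 _ (B y z x)) (etrans (scalar_conjD _ _) (congr2 +%R (esym (ipC x y))
        (etrans (scalar_conjN _) (congr1 -%R (esym (ipC x z))))))))
  (fun z a x => Z a x z)
  (fun x a y => etrans (ipC x (a *: y))
     (etrans (congr1 _ (Z a y x)) (etrans (scalar_conjM _ _) (congr1 ( *%R _) (esym (ipC x y)))))).
pose m2 := isHermitianSesquilinear.Build (scalars R k) V false (@scalar_conj R k) ip
  (fun x y => etrans (ipC x y) (esym (mul1r _))).
have gt0 x : x != 0 -> 0 < ip x x.
  by move=> x0; rewrite ipx exprn_gt0 // normr_gt0.
pose m3 := isDotProduct.Build (scalars R k) V ip gt0.
pose f : {dot V for scalar_conj} := HB.pack ip m1 m2 m3.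
by exists f.
Qed.

Variable ip : {dot V for (@scalar_conj R k)}.
Hypothesis ip_norm : forall x, ip x x = `|x| ^+ 2.

Lemma ipDl x y z : ip (x + y) z = ip x z + ip y z. Proof. exact: linearDl. Qed.
Lemma ipDr x y z : ip x (y + z) = ip x y + ip x z. Proof. exact: linearDr. Qed.
Lemma ipNl x y : ip (- x) y = - ip x y. Proof. exact: linearNl. Qed.
Lemma ipNr x y : ip x (- y) = - ip x y. Proof. exact: linearNr. Qed.
Lemma ipZl a x y : ip (a *: x) y = a * ip x y. Proof. exact: linearZl_LR. Qed.
Lemma ipZr a x y : ip x (a *: y) = scalar_conj a * ip x y.
Proof. exact: linearZr_LR. Qed.
Lemma ipC x y : ip x y = scalar_conj (ip y x).
Proof. by rewrite (hermitian_subproof (s := ip) x y) expr0 mul1r. Qed.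

Lemma rnorm_ip x : scalar_re (ip x x) = rnorm x ^+ 2.
Proof.
rewrite ip_norm -rnormE -[RHS](@scalar_of_realK R k); congr scalar_re.
by rewrite !expr2 scalar_of_realM.
Qed.

Lemma ip_parallelogram : parallelogram V.
Proof.
move=> x y; rewrite -!rnorm_ip; apply: (@scalar_of_real_inj R k).
have n z : scalar_of_real (scalar_re (ip z z)) = ip z z.
  by apply: scalar_reK; rewrite ip_norm exprn_ge0.
rewrite !(scalar_of_realD, scalar_of_realM) !n.
rewrite ?scalar_of_real1.
by rewrite !(ipDl, ipDr, ipNl, ipNr); ring.
Qed.

End InnerProducts.

(** * The Jordan-von Neumann theorem *)

Section JordanVonNeumann.
Context {R : realType} {k : scalar_kind}.
Variable V : normedModType (scalars R k).
Hypothesis par : parallelogram V.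
Implicit Types x y z : V.

Let N x := rnorm x ^+ 2.
Let b x y : R := (N (x + y) - N (x - y)) / 4.

Let NN x : N (- x) = N x. Proof. by rewrite /N rnormN. Qed.

Let bC x y : b x y = b y x.
Proof. by rewrite /b (addrC x y) -(NN (x - y)) opprB. Qed.

Let b0 y : b 0 y = 0.
Proof. by rewrite /b add0r sub0r NN subrr mul0r. Qed.

Let bNr x y : b x (- y) = - b x y.
Proof. by rewrite /b opprK; ring. Qed.

Let bNl x y : b (- x) y = - b x y.
Proof. by rewrite bC bNr bC. Qed.

Let b_mid x z y : b (x + z) y + b (x - z) y = 2 * b x y.
Proof.
have h1 := par (x + y) z; have h2 := par (x - y) z; rewrite -/(N _) -/(N _) in h1 h2.
rewrite /b (addrAC x z y) (addrAC x (- z) y) (addrAC x z (- y)) (addrAC x (- z) (- y)).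
by rewrite /N in h1 h2 *; lra.
Qed.

(** [b_mid] is applied to half the sum and half the difference of [x] and [z], and then to [h]
    twice, which identifies [2 * b h y] with [b (h + h) y]. *)
Let bD x z y : b (x + z) y = b x y + b z y.
Proof.
pose h : V := scalar_of_real 2^-1 *: (x + z).
pose d : V := scalar_of_real 2^-1 *: (x - z).
have hx (u : V) : scalar_of_real 2^-1 *: u + scalar_of_real 2^-1 *: u = u.
  have e : 2^-1 + 2^-1 = 1 :> R by lra.
  by rewrite -scalerDl -scalar_of_realD e scalar_of_real1 scale1r.
have hdx : h + d = x by rewrite -scalerDr addrACA subrr addr0 scalerDr hx.
have hdz : h - d = z by rewrite -scalerBr opprB addrC addrA subrK scalerDr hx.
have hh : h + h = x + z by rewrite hx.
have := b_mid h d y; rewrite hdx hdz => ->.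
by have := b_mid h h y; rewrite hh subrr b0 addr0.
Qed.

(** Weaker than Cauchy-Schwarz, but it bounds [b] on the multiples [r x] with [0 <= r <= 1]
    uniformly. *)
Let b_bound x y : `|b x y| <= rnorm x * (rnorm x + rnorm y).
Proof.
have h1 : rnorm (x + y) <= rnorm (x - y) + 2 * rnorm x.
  have -> : x + y = - (x - y) + (x + x) by rewrite opprB addrA subrK addrC.
  apply: le_trans (ler_rnormD _ _) _; rewrite rnormN lerD2l mulr_natl mulr2n.
  exact: ler_rnormD.
have h2 : rnorm (x - y) <= rnorm (x + y) + 2 * rnorm x.
  have -> : x - y = - (x + y) + (x + x) by rewrite opprD addrACA addNr add0r addrC.
  apply: le_trans (ler_rnormD _ _) _; rewrite rnormN lerD2l mulr_natl mulr2n.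
  exact: ler_rnormD.
have h3 := ler_rnormD x y; have h4 := ler_rnormB x y.
have h5 := rnorm_ge0 (x + y); have h6 := rnorm_ge0 (x - y).
have h7 := rnorm_ge0 x; have h8 := rnorm_ge0 y.
rewrite /b /N subr_sqr normrM normrM (ger0_norm (addr_ge0 h5 h6)).
rewrite (@ger0_norm _ 4^-1) ?invr_ge0 // ler_pdivrMr //.
have : `|rnorm (x + y) - rnorm (x - y)| <= 2 * rnorm x.
  by rewrite ler_norml; lra.
move=> /ler_pM /(_ (_ : rnorm (x + y) + rnorm (x - y) <= 2 * (rnorm x + rnorm y))) h.
apply: le_trans (h _ _ _) _ => //; first exact: addr_ge0.
  by lra.
by rewrite le_eqVlt; apply/orP; left; apply/eqP; ring.
Qed.

Let bMn n x y : b (x *+ n) y = n%:R * b x y.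
Proof.
elim: n => [|n IH]; first by rewrite mulr0n b0 mul0r.
by rewrite mulrS bD IH -natr1; ring.
Qed.

(** Write [n * t = m + r] with [m] the integer part. Additivity takes care of [m], and the remainder
    contributes at most [C]. So [n] times the defect of homogeneity is bounded in [n], and the
    defect is 0. *)
Let bZr_ge0 (t : R) x y : 0 <= t -> b (scalar_of_real t *: x) y = t * b x y.
Proof.
move=> t0; pose C := rnorm x * (rnorm x + rnorm y) + `|b x y|.
have C0 : 0 <= C by rewrite addr_ge0 // mulr_ge0 ?addr_ge0 ?rnorm_ge0.
suff main n : n%:R * `|b (scalar_of_real t *: x) y - t * b x y| <= C.
  apply/eqP; rewrite -subr_eq0 -normr_le0 leNgt; apply/negP => d0.
  have := main (Num.bound (C / `|b (scalar_of_real t *: x) y - t * b x y|)).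
  rewrite leNgt => /negP; apply; rewrite -ltr_pdivrMr //.
  by apply: archi_boundP; rewrite divr_ge0.
have nt0 : 0 <= n%:R * t by rewrite mulr_ge0.
have /andP[m1 m2] := truncn_itv nt0; set m := Num.truncn (n%:R * t) in m1 m2.
pose r := n%:R * t - m%:R.
have r0 : 0 <= r by rewrite subr_ge0.
have r1 : r <= 1 by rewrite lerBlDr addrC -natr1 in m2 *; exact: ltW.
have e : n%:R * b (scalar_of_real t *: x) y = m%:R * b x y + b (scalar_of_real r *: x) y.
  rewrite -!bMn -bD; congr b.
  have nE (u : V) j : u *+ j = scalar_of_real j%:R *: u.
    by rewrite scalar_of_real_nat scaler_nat.
  by rewrite !nE scalerA -scalar_of_realM -scalerDl -scalar_of_realD addrC subrK.
rewrite -[n%:R]ger0_norm // -normrM mulrBr e.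
have -> : m%:R * b x y + b (scalar_of_real r *: x) y - n%:R * (t * b x y) =
    b (scalar_of_real r *: x) y - r * b x y by rewrite /r; ring.
apply: le_trans (ler_normB _ _) _; rewrite lerD //; last first.
  by rewrite normrM ger0_norm // ler_piMl.
apply: le_trans (b_bound _ _) _; rewrite rnormZr ger0_norm //.
have rx : r * rnorm x <= rnorm x by rewrite ler_piMl ?rnorm_ge0.
by rewrite ler_pM ?addr_ge0 ?mulr_ge0 ?rnorm_ge0 // lerD2r.
Qed.

Let bZ (t : R) x y : b (scalar_of_real t *: x) y = t * b x y.
Proof.
have [t0|t0] := leP 0 t; first exact: bZr_ge0.
rewrite -[t]opprK scalar_of_realN scaleNr bNl bZr_ge0 ?oppr_ge0 ?ltW //.
by rewrite !mulNr.
Qed.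

Let bxx x : b x x = rnorm x ^+ 2.
Proof.
rewrite /b subrr {2}/N rnorm0 expr0n subr0 /N.
have -> : x + x = scalar_of_real 2 *: x.
  by rewrite scalar_of_real_nat scaler_nat mulr2n.
by rewrite rnormZr ger0_norm // exprMn; field.
Qed.

Definition polarization := b.

Lemma polarizationC x y : polarization x y = polarization y x.
Proof. exact: bC. Qed.

Lemma polarizationD x y z : polarization (x + y) z = polarization x z + polarization y z.
Proof. exact: bD. Qed.

Lemma polarizationN x y : polarization (- x) y = - polarization x y.
Proof. exact: bNl. Qed.

Lemma polarizationZ (t : R) x y :
  polarization (scalar_of_real t *: x) y = t * polarization x y.
Proof. exact: bZ. Qed.

Lemma polarizationxx x : polarization x x = rnorm x ^+ 2.
Proof. exact: bxx. Qed.

Lemma polarization_unit (u : scalars R k) x y : rnorm u = 1 ->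
  polarization (u *: x) (u *: y) = polarization x y.
Proof.
by move=> u1; rewrite /polarization /b /N -scalerDr -scalerBr !rnormZ u1 !mul1r.
Qed.

End JordanVonNeumann.

Lemma jordan_von_neumann_real (R : realType)
    (V : normedModType (scalars R RealScalars)) : parallelogram V ->
  exists f : {dot V for (@scalar_conj R RealScalars)}, forall x, f x x = `|x| ^+ 2.
Proof.
move=> par.
have [|||f fx _] := @dot_of_form R RealScalars V (@polarization R RealScalars V); last by exists f.
- by move=> a x y z; rewrite polarizationD // (@polarizationZ R RealScalars).
- by move=> x y; exact: (@polarizationC R RealScalars).
- by move=> x; rewrite (@polarizationxx R RealScalars).
Qed.

Lemma complex_split (R : realType) (s t : R) :
  Complex s t = real_complex R s + real_complex R t * Complex 0 1 :> R[i].
Proof. by rewrite /real_complex_def /=; simpc. Qed.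

Lemma jordan_von_neumann_complex (R : realType)
    (V : normedModType (scalars R ComplexScalars)) : parallelogram V ->
  exists f : {dot V for (@scalar_conj R ComplexScalars)}, forall x, f x x = `|x| ^+ 2.
Proof.
move=> par; pose I : scalars R ComplexScalars := Complex 0 1.
pose B (x y : V) : R := polarization x y.
have I1 : rnorm I = 1 by rewrite /rnorm /I /= expr0n expr1n add0r sqrtr1.
have IIN (x : V) : I *: (I *: x) = - x.
  rewrite scalerA -scaleN1r; congr (_ *: _).
  by apply/eqP; rewrite eq_complex /= !mul0r !mulr0 mulr1 sub0r addr0 oppr0 !eqxx.
have BI x y : B (I *: x) y = - B x (I *: y).
  by rewrite /B -(@polarization_unit _ _ _ I) // IIN polarizationN.
have BIx x : B x (I *: x) = 0.
  by have := BI x x; rewrite /B polarizationC; lra.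
have BC x y : B x y = B y x by exact: polarizationC.
have BD x y z : B (x + y) z = B x z + B y z by exact: polarizationD.
have BZ (t : R) x y : B (scalar_of_real t *: x) y = t * B x y by exact: polarizationZ.
(* The imaginary part is forced: conjugate linearity requires [ip x (I *: y) = - I * ip x y], whose
   real part is the imaginary part of [ip x y]. *)
pose ip (x y : V) : scalars R ComplexScalars := Complex (B x y) (B x (I *: y)).
have [|||f fx _] := @dot_of_form R ComplexScalars V ip; last by exists f.
- move=> [s t] x y z.
  have -> : Complex s t *: x = (scalar_of_real s : scalars R ComplexScalars) *: x
      + (scalar_of_real t : scalars R ComplexScalars) *: (I *: x).
    rewrite scalerA -scalerDl; congr (_ *: _).
    exact: complex_split.
  rewrite /ip !BD !BZ !BI IIN.
  have -> : B x (- z) = - B x z by rewrite BC /B polarizationN -/(B _ _) BC.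
  by apply/eqP; rewrite eq_complex /=; apply/andP; split; apply/eqP; ring.
- move=> x y; rewrite /ip; apply/eqP; rewrite eq_complex /= (BC y x) eqxx /=.
  by rewrite (BC y) BI opprK.
- move=> x; rewrite /ip BIx /B polarizationxx // -rnormE.
  apply/eqP; rewrite eq_complex /= !expr2 /=.
  by rewrite !mul0r !mulr0 subr0 addr0 !eqxx.
Qed.

Theorem jordan_von_neumann_theorem (R : realType) (k : scalar_kind)
    (V : normedModType (scalars R k)) : parallelogram V ->
  exists f : {dot V for (@scalar_conj R k)}, forall x, f x x = `|x| ^+ 2.
Proof.
by case: k V => V; [exact: jordan_von_neumann_real|exact: jordan_von_neumann_complex].
Qed.

Lemma hilbert_of_parallelogram (R : realType) (k : scalar_kind)
    (V : normedModType (scalars R k)) : banach V -> parallelogram V -> hilbert V.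
Proof. by move=> ? /jordan_von_neumann_theorem. Qed.

Lemma hilbert_parallelogram (R : realType) (k : scalar_kind)
    (V : normedModType (scalars R k)) : hilbert V -> parallelogram V.
Proof. by move=> [_ [ip ipE]]; exact: ip_parallelogram ipE. Qed.

(** * Ultrapowers of Nakano sums *)

Lemma luxemburg_norm_mono (R : realType) (k : scalar_kind) (X Y : modularType R k)
    (x : X) (y : Y) :
  (forall c : R, 0 < c ->
     modular (scalar_of_real c *: x) <= modular (scalar_of_real c *: y)) ->
  luxemburg_norm x <= luxemburg_norm y.
Proof.
move=> xy; apply/ler_addgt0Pr => e e0; set l := luxemburg_norm y + e.
have l0 : 0 < l by rewrite ltr_wpDl ?luxemburg_norm_ge0.
have li0 : 0 < l^-1 by rewrite invr_gt0.
suff : l^-1 * luxemburg_norm x <= 1 by rewrite ler_pdivrMl // mulr1.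
apply: luxemburg_norm_le; first exact: ltW.
apply: le_trans (xy _ li0) _; apply/ltW/modular_lt1; first exact: ltW.
by rewrite ltr_pdivrMl // mulr1 ltrDl.
Qed.

Section PairNorms.
Context {R : realType} {k : scalar_kind} (p : exponents R).
Variables (E : nat -> normedModType (scalars R k)) (H : normedModType (scalars R k)).
Local Notation Z := (nakano_sum_hilbert p E H).

Lemma rnorm_npair0r (z : Z) : rnorm (npair (npart z) 0 : Z) <= rnorm z.
Proof.
rewrite !rnorm_luxemburg; apply: luxemburg_norm_mono => c _.
rewrite !modular_sumE /= lerD2l !square_modularE scaler0 rnorm0 expr0n.
exact: sqr_ge0.
Qed.

Lemma rnorm_npair0l (h : H) : rnorm (npair 0 h : Z) = rnorm h.
Proof.
rewrite rnorm_luxemburg -luxemburg_square; apply: luxemburg_norm_modular => c.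
by rewrite modular_sumE /= scaler0 modular0 add0r.
Qed.

Lemma rnorm_hpart (z : Z) : rnorm (hpart z) <= rnorm z.
Proof.
rewrite -luxemburg_square rnorm_luxemburg; apply: luxemburg_norm_mono => c _.
by rewrite modular_sumE lerDr modular_ge0.
Qed.

Lemma modular_scaleE (c : R) (z : Z) :
  modular (scalar_of_real c *: (z : modular_sum (nakano_sum p E) (square_modular H))) =
  modular (scalar_of_real c *: npart z) + c ^+ 2 * rnorm (hpart z) ^+ 2.
Proof.
rewrite modular_sumE; congr (_ + _).
by rewrite square_modularE [rnorm _]rnormZr exprMn real_normK ?num_real.
Qed.

End PairNorms.

Lemma null_residual (R : realType) (k : scalar_kind) (p : exponents R)
    (E : nat -> normedModType (scalars R k)) (H : normedModType (scalars R k))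
    (I : Type) (U : set_system I) (UU : UltraFilter U)
    (x : I -> nakano_sum_hilbert p E H) (e : nakano_sum p E) :
  coord_cvg U x e -> null U (fun i => x i - npair e 0).
Proof.
move=> xe n.
have -> : (fun i => npart (x i - npair e 0) n) = (fun i => npart (x i) n - e n).
  by apply/funext => i; rewrite npartD npartN nakanoDE nakanoNE.
by rewrite -(subrr (e n)); apply: norm_cvgB (xe n) _; exact: norm_cvg_cst.
Qed.

(** This is [utheta_shift] for the families [e + y], with coordinatewise limit [e], and [y], with
    limit 0. *)
Lemma utheta_npair (R : realType) (k : scalar_kind) (p : exponents R)
    (E : nat -> normedModType (scalars R k)) (H : normedModType (scalars R k))
    (I : Type) (U : set_system I) (UU : UltraFilter U)
    (y : @bounded_family R k I (nakano_sum_hilbert p E H)) (e : nakano_sum p E) :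
  null U y ->
  utheta U (const_family (npair e 0 : nakano_sum_hilbert p E H) + y) =
  modular e + utheta U y.
Proof.
move=> y0; set x := _ + y.
suff : utheta U x - modular e = utheta U y - modular (0 : nakano_sum p E).
  by rewrite modular0 subr0 => <-; rewrite addrC subrK.
apply: (@utheta_shift _ _ p E H I U UU x y e 0 e) => // [|i|i]; rewrite /x.
- have := @coord_cvgD _ _ p E H I U UU _ _ e 0
    (@coord_cvg_cst _ _ p E H I U UU (npair e 0 : nakano_sum_hilbert p E H)) y0.
  by rewrite addr0; exact.
- by rewrite familyDE npartD addrC.
- by rewrite familyDE hpartD add0r.
Qed.

(** The reverse inequality is the given one for [x + y] and [x - y], whose sum and difference are
    [2 x] and [2 y]. *)
Lemma parallelogram_of_le (R : realType) (k : scalar_kind)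
    (V : normedModType (scalars R k)) :
  (forall x y : V, rnorm (x + y) ^+ 2 + rnorm (x - y) ^+ 2 <=
    2 * (rnorm x ^+ 2 + rnorm y ^+ 2)) -> parallelogram V.
Proof.
move=> le x y; apply/eqP; rewrite eq_le le /=.
have dbl (z : V) : rnorm (z + z) ^+ 2 = 4 * rnorm z ^+ 2.
  rewrite -mulr2n -scaler_nat -scalar_of_real_nat rnormZr exprMn ger0_norm //.
  by rewrite -natrX.
have := le (x + y) (x - y).
rewrite addrACA subrr addr0 opprB [x + y + _]addrC addrA subrK !dbl.
by lra.
Qed.

Section UltraDecomposition.
Local Opaque rnorm ultra_class ultranorm.
Context {R : realType} {k : scalar_kind} (p : exponents R).
Variables (E : nat -> normedModType (scalars R k)) (H : normedModType (scalars R k)).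
Hypothesis p_cvg2 : p n @[n --> \oo] --> (2 : R).
Hypothesis E_fin : forall n, finite_dim (E n).
Hypothesis E_jvn : jordan_von_neumann (E n) @[n --> \oo] --> (1 : R).
Hypothesis H_par : parallelogram H.
Context {I : Type} (U : set_system I) {UU : UltraFilter U}.
Local Notation Z := (nakano_sum_hilbert p E H).
Local Notation UZ := (ultrapower UU Z).

Let null_class (q : UZ) : Prop :=
  exists2 x : @bounded_family R k I Z, q = ultra_class UU x & null U x.

Let null_class0 : null_class 0.
Proof. by exists 0 => // n; exact: norm_cvg_cst. Qed.

Let null_classP a q r : null_class q -> null_class r -> null_class (a *: q + r).
Proof.
move=> [x -> x0] [y -> y0]; exists (a *: x + y).
  by rewrite ultra_classD ultra_classZ.
exact: nullD (nullZ a x0) y0.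
Qed.

Definition null_classes : linear_subspace UZ := LinearSubspace null_class0 null_classP.

Definition ultra_hilbert : normedModType (scalars R k) := subspace null_classes.

Lemma ultra_hilbert_parallelogram : parallelogram ultra_hilbert.
Proof.
have le0 (x y : @bounded_family R k I Z) : null U x -> null U y ->
    rnorm (ultra_class UU x + ultra_class UU y) ^+ 2 +
    rnorm (ultra_class UU x - ultra_class UU y) ^+ 2 <=
    2 * (rnorm (ultra_class UU x) ^+ 2 + rnorm (ultra_class UU y) ^+ 2).
  move=> x0 y0; rewrite -ultra_classD -ultra_classB !rnorm_ultra_class.
  have := utheta_parallelogram_le p_cvg2 E_jvn H_par x0 y0.
  have yN0 : null U (- y) by rewrite -scaleN1r; exact: nullZ.
  rewrite (utheta_null p_cvg2 x0) (utheta_null p_cvg2 y0).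
  rewrite (utheta_null (x := x + y) p_cvg2 (nullD x0 y0)).
  rewrite (utheta_null (x := x - y) p_cvg2 (nullD x0 yN0)); exact.
have le (q r : ultra_hilbert) : rnorm (q + r) ^+ 2 + rnorm (q - r) ^+ 2 <=
    2 * (rnorm q ^+ 2 + rnorm r ^+ 2).
  have [x hx x0] := subvalP q; have [y hy y0] := subvalP r.
  have := le0 x y x0 y0; rewrite -hx -hy.
  rewrite -subvalN -!subvalD !rnorm_subval; exact.
exact: parallelogram_of_le le.
Qed.

Definition ultra_map (z : nakano_sum_hilbert p E ultra_hilbert) : UZ :=
  udiag UU (npair (npart z) 0 : Z) + subval (hpart z).

Lemma ultra_mapP a x y : ultra_map (a *: x + y) = a *: ultra_map x + ultra_map y.
Proof.
rewrite /ultra_map npartD npartZ hpartD hpartZ subvalD subvalZ.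
have -> : npair (a *: npart x + npart y) 0 =
    a *: npair (npart x) 0 + npair (npart y) 0 :> Z.
  by rewrite -npairZ -npairD scaler0 addr0.
by rewrite udiagP scalerDr addrACA.
Qed.

Lemma ultra_map_surj (q : UZ) : exists z, ultra_map z = q.
Proof.
have [x ->] := ultra_classK q; have [e xe] := @coord_cvg_exists _ _ _ _ _ _ U UU x E_fin.
pose d := const_family (I := I) (npair e 0 : Z).
have xd0 : null_classes (ultra_class UU (x - d)).
  exists (x - d); first by [].
  have -> : (x - d : I -> Z) = (fun i => x i - npair e 0).
    by apply/funext => i; rewrite familyDE familyNE.
  exact: null_residual.
exists (npair e (Subspace xd0)); rewrite /ultra_map /= ultra_classB.
by rewrite addrC subrK.
Qed.

(** The modulars are compared at every scale [c]: along [U] they tend to the modular of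
    [c *: npart z] plus [c ^ 2] times the squared norm of the null class. *)
Lemma rnorm_ultra_map z : rnorm (ultra_map z) = rnorm z.
Proof.
have [y hy y0] := subvalP (hpart z).
pose d := const_family (I := I) (npair (npart z) 0 : Z).
have -> : ultra_map z = ultra_class UU (d + y).
  by rewrite /ultra_map hy ultra_classD.
rewrite rnorm_ultra_class; apply: ultranorm_lim; rewrite rnorm_luxemburg.
have -> : (fun i => rnorm ((d + y) i)) = (fun i => luxemburg_norm
    ((d + y) i : modular_sum (nakano_sum p E) (square_modular H))).
  by apply/funext => i; rewrite rnorm_luxemburg.
apply: cvg_luxemburg_norm => c c0.
have -> : (fun i => modular (scalar_of_real c *:
      ((d + y) i : modular_sum (nakano_sum p E) (square_modular H)))) =
    (fun i => theta ((scalar_of_real c *: (d + y)) i)).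
  by apply/funext => i; rewrite familyZE.
have cy0 : null U (scalar_of_real c *: y) by exact: nullZ.
have -> : scalar_of_real c *: (d + y) =
    const_family (I := I) (npair (scalar_of_real c *: npart z) 0 : Z) + scalar_of_real c *: y.
  apply: bounded_familyP => i; rewrite !familyZE !familyDE scalerDr.
  by rewrite -npairZ scaler0.
have <- : utheta U (const_family (I := I) (npair (scalar_of_real c *: npart z) 0 : Z) +
      scalar_of_real c *: y) =
    modular (scalar_of_real c *: (z : modular_sum (nakano_sum p E) (square_modular ultra_hilbert))).
  have hn : rnorm (hpart z) = ultranorm U y.
    by rewrite -rnorm_subval hy rnorm_ultra_class.
  rewrite (utheta_npair UU _ cy0) (utheta_scale p_cvg2 c0 y0) (utheta_null p_cvg2 y0).
  by rewrite modular_scaleE hn.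
exact: utheta_cvg.
Qed.

(** A constant family in the Hilbert part of [Z] has zero coordinates in [E], so it is null. *)
Lemma ultra_map_diag (z : Z) : exists h : ultra_hilbert, 
  udiag UU z = ultra_map (npair (npart z) h) /\ rnorm h = rnorm (hpart z).
Proof.
have h0 : null_classes (udiag UU (npair 0 (hpart z) : Z)).
  by exists (const_family (npair 0 (hpart z) : Z)) => // n; exact: norm_cvg_cst.
exists (Subspace h0); split.
  rewrite /ultra_map /= -[udiag UU (npair (npart z) 0)]scale1r -udiagP scale1r.
  by rewrite -npairD addr0 add0r npairK.
by rewrite -rnorm_subval /= rnorm_udiag rnorm_npair0l.
Qed.

Lemma ultra_map_npair0 (e : nakano_sum p E) :
  ultra_map (npair e 0) = udiag UU (npair e 0 : Z).
Proof. by rewrite /ultra_map /= addr0. Qed.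

Lemma ultra_map_null (x : @bounded_family R k I Z) : null U x ->
  exists h : ultra_hilbert, ultra_class UU x = ultra_map (npair 0 h).
Proof.
move=> x0; have xc : null_classes (ultra_class UU x) by exists x.
exists (Subspace xc); rewrite /ultra_map /=.
have -> : udiag UU (npair 0 0 : Z) = 0.
  have := udiagP UU 1 (0 : Z) 0; rewrite !scale1r addr0 -[LHS]addr0.
  by move=> /addrI <-.
by rewrite add0r.
Qed.

End UltraDecomposition.

Section Completeness.
Context {R : realType} {k : scalar_kind} (p : exponents R).
Variable E : nat -> normedModType (scalars R k).
Hypothesis p_cvg2 : p n @[n --> \oo] --> (2 : R).
Hypothesis E_fin : forall n, finite_dim (E n).
Hypothesis E_jvn : jordan_von_neumann (E n) @[n --> \oo] --> (1 : R).

(** Only the parallelogram law is claimed for [H'], because the completeness of E +m H is itself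
    derived from this form. The last three clauses locate E, the diagonal and the null families. *)
Theorem ultrapower_structure (H : normedModType (scalars R k)) (I : Type)
    (U : set_system I) (UU : UltraFilter U) : parallelogram H ->
  exists (H' : normedModType (scalars R k))
      (f : nakano_sum_hilbert p E H' -> ultrapower UU (nakano_sum_hilbert p E H)),
    [/\ parallelogram H',
      (forall a x y, f (a *: x + y) = a *: f x + f y),
      (forall q, exists z, f z = q), (forall z, rnorm (f z) = rnorm z) &
      [/\ (forall e, f (npair e 0) = udiag UU (npair e 0 : nakano_sum_hilbert p E H)),
        (forall z : nakano_sum_hilbert p E H, exists h,
           udiag UU z = f (npair (npart z) h)) &
        (forall x : @bounded_family R k I (nakano_sum_hilbert p E H), null U x ->
           exists h, ultra_class UU x = f (npair 0 h))]].
Proof.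
move=> Hpar; exists (@ultra_hilbert R k p E H I U UU), (@ultra_map R k p E H I U UU); split.
- exact: ultra_hilbert_parallelogram.
- exact: ultra_mapP.
- exact: ultra_map_surj.
- exact: rnorm_ultra_map.
split.
- exact: ultra_map_npair0.
- by move=> z; have [h [zh _]] := ultra_map_diag z; exists h.
- exact: ultra_map_null.
Qed.

Lemma banach_hpart (H : normedModType (scalars R k)) :
  banach (nakano_sum_hilbert p E H) -> banach H.
Proof.
move=> BZ; apply: geometric_banach => u uc.
have [n|z zu] := @banach_geometric _ _ (nakano_sum_hilbert p E H)
    (fun n => npair 0 (u n)) 1 BZ.
  rewrite mul1r; apply: le_trans (uc n).
  have -> : npair 0 (u n.+1) - npair 0 (u n) =
      npair 0 (u n.+1 - u n) :> nakano_sum_hilbert p E H.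
    by rewrite -scaleN1r -npairZ -npairD scaler0 addr0 scaleN1r.
  by rewrite rnorm_npair0l.
exists (hpart z) => n; have /le_trans := rnorm_hpart (z - npair 0 (u n)).
move=> /(_ _ (zu n)); rewrite hpartD hpartN /= mulr1 => /le_trans; apply.
by rewrite ler_wpM2r ?ler_nat // ltW // expr_half_gt0.
Qed.

Lemma isometric_linearB (X Y : normedModType (scalars R k)) (f : X -> Y) :
  (forall a x y, f (a *: x + y) = a *: f x + f y) -> {morph f : x y / x - y}.
Proof. by move=> lf x y; rewrite addrC -scaleN1r lf scaleN1r addrC. Qed.

Lemma rnorm_npair0 (H H' : normedModType (scalars R k)) (e : nakano_sum p E) :
  rnorm (npair e 0 : nakano_sum_hilbert p E H) =
  rnorm (npair e 0 : nakano_sum_hilbert p E H').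
Proof.
rewrite !rnorm_luxemburg; apply: luxemburg_norm_modular => c.
by rewrite !modular_scaleE !rnorm0.
Qed.

(** A Cauchy sequence is a bounded family, and decomposing its class over an ultrafilter on [nat]
    yields the limit [npart z] in E. The Hilbert components converge in [H]. *)
Lemma nakano_sum_hilbert_banach (H : normedModType (scalars R k)) :
  hilbert H -> banach (nakano_sum_hilbert p E H).
Proof.
move=> hH; have Hpar := hilbert_parallelogram hH; have [BH _] := hH.
have [G GU oG] := ultra_nat.
have [H' [f [_ fl fs fn [_ fd _]]]] := ultrapower_structure GU Hpar.
apply: geometric_banach => u uc.
have uc1 n : rnorm (u n.+1 - u n) <= 1 * 2^-1 ^+ n by rewrite mul1r.
have uM n : rnorm (u n) <= 2 + rnorm (u 0%N).
  have -> : u n = (u n - u 0%N) + u 0%N by rewrite subrK.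
  apply: le_trans (ler_rnormD _ _) _; rewrite lerD2r.
  by have := geometric_tail uc1 n 0; rewrite expr0 !mulr1 add0n.
pose x := BoundedFamily (ex_intro _ _ uM).
have [z zx] := fs (ultra_class GU x).
have [n|h hu] := @banach_geometric _ _ H (fun n => hpart (u n)) 1 BH.
  rewrite mul1r; apply: le_trans (uc n).
  by rewrite /= -hpartN -hpartD rnorm_hpart.
exists (npair (npart z) h) => n.
have [h' uh'] := fd (u n).
have zu : rnorm (npair (npart z - npart (u n)) 0 : nakano_sum_hilbert p E H) <= 2 * 2^-1 ^+ n.
  rewrite (rnorm_npair0 H H').
  apply: le_trans (rnorm_npair0r (z - npair (npart (u n)) h')) _.
  rewrite -fn (isometric_linearB fl) -uh' zx /udiag -ultra_classB.
  rewrite rnorm_ultra_class; apply: ultranorm_le; apply: oG; near=> m.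
  have nm : (n <= m)%N by near: m; exists n.
  by rewrite familyDE familyNE /= -(subnKC nm); have := geometric_tail uc1 (m - n) n; rewrite mulr1.
have -> : npair (npart z) h - u n =
    npair (npart z - npart (u n)) 0 + npair 0 (h - hpart (u n)) :> nakano_sum_hilbert p E H.
  by rewrite -npairD addr0 add0r.
apply: le_trans (ler_rnormD _ _) _; rewrite rnorm_npair0l.
by have := hu n; rewrite /= mulr1; move: zu; lra.
Unshelve. all: by end_near. Qed.

Theorem hilbert_ultrapower_structure (H : normedModType (scalars R k)) (I : Type)
    (U : set_system I) (UU : UltraFilter U) : hilbert H ->
  exists (H' : normedModType (scalars R k))
      (f : nakano_sum_hilbert p E H' -> ultrapower UU (nakano_sum_hilbert p E H)),
    [/\ hilbert H',
      (forall a x y, f (a *: x + y) = a *: f x + f y),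
      (forall q, exists z, f z = q), (forall z, rnorm (f z) = rnorm z) &
      [/\ (forall e, f (npair e 0) = udiag UU (npair e 0 : nakano_sum_hilbert p E H)),
        (forall z : nakano_sum_hilbert p E H, exists h,
           udiag UU z = f (npair (npart z) h)) &
        (forall x : @bounded_family R k I (nakano_sum_hilbert p E H), null U x ->
           exists h, ultra_class UU x = f (npair 0 h))]].
Proof.
move=> hH; have BZ := nakano_sum_hilbert_banach hH.
have [H' [f [Hpar' fl fs fn fd]]] :=
  ultrapower_structure UU (hilbert_parallelogram hH).
exists H', f; split => //; apply: hilbert_of_parallelogram => //.
have iso : isometric (ultrapower UU (nakano_sum_hilbert p E H)) (nakano_sum_hilbert p E H').
  exact/isometric_sym/(isometricI fl fs fn).
exact: banach_hpart (isometric_banach iso (ultrapower_banach (UU := UU) BZ)).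
Qed.

End Completeness.

(** * Spaces with an ultrapower E +m H *)

Section ModularFromNorm.
Context {R : realType} {k : scalar_kind} (p : exponents R).
Variable E : nat -> normedModType (scalars R k).

Lemma npart_npair (H : normedModType (scalars R k)) e (h : H) :
  npart (npair e h : nakano_sum_hilbert p E H) = e.
Proof. by []. Qed.

Lemma hpart_npair (H : normedModType (scalars R k)) e (h : H) :
  hpart (npair e h : nakano_sum_hilbert p E H) = h.
Proof. by []. Qed.

Lemma rnorm_sqrD (H : normedModType (scalars R k)) : parallelogram H ->
  forall x h : H, exists b : R, forall t : R,
    rnorm (x + scalar_of_real t *: h) ^+ 2 =
    rnorm x ^+ 2 + 2 * t * b + t ^+ 2 * rnorm h ^+ 2.
Proof.
move=> par x h; exists (polarization x h) => t.
have h1 := par x (scalar_of_real t *: h).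
have : polarization x (scalar_of_real t *: h) = t * polarization x h.
  by rewrite polarizationC polarizationZ // polarizationC.
rewrite {1}/polarization; move: h1.
rewrite rnormZr exprMn real_normK ?num_real //.
move: (rnorm (x + _) ^+ 2) (rnorm (x - _) ^+ 2) (polarization x h) => A B b.
by move: (rnorm x ^+ 2) (t ^+ 2 * rnorm h ^+ 2) => u v; lra.
Qed.

(** As [s < 1] and [K > 0], the first quadratic takes the value 1 at two distinct points, and so
    does the second. Subtracting the equations at these points gives [b = b'], and then [s = s']. *)
Lemma quadratic_const_eq (s b s' b' K : R) : 0 < K -> s < 1 ->
  (forall t, s + 2 * t * b + t ^+ 2 * K = 1 -> s' + 2 * t * b' + t ^+ 2 * K = 1) ->
  s = s'.
Proof.
move=> K0 s1 roots; pose D := Num.sqrt (b ^+ 2 + K * (1 - s)).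
have D20 : 0 < b ^+ 2 + K * (1 - s) by rewrite ltr_wpDl ?sqr_ge0 // mulr_gt0 // subr_gt0.
have D0 : 0 < D by rewrite sqrtr_gt0.
have DE : D ^+ 2 = b ^+ 2 + K * (1 - s) by rewrite sqr_sqrtr // ltW.
have K0' : K != 0 by rewrite gt_eqF.
have root d : d ^+ 2 = D ^+ 2 -> s + 2 * ((d - b) / K) * b + ((d - b) / K) ^+ 2 * K = 1.
  move=> dD; have : (s + 2 * ((d - b) / K) * b + ((d - b) / K) ^+ 2 * K - 1) * K = 0.
    have -> : (s + 2 * ((d - b) / K) * b + ((d - b) / K) ^+ 2 * K - 1) * K =
        d ^+ 2 - (b ^+ 2 + K * (1 - s)) by field.
    by rewrite dD DE subrr.
  by move=> /eqP; rewrite mulf_eq0 (negbTE K0') orbF subr_eq0 => /eqP.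
have h1 := root D erefl; have h2 := root (- D) (sqrrN D).
have e1 := roots _ h1; have e2 := roots _ h2.
set t1 := (D - b) / K in h1 e1; set t2 := (- D - b) / K in h2 e2.
have t12 : t1 - t2 != 0.
  have -> : t1 - t2 = 2 * D / K by rewrite /t1 /t2; field.
  by rewrite gt_eqF // divr_gt0 // mulr_gt0.
have bb : b = b'.
  apply/eqP; rewrite -subr_eq0 -(mulrI_eq0 _ (mulfI t12)); apply/eqP.
  by move: h1 h2 e1 e2; lra.
by move: h1 e1; rewrite -bb; lra.
Qed.

(* The norm along the translates of [z] by multiples of a vector of the Hilbert
   part determines a quadratic polynomial up to its middle coefficient, hence the
   modular of [z]. *)
Lemma theta_determined (H : normedModType (scalars R k))
    (z a : nakano_sum_hilbert p E H) (h : H) : parallelogram H -> h != 0 ->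
  (forall t : R, rnorm (z + scalar_of_real t *: npair 0 h) =
                 rnorm (a + scalar_of_real t *: npair 0 h)) ->
  theta z < 1 -> theta z = theta a.
Proof.
move=> par h0 za z1.
have [b zb] := rnorm_sqrD par (hpart z) h.
have [b' ab] := rnorm_sqrD par (hpart a) h.
have thE (y : nakano_sum_hilbert p E H) (c t : R) :
    rnorm (hpart y + scalar_of_real t *: h) ^+ 2 =
      rnorm (hpart y) ^+ 2 + 2 * t * c + t ^+ 2 * rnorm h ^+ 2 ->
    theta (y + scalar_of_real t *: npair 0 h) = theta y + 2 * t * c + t ^+ 2 * rnorm h ^+ 2.
  move=> yc; rewrite !thetaE npartD npartZ npart_npair scaler0 addr0.
  rewrite hpartD hpartZ hpart_npair yc.
  by rewrite !addrA.
apply: (@quadratic_const_eq _ b _ b' (rnorm h ^+ 2)) => // [|t].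
  by rewrite exprn_gt0 // rnorm_gt0.
rewrite -!thE // => /rnorm_eq1; rewrite za => /rnorm_eq1.
by rewrite (thE _ b').
Qed.

Definition nakano_single_fun n (e : E n) : forall m, E m :=
  @eqtype.dfwith nat (fun m => E m) (fun m => 0 : E m) n e.

Lemma nakano_single_head n (e : E n) N :
  nakano_head p N (nakano_single_fun e) = if (n < N)%N then rnorm e `^ p n else 0.
Proof.
elim: N => [|N IH]; first by rewrite /nakano_head big_geq.
rewrite /nakano_head big_nat_recr //= -/(nakano_head p N _) IH ltnS [(n <= N)%N]leq_eqVlt.
have [nN|nN] /= := eqVneq n N.
  by subst N; rewrite ltnn add0r /nakano_single_fun dfwith_in.
rewrite /nakano_single_fun dfwith_out // rnorm0 powR0 ?addr0 //.
by rewrite gt_eqF ?exponent_gt0.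
Qed.

Lemma nakano_singleP n (e : E n) : nakano p (fun m => `|nakano_single_fun e m|).
Proof.
apply: (@nakano_bounded _ _ _ _ _ (rnorm e `^ p n)) => N.
by rewrite nakano_single_head; case: ifP => // _; exact: powR_ge0.
Qed.

Definition nakano_single n (e : E n) : nakano_sum p E := NakanoSum (nakano_singleP e).

Lemma nakano_single_in n (e : E n) : nakano_single e n = e.
Proof. exact: dfwith_in. Qed.

Lemma nakano_single_out n (e : E n) m : n != m -> nakano_single e m = 0.
Proof. exact: dfwith_out. Qed.

Lemma modular_single n (e : E n) : modular (nakano_single e) = rnorm e `^ p n.
Proof.
apply/eqP; rewrite eq_le; apply/andP; split.
  apply: modular_le_head => N; rewrite nakano_single_head.
  by case: ifP => // _; exact: powR_ge0.
by have := nakano_coord_modular n (nakano_single e); rewrite nakano_single_in.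
Qed.

Lemma nakano_singleZ n a (e : E n) : nakano_single (a *: e) = a *: nakano_single e.
Proof.
apply: nakano_sumP => m; rewrite nakanoZE; have [nm|nm] := eqVneq n m.
  by subst m; rewrite !nakano_single_in.
by rewrite !nakano_single_out // scaler0.
Qed.

Lemma nakano_singleD n (e f : E n) :
  nakano_single (e + f) = nakano_single e + nakano_single f.
Proof.
apply: nakano_sumP => m; rewrite nakanoDE; have [nm|nm] := eqVneq n m.
  by subst m; rewrite !nakano_single_in.
by rewrite !nakano_single_out // addr0.
Qed.

Definition nakano_trunc N (x : nakano_sum p E) : nakano_sum p E :=
  \sum_(n < N) nakano_single (x n).

Lemma nakano_truncS N x :
  nakano_trunc N.+1 x = nakano_trunc N x + nakano_single (x N).
Proof. by rewrite /nakano_trunc big_ord_recr. Qed.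

Lemma nakano_truncE N x m : nakano_trunc N x m = if (m < N)%N then x m else 0.
Proof.
elim: N => [|N IH]; first by rewrite /nakano_trunc big_ord0.
rewrite nakano_truncS nakanoDE IH ltnS [(m <= N)%N]leq_eqVlt.
have [mN|mN] := eqVneq m N.
  by subst N; rewrite ltnn add0r nakano_single_in.
by rewrite orFb nakano_single_out ?addr0 // eq_sym.
Qed.

(** At each scale the modular of the remainder is bounded by a tail of a convergent series. *)
Lemma cvg_nakano_trunc (H : normedModType (scalars R k)) (x : nakano_sum p E) :
  norm_cvg \oo (fun N => npair (nakano_trunc N x) 0 : nakano_sum_hilbert p E H) (npair x 0).
Proof.
rewrite /norm_cvg.
have -> : (fun N => rnorm (npair (nakano_trunc N x) 0 - npair x 0 : nakano_sum_hilbert p E H)) =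
    (fun N => luxemburg_norm (x - nakano_trunc N x)).
  apply/funext => N; rewrite rnormB_sym rnorm_luxemburg.
  apply: luxemburg_norm_modular => c; rewrite modular_scaleE.
  by rewrite hpartD hpartN !hpart_npair subrr rnorm0 expr0n mulr0 addr0.
have <- : luxemburg_norm (0 : nakano_sum p E) = 0.
  by rewrite -[0 in LHS](scale0r (0 : nakano_sum p E)) luxemburg_normZ rnorm0 mul0r.
apply: cvg_luxemburg_norm => c c0; rewrite scaler0 modular0.
pose y := scalar_of_real c *: x.
have y0 : modular y - nakano_head p N y @[N --> \oo] --> (0 : R).
  by rewrite -(subrr (modular y)); apply: cvgB; [exact: cvg_cst|exact: cvg_nakano_head].
apply: cvg0_le y0 => N; rewrite modular_ge0 andTb; apply: modular_le_head => M.
have zE m : (scalar_of_real c *: (x - nakano_trunc N x)) m = if (m < N)%N then 0 else y m.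
  rewrite nakanoZE nakanoDE nakanoNE nakano_truncE /y nakanoZE.
  by case: ifP => _; rewrite ?subrr ?scaler0 ?subr0.
have zero : nakano_head p (minn M N) (scalar_of_real c *: (x - nakano_trunc N x)) = 0.
  rewrite /nakano_head big_nat_cond big1 // => m /andP[/andP[_]].
  rewrite leq_min => /andP[_ mN] _; rewrite zE mN rnorm0 powR0 //.
  by rewrite gt_eqF ?exponent_gt0.
have [MN|NM] := leqP M N.
  by move: zero; rewrite (minn_idPl MN) => ->; rewrite subr_ge0; exact: nakano_head_le.
apply: (@le_trans _ _ (nakano_head p M y - nakano_head p N y)); last first.
  by rewrite lerD2r; exact: nakano_head_le.
move: zero; rewrite (minn_idPr (ltnW NM)) => zero.
have split (w : nakano_sum p E) : nakano_head p M w =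
    nakano_head p N w + \sum_(N <= m < M) rnorm (w m) `^ p m.
  by rewrite /nakano_head (big_cat_nat (leq0n N) (ltnW NM)).
rewrite !split zero add0r addrAC subrr add0r big_nat_cond [leRHS]big_nat_cond.
by apply: ler_sum => m /andP[/andP[Nm _] _]; rewrite zE ltnNge Nm.
Qed.

(* With [y] the ratio between the scalings of the exponents [p m] and [p n] at
   [1/2], the combination of the three scales produces the square [(1 - y)^2]. *)
Lemma hpart_eq0_of_scaling (H : normedModType (scalars R k)) n (e : E n)
    (a : nakano_sum_hilbert p E H) : p n != 2 ->
  (forall j : 'I_3, theta (scalar_of_real (2^-1 ^+ j) *: a) =
     theta (scalar_of_real (2^-1 ^+ j) *: (npair (nakano_single e) 0 : nakano_sum_hilbert p E H))) ->
  hpart a = 0.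
Proof.
move=> pn2 sc; pose P := (2 : R) `^ p n.
have P0 : 0 < P by rewrite powR_gt0.
have halfP q : (2^-1 : R) `^ q = (2 `^ q)^-1 by rewrite -powR_inv1 // -powRrM mulN1r powRN.
have rhs (j : nat) : theta (scalar_of_real (2^-1 ^+ j) *:
    (npair (nakano_single e) 0 : nakano_sum_hilbert p E H)) =
    P^-1 ^+ j * rnorm e `^ p n.
  rewrite thetaE hpartZ hpart_npair scaler0 rnorm0 expr0n addr0.
  rewrite npartZ npart_npair -nakano_singleZ.
  rewrite modular_single rnormZr powRM ?rnorm_ge0 //; congr (_ * _).
  rewrite ger0_norm ?exprn_ge0 // -[2^-1 ^+ j]powR_mulrn // -powRrM mulrC powRrM halfP.
  by rewrite powR_mulrn // invr_ge0 ltW.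
pose A j := modular (scalar_of_real (2^-1 ^+ j) *: npart a).
have thA (j : nat) : theta (scalar_of_real (2^-1 ^+ j) *: a) =
    A j + (4^-1) ^+ j * rnorm (hpart a) ^+ 2.
  rewrite thetaE npartZ hpartZ rnormZr exprMn real_normK ?num_real // -exprM mulnC exprM.
  by congr (_ + _ ^+ _ * _); field.
have := sc ord0; have := sc (inord 1); have := sc (inord 2).
rewrite !inordK //= !rhs !thA !expr0 !expr1 !mul1r => s2 s1 s0.
(* The weights [1], [-2 P], [P^2] on the scales [1], [1/2], [1/4] annihilate the modular of [e]. On
   coordinate [m] of [a] they produce the factor [(1 - P r)^2] with [r = 2 ^ (- p m)], and on the
   Hilbert part [(1 - P / 4)^2]. As the total is 0, the Hilbert contribution cannot be positive. *)
have comb : 2 * P * A 1%N <= A 0%N + P ^+ 2 * A 2%N.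
  have := @nakano_tail_le R k p E 0 (2 * P) 0 1 (P ^+ 2)
    (scalar_of_real (2^-1 ^+ 1) *: npart a) 0 (scalar_of_real (2^-1 ^+ 0) *: npart a)
    (scalar_of_real (2^-1 ^+ 2) *: npart a).
  rewrite /nakano_head !big_geq // !subr0 mul0r addr0 mul1r; apply => m _.
  rewrite !nakanoZE !rnormZr !powRM ?rnorm_ge0 // mul0r addr0.
  rewrite !ger0_norm ?exprn_ge0 // expr0 powR1 !mul1r expr1.
  have -> : ((2^-1 : R) ^+ 2) `^ p m = ((2^-1 : R) `^ p m) ^+ 2.
    by rewrite -powR_mulrn // -powRrM mulrC powRrM powR_mulrn // powR_ge0.
  have := powR_ge0 (rnorm (npart a m)) (p m).
  move: (rnorm (npart a m) `^ p m) ((2^-1 : R) `^ p m) => q r q0.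
  have := mulr_ge0 q0 (sqr_ge0 (1 - P * r)).
  rewrite sqrrB expr1n mul1r; clear; move: P => P; lra.
have sq : (1 - P / 4) ^+ 2 * rnorm (hpart a) ^+ 2 <= 0.
  have PP : P * P^-1 = 1 by rewrite divff ?gt_eqF.
  move: s0 s1 s2 comb; move: (A 0%N) (A 1%N) (A 2%N) => A0 A1 A2.
  move: (rnorm (hpart a) ^+ 2) (rnorm e `^ p n) => h2 C s0 s1 s2 comb.
  have t1 : 2 * P * (A1 + 4^-1 * h2) = 2 * C.
    by rewrite s1 mulrA -(mulrA 2) PP mulr1.
  have t2 : P ^+ 2 * (A2 + 4^-1 ^+ 2 * h2) = C.
    by rewrite s2 mulrA -exprMn PP expr1n mul1r.
  rewrite sqrrB expr1n mul1r; move: t1 t2 s0 comb; clear; move: P => P; lra.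
have h20 : 0 < (1 - P / 4) ^+ 2.
  rewrite lt0r sqr_ge0 andbT sqrf_eq0 subr_eq0 eq_sym; apply: contra_neq pn2 => P4.
  have {}P4 : P = 2 `^ 2 by rewrite powR_mulrn // -natrX -[P](divfK (x := 4)) // P4 mul1r.
  have := congr1 (@ln R) P4; rewrite /P !ln_powR => /mulIf; apply.
  by rewrite gt_eqF // ln_gt0 // ltr1n.
apply: rnorm_eq0; apply/eqP; rewrite -sqrf_eq0 eq_le sqr_ge0 andbT.
by move: sq; rewrite pmulr_rle0.
Qed.

End ModularFromNorm.

Section IsometricLimits.
Context {R : realType} {k : scalar_kind}.

(** The range of a complete space under an isometric embedding is closed. *)
Lemma isometric_limit (X Z : normedModType (scalars R k)) (S : X -> Z) (T : Type)
    (F : set_system T) (FF : ProperFilter F) (x : T -> X) (z : Z) : banach X ->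
  (forall a u v, S (a *: u + v) = a *: S u + S v) -> (forall u, rnorm (S u) = rnorm u) ->
  norm_cvg F (fun i => S (x i)) z -> exists2 l, norm_cvg F x l & S l = z.
Proof.
move=> /banachP BX Sl Sn xz; have SB := isometric_linearB Sl.
have [e e0|l xl] := BX (x @ F) _.
  have e20 : 0 < e / 2 by rewrite divr_gt0.
  exists [set u | rnorm (S u - z) < e / 2]; first exact: norm_cvg_near e20 xz.
  move=> u v /= uz vz; rewrite -Sn SB.
  have -> : S u - S v = (S u - z) - (S v - z) by rewrite opprB addrA subrK.
  by apply: le_lt_trans (ler_rnormB _ _) _; rewrite (splitr e) ltrD.
have xl' : norm_cvg F x l.
  apply: near_norm_cvg => e e0; near=> i.
  by rewrite rnormB_sym ltW //; near: i; exact: xl.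
exists l => //; apply: (@norm_cvg_unique _ _ _ F _ Z (fun i => S (x i))) => //.
by apply: cvg0_le xl' => i; rewrite rnorm_ge0 -SB Sn lexx.
Unshelve. all: by end_near. Qed.

Lemma isometric_same_range (X Y Z : normedModType (scalars R k)) (S : X -> Z) (g : Y -> Z) :
  (forall a u v, S (a *: u + v) = a *: S u + S v) -> (forall u, rnorm (S u) = rnorm u) ->
  (forall a u v, g (a *: u + v) = a *: g u + g v) -> (forall u, rnorm (g u) = rnorm u) ->
  (forall x, exists y, g y = S x) -> (forall y, exists x, S x = g y) -> isometric X Y.
Proof.
move=> Sl Sn gl gn /choice[f fP] gS; apply: (@isometricI _ _ X Y f).
- have ginj u v : g u = g v -> u = v.
    move=> uv; apply/eqP; rewrite -subr_eq0; apply/eqP/rnorm_eq0.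
    by rewrite -gn (isometric_linearB gl) uv subrr rnorm0.
  by move=> a x y; apply: ginj; rewrite fP gl !fP Sl.
- move=> y; have [x xy] := gS y; exists x.
  apply/eqP; rewrite -subr_eq0; apply/eqP/rnorm_eq0.
  by rewrite -gn (isometric_linearB gl) fP xy subrr rnorm0.
- by move=> x; rewrite -gn fP Sn.
Qed.

End IsometricLimits.

Section Rigidity.
Context {R : realType} {k : scalar_kind} (p : exponents R).
Variable E : nat -> normedModType (scalars R k).
Hypothesis p_neq2 : forall n, p n != 2.
Hypothesis p_cvg2 : p n @[n --> \oo] --> (2 : R).
Hypothesis E_fin : forall n, finite_dim (E n).
Hypothesis E_jvn : jordan_von_neumann (E n) @[n --> \oo] --> (1 : R).
Local Notation NH := (nakano_sum_hilbert p E).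

Lemma rnorm_class_eq (X Y : normedModType (scalars R k)) (I : Type) (U : set_system I)
    (UU : UltraFilter U) (x : @bounded_family R k I X) (y : @bounded_family R k I Y) :
  (forall i, rnorm (x i) = rnorm (y i)) ->
  rnorm (ultra_class UU x) = rnorm (ultra_class UU y).
Proof.
move=> xy; rewrite !rnorm_ultra_class /ultranorm.
by have -> : (fun i => rnorm (x i)) = (fun i => rnorm (y i)) by exact/funext.
Qed.

Lemma ultra_equiv_cvg (X : normedModType (scalars R k)) (I : Type) (U : set_system I)
    (UU : UltraFilter U) (x : @bounded_family R k I X) (y : X) :
  ultranorm U (x - const_family y) = 0 -> norm_cvg U x y.
Proof.
move=> xy0; have := @ultranorm_cvg _ _ _ U UU _ (x - const_family y).
have -> : (fun i => rnorm ((x - const_family y) i)) = (fun i => rnorm (x i - y)).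
  by apply/funext => i; rewrite familyDE familyNE.
by rewrite xy0.
Qed.

Lemma cvg_ultra_equiv (X : normedModType (scalars R k)) (I : Type) (U : set_system I)
    (UU : UltraFilter U) (x : @bounded_family R k I X) (y : X) :
  norm_cvg U x y -> ultra_class UU x = udiag UU y.
Proof.
move=> xy; apply/ultra_classP; apply: ultranorm_lim.
have -> : (fun i => rnorm ((x - const_family y) i)) = (fun i => rnorm (x i - y)).
  by apply/funext => i; rewrite familyDE familyNE.
exact: xy.
Qed.

(* A vector [a] with the same distances as [e] (supported on one coordinate) to
   the multiples of a null sequence has no Hilbert part: pass to the ultrapower
   where that sequence becomes a vector of the Hilbert part. *)
Lemma hpart_eq0_of_null (H : normedModType (scalars R k)) n (e : E n) (a : NH H)
    (w : nat -> NH H) (eps M : R) : hilbert H -> 0 < eps ->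
  theta (npair (nakano_single p e) 0 : NH H) < 1 ->
  (forall m, eps <= rnorm (w m) <= M) ->
  (forall n, norm_cvg \oo (fun m => npart (w m) n) 0) ->
  (forall (t : R) m, rnorm (npair (nakano_single p e) 0 + scalar_of_real t *: w m) =
                rnorm (a + scalar_of_real t *: w m)) ->
  hpart a = 0.
Proof.
move=> hH eps0 e1 wM w0 ew; have [G GU oG] := ultra_nat.
have [H' [f [hH' fl fs fn [fe fd f0]]]] :=
  hilbert_ultrapower_structure p_cvg2 E_fin E_jvn GU hH.
have wM' m : rnorm (w m) <= M by case/andP: (wM m).
pose W := BoundedFamily (ex_intro _ _ wM').
have W0 : null G W.
  by move=> j; apply: cvg_trans (w0 j); exact: cvg_app.
have [h hW] := f0 W W0.
have hn : eps <= rnorm h.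
  rewrite -(rnorm_npair0l p E) -fn -hW rnorm_ultra_class.
  apply: (cvgr_to_ge (@ultranorm_cvg _ _ _ G _ _ W)).
  by apply: (@filterE _ G) => m; case/andP: (wM m).
have h0 : h != 0.
  by apply/eqP => h0; move: hn; rewrite h0 rnorm0 leNgt eps0.
have [h' ah'] := fd a.
set z : NH H' := npair (nakano_single p e) 0; set a' : NH H' := npair (npart a) h'.
have fZ (c : scalars R k) x : f (c *: x) = c *: f x.
  have f00 : f 0 = 0 by apply: rnorm_eq0; rewrite fn rnorm0.
  by rewrite -[c *: x]addr0 fl f00 addr0.
have lift (y : NH H) (y' : NH H') (t : R) : udiag GU y = f y' ->
    rnorm (y' + scalar_of_real t *: npair 0 h) =
    rnorm (ultra_class GU (const_family (I := nat) y + scalar_of_real t *: W)).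
  by move=> yy'; rewrite -fn addrC fl -hW -yy' /udiag ultra_classD ultra_classZ addrC.
have za t : rnorm (z + scalar_of_real t *: npair 0 h) =
    rnorm (a' + scalar_of_real t *: npair 0 h).
  rewrite (lift _ _ _ (esym (fe (nakano_single p e)))) (lift _ _ _ ah').
  by apply: rnorm_class_eq => m; rewrite !familyDE !familyZE; exact: ew.
(* The diagonal embedding is injective, so [h' = 0] gives [hpart a = 0]. The scaling argument is
   then applied to [a']. *)
suff h'0 : h' = 0.
  have aE : udiag GU a = udiag GU (npair (npart a) 0 : NH H) by rewrite ah' h'0 fe.
  have : rnorm (a - npair (npart a) 0) = 0.
    rewrite -(rnorm_udiag GU) (isometric_linearB (udiagP GU (X := NH H))).
    by rewrite aE subrr rnorm0.
  by move=> /rnorm_eq0/eqP; rewrite subr_eq0 => /eqP ->.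
have par' := hilbert_parallelogram hH'.
apply: (@hpart_eq0_of_scaling _ _ p E H' n e a') => // j.
(* Scaling by [c = 2^-j] preserves the equality of distances, with [t / c] in place of [t], and
   keeps the modular below 1. *)
apply/esym; apply: (theta_determined par' h0) => [t|].
  set c := 2^-1 ^+ j; have c0 : c != 0 by rewrite expf_neq0 // invr_eq0.
  have sc (y : NH H') : scalar_of_real c *: y + scalar_of_real t *: npair 0 h =
      scalar_of_real c *: (y + scalar_of_real (t / c) *: npair 0 h).
    by rewrite scalerDr scalerA -scalar_of_realM mulrCA divff // mulr1.
  by rewrite !sc !rnormZ za.
apply: le_lt_trans e1; have := @modular_contract _ _ _ (2^-1 ^+ j)
  (z : modular_sum (nakano_sum p E) (square_modular H')).
have c01 : 0 <= (2^-1 : R) ^+ j <= 1.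
  by rewrite exprn_ge0 //= exprn_ile1 ?invr_ge0 // invf_le1 ?ler1n.
move=> /(_ c01) /le_trans; apply.
have -> : modular (z : modular_sum (nakano_sum p E) (square_modular H')) =
    theta (npair (nakano_single p e) 0 : NH H).
  by rewrite [RHS]thetaE -/(theta z) thetaE !hpart_npair !rnorm0.
by rewrite ler_piMl ?theta_ge0 //; case/andP: c01.
Qed.

Lemma near_forall_lt (T : Type) (F : set_system T) (FF : Filter F)
    (P : nat -> T -> Prop) m : (forall n, \forall i \near F, P n i) ->
  \forall i \near F, forall n, (n < m)%N -> P n i.
Proof.
move=> FP; elim: m => [|m IH]; first exact: nearW.
apply: filterS2 (FP m) IH => i Pm Pi n; rewrite ltnS leq_eqVlt => /orP[/eqP ->//|].
exact: Pi.
Qed.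

(** Otherwise, for every [e], some ball around an [x j] contains the family on a set of [U], because
    an ultrafilter contains a set or its complement. The image filter would then be Cauchy. *)
Lemma not_cvg_separated (X : normedModType (scalars R k)) (I : Type)
    (U : set_system I) (UU : UltraFilter U) (x : I -> X) : banach X ->
  ~ (exists l, norm_cvg U x l) ->
  exists2 eps : R, 0 < eps & forall j, \forall i \near U, eps <= rnorm (x i - x j).
Proof.
move=> /banachP BX nc; apply: contrapT => neps; apply: nc.
have [e e0|l xl] := BX (x @ U) _.
  have [j nj] : exists j, ~ \forall i \near U, e / 2 <= rnorm (x i - x j).
    apply: contrapT => nj; apply: neps; exists (e / 2); first by rewrite divr_gt0.
    by move=> j; apply: contrapT => njj; apply: nj; exists j.
  exists [set u | rnorm (u - x j) < e / 2].
    have [//|] := in_ultra_setVsetC [set i | e / 2 <= rnorm (x i - x j)] UU.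
    move=> h; suff : U (x @^-1` [set u | rnorm (u - x j) < e / 2]) by [].
    by apply: filterS h => i /= /negP; rewrite -ltNge.
  move=> u v /= uj vj; have -> : u - v = (u - x j) - (v - x j).
    by rewrite opprB addrA subrK.
  by apply: le_lt_trans (ler_rnormB _ _) _; rewrite (splitr e) ltrD.
exists l; apply: near_norm_cvg => e e0; near=> i.
by rewrite rnormB_sym ltW //; near: i; exact: xl.
Unshelve. all: by end_near. Qed.

Section ElementaryEmbedding.
Variables (X H : normedModType (scalars R k)) (I : Type).
Variables (U : set_system I) (UU : UltraFilter U).
Hypotheses (BX : banach X) (hH : hilbert H).
Variables (T : ultrapower UU X -> NH H) (T' : NH H -> ultrapower UU X).
Hypotheses (Tl : forall a x y, T (a *: x + y) = a *: T x + T y)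
  (Tn : forall x, rnorm (T x) = rnorm x) (T'K : cancel T' T).

Let S (x : X) : NH H := T (udiag UU x).

Let Sl a x y : S (a *: x + y) = a *: S x + S y.
Proof. by rewrite /S udiagP Tl. Qed.

Let Sn x : rnorm (S x) = rnorm x.
Proof. by rewrite /S Tn rnorm_udiag. Qed.

(** For each [m] there are two members at distance at least [eps] whose images both have their first
    [m] coordinates close to those of the coordinatewise limit. Their differences form the
    sequence. *)
Lemma null_sequence (x : @bounded_family R k I X) : ~ (exists l, norm_cvg U x l) ->
  exists (v : nat -> X) (eps M : R), [/\ 0 < eps,
    (forall m, eps <= rnorm (v m) <= M) &
    forall n, norm_cvg \oo (fun m => npart (S (v m)) n) 0].
Proof.
move=> xnc; have [eps eps0 xeps] := not_cvg_separated UU BX xnc.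
have [M xM] := family_valP x.
have yM i : rnorm (S (x i)) <= M by rewrite Sn.
pose y := BoundedFamily (ex_intro _ _ yM).
have [e ye] := @coord_cvg_exists _ _ p E H I U UU y E_fin.
have /choice[ij ijP] m : exists ij : I * I, eps <= rnorm (x ij.1 - x ij.2) /\
    forall n, (n < m)%N -> rnorm (npart (S (x ij.1)) n - npart (S (x ij.2)) n) <= 2 * m.+1%:R^-1.
  have m0 : 0 < (m.+1%:R : R)^-1 by rewrite invr_gt0.
  have A : \forall i \near U, forall n, (n < m)%N ->
      rnorm (npart (y i) n - e n) < m.+1%:R^-1.
    by apply: near_forall_lt => n'; exact: norm_cvg_near (ye n').
  have [j jA] := filter_ex A.
  have [i [iA ij]] := filter_ex (filterI A (xeps j)).
  exists (i, j); split => //= n nm.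
  have -> : npart (S (x i)) n - npart (S (x j)) n =
      (npart (y i) n - e n) - (npart (y j) n - e n) by rewrite opprB addrA subrK.
  apply: le_trans (ler_rnormB _ _) _.
  rewrite mulr_natl mulr2n; apply: lerD; apply: ltW; [exact: iA n nm|exact: jA n nm].
exists (fun m => x (ij m).1 - x (ij m).2), eps, (M + M); split => // [m|n].
  have [-> _] := ijP m.
  by rewrite (le_trans (ler_rnormB _ _)) // lerD.
apply: near_norm_cvg => e1 e10; near=> m; rewrite subr0.
have nm : (n < m)%N by near: m; exists n.+1.
rewrite (isometric_linearB Sl) npartD npartN nakanoDE nakanoNE.
have [_ /(_ n nm) /le_trans] := ijP m; apply.
rewrite -ler_pdivlMl // mulrC ltW //; near: m.
have e120 : 0 < e1 / 2 by rewrite divr_gt0.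
exact: (near_infty_natSinv_lt (PosNum e120)).
Unshelve. all: by end_near. Qed.

Lemma single_in_range (v : nat -> X) (eps M : R) n (e : E n) : 0 < eps ->
  (forall m, eps <= rnorm (v m) <= M) ->
  (forall n, norm_cvg \oo (fun m => npart (S (v m)) n) 0) ->
  theta (npair (nakano_single p e) 0 : NH H) < 1 ->
  exists u, S u = npair (nakano_single p e) 0.
Proof.
move=> eps0 vM v0 e1.
have [b qb] := ultra_classK (T' (npair (nakano_single p e) 0)).
have Tb : T (ultra_class UU b) = npair (nakano_single p e) 0 by rewrite -qb T'K.
have [N bN] := family_valP b.
have AN i : rnorm (S (b i)) <= N by rewrite Sn.
pose A := BoundedFamily (ex_intro _ _ AN).
have [H2 [f [hH2 fl fs fn [fe fd _]]]] :=
  hilbert_ultrapower_structure p_cvg2 E_fin E_jvn UU hH.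
have [a fa] := fs (ultra_class UU A).
have /choice[h hP] m : exists h, udiag UU (S (v m)) = f (npair (npart (S (v m))) h).
  exact: fd.
pose w m : NH H2 := npair (npart (S (v m))) (h m).
have a0 : hpart a = 0.
  apply: (@hpart_eq0_of_null H2 n e a w eps M) => // [|m|t m].
  - by apply: le_lt_trans e1; rewrite !thetaE !hpart_npair !rnorm0.
  - by rewrite -fn -hP rnorm_udiag Sn.
  have fD y z (c : scalars R k) : f (y + c *: z) = f y + c *: f z.
    by rewrite addrC fl addrC.
  (* Both sides are the norm of the class of [b i + t v m] in the ultrapower of [X]: on the left
     through [T], which sends the class of [b] to [e], on the right by applying [S] at each
     index. *)
  rewrite -[LHS]fn -[RHS]fn !fD fe -hP fa.
  rewrite [in LHS]addrC -udiagP rnorm_udiag -Tb addrC.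
  rewrite addrC -Tl Tn /udiag -!ultra_classZ -!ultra_classD addrC.
  rewrite [in RHS]addrC.
  apply: rnorm_class_eq => i; rewrite !familyDE !familyZE /=.
  by rewrite -Sl Sn addrC.
(* With no Hilbert part, [A] is equivalent to a constant family, hence converges; as [S] has closed
   range, [b] converges in [X]. *)
have AE : ultra_class UU A = udiag UU (npair (npart a) 0 : NH H).
  by rewrite -fa -fe -{1}(npairK a) a0.
have Acvg : norm_cvg U (fun i => S (b i)) (npair (npart a) 0).
  move/ultra_classP : AE => A0.
  have -> : (fun i => S (b i)) = A by [].
  exact: ultra_equiv_cvg A0.
have [l bl Sl'] := isometric_limit _ BX Sl Sn Acvg.
by exists l; rewrite -Tb /S (cvg_ultra_equiv UU bl).
Qed.

Lemma npair0_in_range (x : @bounded_family R k I X) : ~ (exists l, norm_cvg U x l) ->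
  forall e : nakano_sum p E, exists u, S u = npair e 0.
Proof.
move=> /null_sequence[v [eps [M [eps0 vM v0]]]].
have S0 : S 0 = 0 by apply: rnorm_eq0; rewrite Sn rnorm0.
have SZ a u : S (a *: u) = a *: S u by rewrite -[a *: u]addr0 Sl S0 addr0.
have SD u u' : S (u + u') = S u + S u' by rewrite -[u]scale1r Sl !scale1r.
have single n (e : E n) : exists u, S u = npair (nakano_single p e) 0.
  (* The factor [c] brings the norm, hence the modular, below 1, where [single_in_range] applies. *)
  set z : NH H := npair _ 0; pose c := (rnorm z + 1)^-1.
  have z10 : 0 < rnorm z + 1 by rewrite ltr_wpDl ?rnorm_ge0.
  have c0 : 0 < c by rewrite invr_gt0.
  have zc : npair (nakano_single p (scalar_of_real c *: e)) 0 = scalar_of_real c *: z.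
    by rewrite nakano_singleZ -npairZ scaler0.
  have [|u uz] := single_in_range (e := scalar_of_real c *: e) eps0 vM v0.
    rewrite zc; apply: theta_lt1; rewrite rnormZr gtr0_norm // /c mulrC.
    by rewrite ltr_pdivrMr // mul1r ltrDl.
  exists (scalar_of_real c^-1 *: u).
  by rewrite SZ uz zc scalerA -scalar_of_realM mulVf ?gt_eqF // scalar_of_real1 scale1r.
move=> e; have /choice[u uP] N : exists u, S u = npair (nakano_trunc N e) 0.
  elim: N => [|N [u IH]]; first by exists 0; rewrite S0 /nakano_trunc big_ord0.
  have [u' u'P] := single N (e N).
  by exists (u + u'); rewrite SD IH u'P nakano_truncS -npairD addr0.
have cvu : norm_cvg \oo (fun N => S (u N)) (npair e 0).
  have -> : (fun N => S (u N)) = (fun N => npair (nakano_trunc N e) 0) by exact/funext.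
  exact: cvg_nakano_trunc.
by have [l _ lP] := isometric_limit _ BX Sl Sn cvu; exists l.
Qed.

Lemma isometric_of_npair0 : (forall e : nakano_sum p E, exists u, S u = npair e 0) ->
  exists H0, hilbert H0 /\ isometric X (NH H0).
Proof.
move=> Se.
have S0 : S 0 = 0 by apply: rnorm_eq0; rewrite Sn rnorm0.
have c0 : exists u, S u = npair 0 (0 : H) by exists 0; rewrite S0.
have cP (a : scalars R k) (x y : H) : (exists u, S u = npair 0 x) ->
    (exists u, S u = npair 0 y) -> exists u, S u = npair 0 (a *: x + y).
  move=> [u ux] [u' uy]; exists (a *: u + u').
  by rewrite Sl ux uy -npairZ -npairD scaler0 addr0.
pose C := @LinearSubspace R k H (fun h => exists u, S u = npair 0 h) c0 cP.
pose g (z : NH (subspace C)) : NH H := npair (npart z) (subval (hpart z)).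
have gl a y z : g (a *: y + z) = a *: g y + g z by [].
have gn z : rnorm (g z) = rnorm z.
  rewrite !rnorm_luxemburg; apply: luxemburg_norm_modular => c.
  by rewrite !modular_scaleE /g npart_npair hpart_npair rnorm_subval.
have XH0 : isometric X (NH (subspace C)).
  apply: (isometric_same_range Sl Sn gl gn) => [x|y].
    have [u uE] := Se (npart (S x)).
    have hC : C (hpart (S x)).
      exists (x - u); rewrite (isometric_linearB Sl) uE -{1}(npairK (S x)).
      by rewrite -[- npair _ _]scaleN1r -npairZ -npairD scaler0 addr0 scaleN1r subrr.
    by exists (npair (npart (S x)) (Subspace hC)); rewrite /g /= npairK.
  have [u uE] := Se (npart y); have [u' u'E] := subvalP (hpart y).
  exists (u + u'); rewrite -[u]scale1r Sl scale1r uE u'E.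
  by rewrite -npairD addr0 add0r.
exists (subspace C); split => //; apply: hilbert_of_parallelogram.
  exact: banach_hpart (isometric_banach XH0 BX).
by move=> x y; exact: (hilbert_parallelogram hH (subval x) (subval y)).
Qed.

Lemma isometric_of_ultrapower : exists H0, hilbert H0 /\ isometric X (NH H0).
Proof.
have [xc|/existsNP[x xc]] := pselect (forall x : @bounded_family R k I X,
    exists l, norm_cvg U x l); last first.
  exact: isometric_of_npair0 (npair0_in_range xc).
exists H; split => //; apply: (@isometricI _ _ X (NH H) S) => // z.
have [b bz] := ultra_classK (T' z); have [l bl] := xc b; exists l.
by rewrite /S -[RHS]T'K bz (cvg_ultra_equiv UU bl).
Qed.

End ElementaryEmbedding.

End Rigidity.

(** * Orthonormal bases and their cardinals *)

Section RieszFischer.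
Context {R : realType} {k : scalar_kind}.

Lemma scalar_reD (a b : scalars R k) : scalar_re (a + b) = scalar_re a + scalar_re b.
Proof. by case: k a b => //= -[a b] [c d]. Qed.

Lemma scalar_re0 : scalar_re (0 : scalars R k) = 0.
Proof. by case: k. Qed.

Lemma sum_uniq_sub (B : eqType) (c : B -> R) (F G : seq B) :
  (forall b, 0 <= c b) -> uniq F -> uniq G -> {subset F <= G} ->
  \sum_(b <- F) c b <= \sum_(b <- G) c b.
Proof.
move=> c0 uF uG FG; rewrite [leRHS](bigID (mem F)) /=.
rewrite -[X in _ <= X + _]big_filter.
have FGp : perm_eq F [seq b <- G | b \in F].
  apply: uniq_perm => // [|b]; first exact: filter_uniq.
  by rewrite mem_filter; case: (boolP (b \in F)) => // /FG ->.
rewrite (perm_big _ FGp) /=.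
by rewrite lerDl sumr_ge0.
Qed.

Variable H : normedModType (scalars R k).
Variable ip : {dot H for (@scalar_conj R k)}.
Hypothesis ipE : forall x, ip x x = `|x| ^+ 2.

Lemma pythagoras (x y : H) : ip x y = 0 ->
  rnorm (x + y) ^+ 2 = rnorm x ^+ 2 + rnorm y ^+ 2.
Proof.
move=> xy; rewrite -!(rnorm_ip ipE) ipDl !ipDr xy (ipC _ y x) xy.
have -> : scalar_conj 0 = 0 :> scalars R k by rewrite -scalar_of_real0 scalar_conj_real.
by rewrite addr0 add0r scalar_reD.
Qed.

Lemma ip0l (x : H) : ip 0 x = 0.
Proof. by rewrite -(scale0r (0 : H)) ipZl mul0r. Qed.

Lemma ip_eq0_sym (x y : H) : ip x y = 0 -> ip y x = 0.
Proof. by move=> xy; rewrite ipC xy -scalar_of_real0 scalar_conj_real. Qed.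

Variables (B : choiceType) (e : B -> H).
Hypothesis e_unit : forall b, ip (e b) (e b) = 1.
Hypothesis e_ortho : forall b c, b != c -> ip (e b) (e c) = 0.

Let rnorm_e b : rnorm (e b) = 1.
Proof.
have := rnorm_ip ipE (e b); rewrite e_unit => /esym /eqP.
have -> : scalar_re (1 : scalars R k) = 1 by rewrite -scalar_of_real1 scalar_of_realK.
by rewrite sqrp_eq1 ?rnorm_ge0 // => /eqP.
Qed.

Definition fourier_sum (a : B -> scalars R k) (G : seq B) : H := \sum_(b <- G) a b *: e b.

Lemma ip_fourier_sum a G c : uniq G ->
  ip (fourier_sum a G) (e c) = if c \in G then a c else 0.
Proof.
elim: G => [|b G IH] /=; first by rewrite /fourier_sum big_nil ip0l.
move=> /andP[bG uG]; rewrite /fourier_sum big_cons ipDl ipZl -/(fourier_sum a G) IH // inE.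
have [->|cb] := eqVneq c b; first by rewrite e_unit mulr1 (negbTE bG) addr0.
by rewrite e_ortho 1?eq_sym // mulr0 add0r.
Qed.

Lemma rnorm_fourier_sum a G : uniq G ->
  rnorm (fourier_sum a G) ^+ 2 = \sum_(b <- G) rnorm (a b) ^+ 2.
Proof.
elim: G => [|b G IH] /=; first by rewrite /fourier_sum !big_nil rnorm0 expr0n.
move=> /andP[bG uG]; rewrite /fourier_sum !big_cons -/(fourier_sum a G) addrC pythagoras.
  by rewrite IH // rnormZ rnorm_e mulr1 addrC.
by rewrite ipZr ip_fourier_sum // (negbTE bG) mulr0.
Qed.

Lemma fourier_sum_residual x G : uniq G ->
  rnorm (x - fourier_sum (fun b => ip x (e b)) G) ^+ 2 =
    rnorm x ^+ 2 - \sum_(b <- G) rnorm (ip x (e b)) ^+ 2.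
Proof.
move=> uG; pose a b := ip x (e b); pose P := fourier_sum a G.
have o b : b \in G -> ip (x - P) (e b) = 0.
  by move=> bG; rewrite ipDl ipNl ip_fourier_sum // bG subrr.
have oP : ip (x - P) P = 0.
  rewrite /P /fourier_sum; apply: ip_eq0_sym.
  have : {subset G <= G} by [].
  elim: {1 3}G => [|b G' IH] sG; first by rewrite big_nil ip0l.
  rewrite big_cons ipDl ipZl IH ?addr0 => [|c cG]; last by apply: sG; rewrite inE cG orbT.
  by rewrite (ip_eq0_sym (o b _)) ?mulr0 // sG // inE eqxx.
by have := pythagoras oP; rewrite subrK rnorm_fourier_sum // => ->; rewrite addrK.
Qed.

Lemma bessel x G : uniq G -> \sum_(b <- G) rnorm (ip x (e b)) ^+ 2 <= rnorm x ^+ 2.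
Proof. by move=> /(fourier_sum_residual x) xG; rewrite -subr_ge0 -xG sqr_ge0. Qed.

Lemma ip_unit_le x b : rnorm (ip x (e b)) <= rnorm x.
Proof.
have := @bessel x [:: b] isT; rewrite big_seq1.
by rewrite ler_pXn2r ?nnegrE ?rnorm_ge0.
Qed.

(** The index set may be uncountable, so the sum of squares is the supremum over duplicate-free
    lists. *)
Definition coef_sums (a : B -> scalars R k) : set R :=
  [set r | exists2 G : seq B, uniq G & r = \sum_(b <- G) rnorm (a b) ^+ 2].

(** Growing lists [G n] have sums of squares within [4^-n] of the supremum. By orthogonality
    consecutive Fourier sums differ by at most [2^-n], so they converge. *)
Lemma riesz_fischer (a : B -> scalars R k) (M : R) : banach H ->
  (forall G, uniq G -> \sum_(b <- G) rnorm (a b) ^+ 2 <= M) ->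
  exists2 y, (forall b, ip y (e b) = a b) & rnorm y ^+ 2 = sup (coef_sums a).
Proof.
move=> BH aM; set s := sup _.
pose N G := \sum_(b <- G) rnorm (a b) ^+ 2.
have N0 G : 0 <= N G by apply: sumr_ge0 => b _; exact: sqr_ge0.
have hs : has_sup (coef_sums a).
  split; first by exists 0; exists [::]; rewrite ?big_nil.
  by exists M => _ [G uG ->]; exact: aM.
have Ns G : uniq G -> N G <= s.
  by move=> uG; apply: ub_le_sup; [case: hs|exists G].
have hq n : (0 : R) < 4^-1 ^+ n by rewrite exprn_gt0.
have /choice[F FP] n : exists F : seq B, uniq F /\ s - 4^-1 ^+ n < N F.
  by have [_ [F uF ->] sF] := sup_adherent (hq n) hs; exists F.
(* The lists [F n] need not grow; [G] accumulates them without repetition. *)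
pose fix G n := if n is m.+1 then G m ++ [seq b <- F n | b \notin G m] else F 0%N.
have uG n : uniq (G n).
  elim: n => [|n IH] /=; first exact: (FP 0%N).1.
  rewrite cat_uniq IH filter_uniq ?(FP n.+1).1 //= andbT.
  by apply/hasPn => b; rewrite mem_filter => /andP[].
have NG n : s - 4^-1 ^+ n < N (G n).
  apply: lt_le_trans (FP n).2 _; case: n => [|n] //=.
  apply: sum_uniq_sub => [b||| b bF]; rewrite ?sqr_ge0 ?(FP n.+1).1 //.
    exact: (uG n.+1).
  by rewrite mem_cat mem_filter bF andbT orbN.
pose y n := fourier_sum a (G n).
have half2 n : (2^-1 ^+ n) ^+ 2 = 4^-1 ^+ n :> R.
  by rewrite -exprM mulnC exprM; congr (_ ^+ _); field.
have yc n : rnorm (y n.+1 - y n) <= 1 * 2^-1 ^+ n.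
  rewrite mul1r -(@ler_pXn2r _ 2) ?nnegrE ?rnorm_ge0 ?(ltW (expr_half_gt0 _)) // half2.
  rewrite /y /fourier_sum /= big_cat /= addrAC subrr add0r -/(fourier_sum a _).
  rewrite rnorm_fourier_sum; last by rewrite filter_uniq // (FP n.+1).1.
  have := Ns _ (uG n.+1); rewrite /N /= big_cat /= -/(N (G n)).
  by move: (NG n); lra.
have [l yl] := banach_geometric BH yc.
have lim0 (u c : R) : 0 <= u -> 0 <= c -> (forall n, u <= c * 2^-1 ^+ n) -> u = 0.
  move=> u0 c0 uc; apply/eqP; rewrite eq_le u0 andbT leNgt; apply/negP => up.
  have c10 : 0 < c + 1 by rewrite ltr_wpDl.
  have [|n] := @near_expr_half _ (u / (c + 1)); first by rewrite divr_gt0.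
  rewrite ltr_pdivlMr // => nu; have := uc n; rewrite leNgt => /negP; apply.
  apply: le_lt_trans nu; rewrite mulrC ler_wpM2l ?(ltW (expr_half_gt0 _)) //.
  by rewrite lerDl.
exists l => [b|].
  apply/eqP; rewrite -subr_eq0; apply/eqP/rnorm_eq0.
  apply: (lim0 _ (2 * 1 + 1)); rewrite ?rnorm_ge0 // => n.
  have -> : ip l (e b) - a b = ip (l - y n) (e b) + (ip (y n) (e b) - a b).
    by rewrite ipDl ipNl addrA subrK.
  apply: le_trans (ler_rnormD _ _) _; rewrite mulrDl lerD //.
    exact: le_trans (ip_unit_le _ _) (yl n).
  rewrite mul1r ip_fourier_sum //; case: ifPn => bG.
    by rewrite subrr rnorm0 ltW // expr_half_gt0.
  (* An index outside [G n] has a coefficient whose square fits into the remaining [4^-n]. *)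
  rewrite sub0r rnormN -(@ler_pXn2r _ 2) ?nnegrE ?rnorm_ge0 ?(ltW (expr_half_gt0 _)) // half2.
  have := Ns (b :: G n); rewrite /= bG uG => /(_ isT); rewrite /N big_cons -/(N (G n)).
  by move: (NG n); lra.
have h1 : rnorm (y n) @[n --> \oo] --> rnorm l.
  apply: norm_cvg_rnorm; apply: near_norm_cvg => d d0.
  have [|n nd] := @near_expr_half _ (d / 2); first by rewrite divr_gt0.
  exists n => // m /= nm; rewrite rnormB_sym; apply: le_trans (yl m) _.
  have : (2^-1 : R) ^+ m <= 2^-1 ^+ n.
    by apply: ler_wiXn2l => //; rewrite ?invr_ge0 // invf_le1 // ler1n.
  by move: nd; lra.
have h2 : rnorm (y n) ^+ 2 @[n --> \oo] --> rnorm l ^+ 2 by exact: cvgM.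
have h3 : rnorm (y n) ^+ 2 @[n --> \oo] --> s.
  have q0 : s - 4^-1 ^+ n @[n --> \oo] --> s.
    rewrite -[X in _ --> X]subr0; apply: cvgB; first exact: cvg_cst.
    by apply: cvg_expr; rewrite ger0_norm ?invr_ge0 //; lra.
  apply: (squeeze_cvgr _ q0 (cvg_cst s)); near=> n.
  by rewrite rnorm_fourier_sum // (ltW (NG n)) Ns.
exact: (cvg_unique (@Rhausdorff R) h2 h3).
Unshelve. all: by end_near. Qed.

Hypothesis e_complete : forall x, (forall b, ip x (e b) = 0) -> x = 0.

Lemma complete_unique x y : (forall b, ip x (e b) = ip y (e b)) -> x = y.
Proof.
move=> xy; apply/eqP; rewrite -subr_eq0; apply/eqP/e_complete => b.
by rewrite ipDl ipNl xy subrr.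
Qed.

Lemma parseval x : banach H -> rnorm x ^+ 2 = sup (coef_sums (fun b => ip x (e b))).
Proof.
move=> BH; have [y yx yn] := riesz_fischer BH (bessel x).
by rewrite -yn; congr (rnorm _ ^+ 2); apply: complete_unique => b; rewrite yx.
Qed.

End RieszFischer.

Section HilbertBases.
Context {R : realType} {k : scalar_kind}.
Implicit Types H : normedModType (scalars R k).

Definition hilbert_basis H (B : choiceType) (e : B -> H) := exists ip : {dot H for (@scalar_conj R k)},
  [/\ (forall x, ip x x = `|x| ^+ 2), (forall b, ip (e b) (e b) = 1),
      (forall b c, b != c -> ip (e b) (e c) = 0) &
      forall x, (forall b, ip x (e b) = 0) -> x = 0].

Lemma hilbert_basis_isometric H1 H2 (B : choiceType) (e1 : B -> H1) (e2 : B -> H2) :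
  banach H1 -> banach H2 -> hilbert_basis e1 -> hilbert_basis e2 -> isometric H1 H2.
Proof.
move=> B1 B2 [ip1 [n1 u1 o1 c1]] [ip2 [n2 u2 o2 c2]].
have /choice[f fP] x : exists y, forall b, ip2 y (e2 b) = ip1 x (e1 b).
  have [y yx _] := riesz_fischer n2 u2 o2 B2 (bessel n1 u1 o1 x).
  by exists y.
apply: (@isometricI _ _ _ _ f).
- move=> a x y; apply: (complete_unique c2) => b.
  by rewrite fP !ipDl !ipZl !fP.
- move=> y; have [x xy _] := riesz_fischer n1 u1 o1 B1 (bessel n2 u2 o2 y).
  by exists x; apply: (complete_unique c2) => b; rewrite fP xy.
- move=> x; apply/eqP; rewrite -(@eqrXn2 _ 2) ?rnorm_ge0 //.
  rewrite (parseval n1 u1 o1 c1 x B1) (parseval n2 u2 o2 c2 (f x) B2).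
  by rewrite (_ : (fun b => ip2 (f x) (e2 b)) = (fun b => ip1 x (e1 b))) //; exact/funext.
Qed.

Definition orthonormal_set H (ip : {dot H for (@scalar_conj R k)}) (S : set H) :=
  (forall x, S x -> ip x x = 1) /\ (forall x y, S x -> S y -> x <> y -> ip x y = 0).

(** Zorn's lemma is applied to the sets whose union with [S0] is orthonormal, so that the union of
    the empty chain qualifies. A nonzero vector orthogonal to a maximal set could be normalized and
    added. *)
Lemma orthonormal_extend H (ip : {dot H for (@scalar_conj R k)}) (S0 : set H) :
  (forall x, ip x x = `|x| ^+ 2) -> orthonormal_set ip S0 ->
  exists S, [/\ S0 `<=` S, orthonormal_set ip S &
    forall x, (forall s, S s -> ip x s = 0) -> x = 0].
Proof.
move=> ipE oS0.
have [F FP Fchain|A [oA Amax]] := @Zorn_bigcup H (fun A => orthonormal_set ip (A `|` S0)).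
  split=> [x [[X FX Xx]|S0x]|x y]; first by apply: (FP _ FX).1; left.
    exact: oS0.1.
  have in1 X u : F X -> X u -> forall v, S0 v -> u <> v -> ip u v = 0 /\ ip v u = 0.
    move=> FX Xu v S0v uv.
    have h : ip u v = 0 by exact: ((FP _ FX).2 u v (or_introl Xu) (or_intror S0v) uv).
    by split => //; exact: ip_eq0_sym h.
  move=> [[X FX Xx]|S0x] [[Y FY Yy]|S0y] xy.
  - have [XY|YX] := Fchain _ _ FX FY.
      exact: ((FP _ FY).2 x y (or_introl (XY _ Xx)) (or_introl Yy) xy).
    exact: ((FP _ FX).2 x y (or_introl Xx) (or_introl (YX _ Yy)) xy).
  - exact: (in1 _ _ FX Xx _ S0y xy).1.
  - exact: (in1 _ _ FY Yy _ S0x (nesym xy)).2.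
  - exact: oS0.2.
exists (A `|` S0); split => // x xS.
apply: contrapT => /eqP x0; pose u := scalar_of_real (rnorm x)^-1 *: x.
have xn := rnorm_gt0 x0.
have uu : ip u u = 1.
  rewrite ipE -rnormE rnormZr ger0_norm ?invr_ge0 ?rnorm_ge0 // mulVf ?gt_eqF //.
  by rewrite scalar_of_real1 expr1n.
have us s : (A `|` S0) s -> ip u s = 0.
  by move=> Ss; rewrite ipZl xS // mulr0.
have nAu : ~ A u.
  move=> Au; have := us u (or_introl Au); rewrite uu => /eqP.
  by rewrite oner_eq0.
apply: (Amax (A `|` [set u])); first by split=> [?|/(_ u (or_intror erefl))//]; left.
split=> [z|z w].
  by move=> [[Az|->//]|Sz]; apply: oA.1; [left|right].
have cases v : (A `|` [set u] `|` S0) v -> (A `|` S0) v \/ v = u.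
  by move=> [[Av|->]|Sv]; [left; left|right|left; right].
move=> /cases[zS|->] /cases[wS|->] zw.
- exact: oA.2.
- by rewrite ip_eq0_sym // us.
- exact: us.
- by case: zw.
Qed.

End HilbertBases.

Section Cardinals.

Lemma card_le_fun (T U : Type) (A : set T) (B : set U) (f : T -> U) :
  (forall x, A x -> B (f x)) -> (forall x y, A x -> A y -> f x = f y -> x = y) ->
  (A #<= B)%card.
Proof.
move=> AB finj; have /card_eqPle[_ Af] : (f @` A #= A)%card.
  by apply: inj_card_eq => x y /set_mem Ax /set_mem Ay; exact: finj.
by apply: card_le_trans Af _; apply: subset_card_le => _ [x Ax <-]; exact: AB.
Qed.

Lemma card_leE (T : Type) (U : pointedType) (A : set T) (B : set U) : (A #<= B)%card ->
  exists f : T -> U, (forall x, A x -> B (f x)) /\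
    (forall x y, A x -> A y -> f x = f y -> x = y).
Proof.
move=> /pcard_leP[f]; exists f; split=> [x Ax|x y Ax Ay fxy]; first exact: 'funS_f.
by have := 'inj_f => /(_ x y (mem_set Ax) (mem_set Ay) fxy).
Qed.

End Cardinals.

Section BasisOfSet.
Context {R : realType} {k : scalar_kind}.

Lemma hilbert_basis_of_set (H : normedModType (scalars R k)) (C : Type)
    (ip : {dot H for (@scalar_conj R k)}) (S : set H) :
  (forall x, ip x x = `|x| ^+ 2) -> orthonormal_set ip S ->
  (forall x, (forall s, S s -> ip x s = 0) -> x = 0) -> ([set: C] #= S)%card ->
  exists e : {classic C} -> H, hilbert_basis e.
Proof.
move=> ipE [S1 S0] Sc /card_set_bijP[f [fS finj fsurj]].
exists f, ip; split => // [b|b c bc|x xe].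
- exact/S1/fS.
- apply: S0; [exact: fS|exact: fS|] => /finj bc'.
  by move/eqP: bc; apply; apply: bc'; rewrite inE.
- by apply: Sc => s /fsurj[b _ <-]; exact: xe.
Qed.

(** Equal norms of [x + l *: y] and [x - l *: y] annihilate the real part of [ip x (l *: y)]. For
    [l] the phase of [ip x y] this real part is [rnorm (ip x y)]. *)
Lemma ip_eq0_of_norms (H : normedModType (scalars R k))
    (ip : {dot H for (@scalar_conj R k)}) (x y : H) (c : R) :
  (forall x, ip x x = `|x| ^+ 2) ->
  (forall l : scalars R k, rnorm l = 1 -> rnorm (x + l *: y) ^+ 2 = c) -> ip x y = 0.
Proof.
move=> ipE xy; set z := ip x y; apply: contrapT => /eqP z0.
have zn : 0 < rnorm z := rnorm_gt0 z0.
pose l := z * scalar_of_real (rnorm z)^-1.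
have l1 : rnorm l = 1.
  rewrite /l -[z * _]/(z *: (scalar_of_real (rnorm z)^-1 : scalars R k)).
  by rewrite rnormZ rnorm_scalar ger0_norm ?invr_ge0 ?rnorm_ge0 // divff // gt_eqF.
have Nl1 : rnorm (- l) = 1 by rewrite rnormN.
have := xy _ Nl1; rewrite -(xy _ l1) scaleNr -!(rnorm_ip ipE).
have re_conj (a : scalars R k) : scalar_re (scalar_conj a) = scalar_re a.
  by case: k a => //= -[].
have reN (a : scalars R k) : scalar_re (- a) = - scalar_re a.
  by apply/eqP; rewrite -addr_eq0 -scalar_reD addNr scalar_re0.
have e1 : scalar_re (ip x (l *: y)) = rnorm z.
  rewrite ipZr -/z /l scalar_conjM scalar_conj_real mulrAC mulrC [scalar_conj z * z]mulrC.
  rewrite scalar_mul_conj -rnormE expr2 mulrA -!scalar_of_realM mulVf ?gt_eqF //.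
  by rewrite mul1r scalar_of_realK.
rewrite !(ipDl, ipDr, ipNl, ipNr) (ipC _ (l *: y) x) !scalar_reD !reN !re_conj e1.
by move: zn; lra.
Qed.

End BasisOfSet.

(** * An ultrafilter whose ultrapowers have Hilbert parts of prescribed dimension *)

Section BigUltrafilter.
Variable W : Type.

(* The constructor makes the cardinal of [node] absorb finite sequences and [W], so
   no cardinal arithmetic is needed. *)
Inductive node := Node of nat & seq node & W.

(** Along this filter the stage [n] tends to infinity, while the list [s] eventually tells any two
    distinct functions on [node] apart. *)
Definition big_base : set_system (nat * seq node) := [set A | exists n0 s0,
  forall n s, (n0 <= n)%N -> (forall x, List.In x s0 -> List.In x s) -> A (n, s)].

Lemma big_base_filter : ProperFilter big_base.
Proof.
apply: Build_ProperFilter_ex; first by move=> A [n0 [s0 A0]]; exists (n0, s0); exact: A0.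
split; first by exists 0%N, [::].
  move=> A B [n0 [s0 A0]] [n1 [s1 B1]]; exists (maxn n0 n1), (s0 ++ s1) => n s.
  rewrite geq_max => /andP[n0n n1n] ss.
  by split; [apply: A0|apply: B1] => // x xs; apply: ss; apply/List.in_or_app; [left|right].
by move=> A B AB [n0 [s0 A0]]; exists n0, s0 => n s n0n ss; exact/AB/A0.
Qed.

(** One number encodes the stage and the values of [f] on the list. It serves as a coordinate of E:
    the coordinates tend to infinity, and eventually differ for distinct [f]. *)
Definition node_code (f : node -> bool) (i : nat * seq node) : nat :=
  choice.pickle (i.1, [seq f x | x <- i.2]).

Lemma node_code_infinite (U : set_system (nat * seq node)) (f : node -> bool) j :
  Filter U -> big_base `<=` U -> \forall i \near U, node_code f i <> j.
Proof.
move=> FU bU; apply: bU.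
(* If [j] is a code, [q.1.+1] lies beyond its stage; otherwise every stage will do. *)
exists (if (choice.unpickle j : option (nat * seq bool)) is Some q then q.1.+1 else 0%N), [::].
move=> n s + _ nj; have : choice.unpickle j = Some (n, [seq f x | x <- s]).
  by rewrite -nj /node_code choice.pickleK.
by move=> ->; rewrite ltnn.
Qed.

Lemma node_code_neq (U : set_system (nat * seq node)) (f g : node -> bool) :
  Filter U -> big_base `<=` U -> f <> g ->
  \forall i \near U, node_code f i <> node_code g i.
Proof.
move=> FU bU fg; have [x fgx] : exists x, f x <> g x.
  by apply: contrapT => nx; apply: fg; apply/funext => x; apply: contrapT => ?; apply: nx; exists x.
apply: bU; exists 0%N, [:: x] => n s _ /(_ x (or_introl erefl)) xs.
move=> /(pcan_inj choice.pickleK)[]; elim: s xs => //= y s IH [->|xs] [yy fgs] //.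
exact: IH.
Qed.

(** Injects the families over the index set into [node -> bool]; this bounds the cardinal of an
    ultrapower from above. *)
Definition node_graph (g : nat * seq node -> W) (x : node) : bool :=
  let: Node n s w := x in `[< g (n, s) = w >].

Lemma node_graph_inj : injective node_graph.
Proof.
move=> g h gh; apply/funext => -[n s].
have : node_graph g (Node n s (g (n, s))) by exact/asboolP.
by rewrite gh => /asboolP.
Qed.

End BigUltrafilter.

Section BigUltrapower.
Context {R : realType} {k : scalar_kind} (p : exponents R).
Variable E : nat -> normedModType (scalars R k).
Hypothesis p_cvg2 : p n @[n --> \oo] --> (2 : R).
Hypothesis E_fin : forall n, finite_dim (E n).
Hypothesis E_nonzero : forall n, exists x : E n, x != 0.
Hypothesis E_jvn : jordan_von_neumann (E n) @[n --> \oo] --> (1 : R).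
Local Notation NH := (nakano_sum_hilbert p E).

Lemma unit_vectors : exists u : forall n, E n, forall n, rnorm (u n) = 1.
Proof.
have un n : exists u : E n, rnorm u = 1.
  have [x x0] := E_nonzero n; exists (scalar_of_real (rnorm x)^-1 *: x).
  by rewrite rnormZr ger0_norm ?invr_ge0 ?rnorm_ge0 // mulVf // gt_eqF // rnorm_gt0.
by exists (fun n => sval (cid (un n))) => n; case: cid.
Qed.

Lemma modular_singleD n m (x : E n) (y : E m) : n != m ->
  modular (nakano_single p x + nakano_single p y) = rnorm x `^ p n + rnorm y `^ p m.
Proof.
move=> nm; rewrite -!modular_single.
set X := nakano_single p x; set Y := nakano_single p y.
have pt j : rnorm ((X + Y) j) `^ p j = rnorm (X j) `^ p j + rnorm (Y j) `^ p j.
  rewrite nakanoDE; have [jn|jn] := eqVneq n j.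
    rewrite [Y j]nakano_single_out; last by rewrite -jn eq_sym.
    by rewrite addr0 rnorm0 (powR0 (lt0r_neq0 (exponent_gt0 p j))) addr0.
  rewrite [X j]nakano_single_out //.
  by rewrite add0r rnorm0 (powR0 (lt0r_neq0 (exponent_gt0 p j))) add0r.
have hD N : nakano_head p N (X + Y) = nakano_head p N X + nakano_head p N Y.
  by rewrite /nakano_head -big_split; apply: eq_bigr => j _; exact: pt.
apply: (cvg_unique (@Rhausdorff R) (@cvg_nakano_head _ _ _ _ (X + Y))).
have -> : (fun N => nakano_head p N (X + Y)) = (fun N => nakano_head p N X + nakano_head p N Y).
  exact/funext.
by apply: cvgD; exact: cvg_nakano_head.
Qed.

Lemma utheta_near (H : normedModType (scalars R k)) (I : Type) (U : set_system I)
    (UU : UltraFilter U) (x : @bounded_family R k I (NH H)) (c : R) :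
  (\forall i \near U, theta (x i) = c) -> utheta U x = c.
Proof.
move=> xc; apply: (cvg_unique (@Rhausdorff R) (@utheta_cvg _ _ _ _ _ _ _ UU x)).
apply: (@cvg_trans _ (cst c @ U)); last exact: cvg_cst.
by apply: near_eq_cvg; apply: filterS xc => i <-.
Qed.

Section Spread.
Variables (W : Type) (U : set_system (nat * seq (node W))).
Hypotheses (UU : UltraFilter U) (bU : @big_base W `<=` U).
Variables (H : normedModType (scalars R k)) (u : forall n, E n).
Hypothesis u1 : forall n, rnorm (u n) = 1.
Local Notation I := (nat * seq (node W))%type.

Let spread_fun (f : node W -> bool) (i : I) : NH H :=
  npair (nakano_single p (u (node_code f i))) 0.

Let theta_spread f i : theta (spread_fun f i) = 1.
Proof. by rewrite thetaE modular_single u1 powR1 hpart_npair rnorm0 expr0n addr0. Qed.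

Let rnorm_spread f i : rnorm (spread_fun f i) = 1.
Proof. exact/rnorm_eq1/theta_spread. Qed.

Let spread_bounded f : exists M : R, forall i, rnorm (spread_fun f i) <= M.
Proof. by exists 1 => i; rewrite rnorm_spread. Qed.

Definition spread f : @bounded_family R k I (NH H) := BoundedFamily (spread_bounded f).

Lemma spread_null f : null U (spread f).
Proof.
move=> j; apply: near_norm_cvg => e e0.
apply: filterS (node_code_infinite f j _ bU) => i ij.
have -> : npart (spread f i) j = 0 by apply: nakano_single_out; exact/eqP.
by rewrite subr0 rnorm0 ltW.
Qed.

Lemma rnorm_class_spread f : rnorm (ultra_class UU (spread f)) = 1.
Proof.
rewrite rnorm_ultra_class; apply: ultranorm_lim.
have -> : (fun i => rnorm (spread f i)) = cst 1 by apply/funext => i; exact: rnorm_spread.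
exact: cvg_cst.
Qed.

(** Eventually the two vectors sit on different coordinates, and the modular of the sum is [1 + 1].
    That the value does not depend on the phase [l] gives orthogonality through
    [ip_eq0_of_norms]. *)
Lemma rnorm_class_spreadD f g (l : scalars R k) : f <> g -> rnorm l = 1 ->
  rnorm (ultra_class UU (spread f + l *: spread g)) ^+ 2 = 2.
Proof.
move=> fg l1; rewrite rnorm_ultra_class -utheta_null //; last first.
  exact: nullD (spread_null f) (nullZ l (spread_null g)).
apply: utheta_near; apply: filterS (node_code_neq _ bU fg) => i /eqP fgi.
rewrite familyDE familyZE thetaE npartD npartZ hpartD hpartZ /= scaler0 addr0 rnorm0 expr0n addr0.
rewrite -nakano_singleZ modular_singleD // rnormZ l1 mul1r !u1 !powR1.
by lra.
Qed.

End Spread.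

(** The classes of the families [spread f] are orthonormal and extend to a basis, which is therefore
    at least as large as [node W -> bool]. Conversely, a vector is determined by a representing
    family, and [w] and [node_graph] code that family as an element of [node W -> bool]. Keeping [W]
    as a parameter lets different spaces share one ultrafilter. *)
Theorem big_ultrapower_basis (W : Type) (U : set_system (nat * seq (node W)))
    (UU : UltraFilter U) (H : normedModType (scalars R k)) (w : NH H -> W) :
  @big_base W `<=` U -> hilbert H -> injective w ->
  exists H' : normedModType (scalars R k), [/\ hilbert H',
    isometric (ultrapower UU (NH H)) (NH H') &
    exists e : {classic (node W -> bool)} -> H', hilbert_basis e].
Proof.
move=> bU hH winj; have [u u1] := unit_vectors.
have [H' [F [hH' Fl Fs Fn [_ _ F0]]]] :=
  hilbert_ultrapower_structure p_cvg2 E_fin E_jvn UU hH.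
exists H'; split => //; first exact/isometric_sym/(isometricI Fl Fs Fn).
have [_ [ip ipE]] := hH'.
have /choice[h hP] f : exists h, ultra_class UU (spread H u1 f) = F (npair 0 h).
  by apply: F0; exact: spread_null.
have hn f : rnorm (h f) = 1.
  by rewrite -(rnorm_npair0l p E) -Fn -hP; exact: rnorm_class_spread.
have ip1 f : ip (h f) (h f) = 1.
  by rewrite ipE -rnormE hn scalar_of_real1 expr1n.
have ip0 f g : f <> g -> ip (h f) (h g) = 0.
  move=> fg; apply: (ip_eq0_of_norms (c := 2) ipE) => l l1.
  rewrite -(rnorm_npair0l p E).
  have -> : npair 0 (h f + l *: h g) = l *: npair 0 (h g) + npair 0 (h f) :> NH H'.
    by rewrite -npairZ -npairD scaler0 addr0 addrC.
  rewrite -Fn Fl -!hP -ultra_classZ -ultra_classD addrC.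
  exact: rnorm_class_spreadD.
have oS0 : orthonormal_set ip (range h).
  split=> [_ [f _ <-]|_ _ [f _ <-] [g _ <-] hfg]; first exact: ip1.
  by apply: ip0 => fg; apply: hfg; rewrite fg.
have [S [S0S oS Sc]] := orthonormal_extend ipE oS0.
apply: (hilbert_basis_of_set ipE oS Sc); apply: Cantor_Bernstein.
  apply: (@card_le_fun _ _ _ _ h) => [f _|f g _ _ hfg]; first by apply: S0S; exists f.
  apply: contrapT => fg; have := ip1 f; rewrite {2}hfg ip0 // => /eqP.
  by rewrite eq_sym oner_eq0.
have /choice[r rP] (s : H') := ultra_classK (F (npair 0 s)).
apply: (@card_le_fun _ _ _ _ (fun s => node_graph (fun i => w (r s i)))) => // s t _ _.
move=> /node_graph_inj rst; have {}rst : r s = r t.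
  by apply: bounded_familyP => i; apply: winj; exact: (congr1 (fun g => g i) rst).
have FF : F (npair 0 s) = F (npair 0 t) by rewrite !rP rst.
apply/eqP; rewrite -subr_eq0; apply/eqP/rnorm_eq0.
rewrite -(rnorm_npair0l p E).
have -> : npair 0 (s - t) = npair 0 s - npair 0 t :> NH H'.
  by rewrite -[- npair _ _]scaleN1r -npairZ -npairD scaler0 addr0 scaleN1r.
by rewrite -Fn (isometric_linearB Fl) FF subrr rnorm0.
Qed.

End BigUltrapower.

(** * The elementary class of E *)

Section ElementaryClass.
Context {R : realType} {k : scalar_kind}.

Lemma isometric_ultrapower (X Y : normedModType (scalars R k)) (I : Type)
    (U : set_system I) (UU : UltraFilter U) :
  isometric X Y -> isometric (ultrapower UU X) (ultrapower UU Y).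
Proof.
move=> /isometricE[f [g [fl fK gK gl [fn gn]]]].
have bnd (V V' : normedModType (scalars R k)) (F : V -> V') (x : @bounded_family R k I V) :
    (forall v, rnorm (F v) = rnorm v) -> exists M : R, forall i, rnorm (F (x i)) <= M.
  by move=> Fn; have [M xM] := family_valP x; exists M => i; rewrite Fn.
pose fam (x : @bounded_family R k I X) := BoundedFamily (bnd _ _ f x fn).
have famE x y : ultra_class UU x = ultra_class UU y ->
    ultra_class UU (fam x) = ultra_class UU (fam y).
  move=> /ultra_classP xy; apply/ultra_classP; rewrite -{}xy /ultranorm.
  have -> // : (fun i => rnorm ((fam x - fam y) i)) = (fun i => rnorm ((x - y) i)).
  by apply/funext => i; rewrite !familyDE !familyNE -(isometric_linearB fl) fn.
have /choice[r rP] : forall q : ultrapower UU X, exists x, q = ultra_class UU x.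
  exact: ultra_classK.
have FE x : ultra_class UU (fam (r (ultra_class UU x))) = ultra_class UU (fam x).
  by apply: famE; rewrite -rP.
apply: (@isometricI _ _ _ _ (fun q => ultra_class UU (fam (r q)))).
- move=> a q q'; rewrite {1}(rP q) {1}(rP q') -ultra_classZ -ultra_classD FE.
  rewrite -ultra_classZ -ultra_classD; congr ultra_class.
  by apply: bounded_familyP => i; rewrite /= fl.
- move=> q; have [y ->] := ultra_classK q.
  pose x := BoundedFamily (bnd _ _ g y gn).
  exists (ultra_class UU x); rewrite FE; congr ultra_class.
  by apply: bounded_familyP => i; rewrite /= gK.
- move=> q; rewrite [in RHS](rP q); apply: rnorm_class_eq => i; exact: fn.
Qed.

Lemma zero_carrierP (V : normedModType (scalars R k)) (a : scalars R k) (x y : V) :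
  x = 0 -> y = 0 -> a *: x + y = 0.
Proof. by move=> -> ->; rewrite scaler0 addr0. Qed.

(** Presents E as E +m 0, so that the structure of ultrapowers applies to E itself. *)
Definition zero_space : normedModType (scalars R k) :=
  subspace (@LinearSubspace R k (scalars R k) (fun x => x = 0) erefl
    (@zero_carrierP (scalars R k))).

Lemma zero_spaceE (x : zero_space) : x = 0.
Proof. by apply: subspaceP; exact: subvalP x. Qed.

Lemma zero_space_hilbert : hilbert zero_space.
Proof.
apply: hilbert_of_parallelogram.
  apply: geometric_banach => u uc; exists 0 => n.
  by rewrite (zero_spaceE (_ - _)) rnorm0 mulr_ge0 // ltW // expr_half_gt0.
by move=> x y; rewrite (zero_spaceE x) (zero_spaceE y) addr0 subr0 !rnorm0 expr0n addr0 mulr0.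
Qed.

Variables (p : exponents R) (E : nat -> normedModType (scalars R k)).
Local Notation NH := (nakano_sum_hilbert p E).
Local Notation NE := (nakano_direct_sum p E).

Lemma isometric_nakano_zero : isometric NE (NH zero_space).
Proof.
apply: (@isometricI _ _ NE (NH zero_space) (fun e => npair (e : nakano_sum p E) 0)).
- by move=> a x y; rewrite -npairZ -npairD scaler0 addr0.
- move=> z; exists (npart z : NE); rewrite -[RHS]npairK.
  congr npair; exact: esym (zero_spaceE _).
- move=> e; rewrite !rnorm_luxemburg; apply: luxemburg_norm_modular => c.
  by rewrite modular_scaleE hpart_npair rnorm0 expr0n mulr0 addr0.
Qed.

Lemma isometric_nakano_hilbert (H1 H2 : normedModType (scalars R k)) :
  isometric H1 H2 -> isometric (NH H1) (NH H2).
Proof.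
move=> /isometricE[f [g [fl fK gK gl [fn gn]]]].
apply: (@isometricI _ _ _ _ (fun z : NH H1 => npair (npart z) (f (hpart z)) : NH H2)).
- by move=> a x y; rewrite -npairZ -npairD hpartD hpartZ fl.
- move=> z; exists (npair (npart z) (g (hpart z))).
  by rewrite npart_npair hpart_npair gK npairK.
- move=> z; rewrite !rnorm_luxemburg; apply: luxemburg_norm_modular => c.
  by rewrite !modular_scaleE npart_npair hpart_npair fn.
Qed.

Hypothesis p_neq2 : forall n, p n != 2.
Hypothesis p_cvg2 : p n @[n --> \oo] --> (2 : R).
Hypothesis E_fin : forall n, finite_dim (E n).
Hypothesis E_nonzero : forall n, exists x : E n, x != 0.
Hypothesis E_jvn : jordan_von_neumann (E n) @[n --> \oo] --> (1 : R).

Lemma elementary_class_isometric (X : normedModType (scalars R k)) :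
  elementary_class NE X -> exists H, hilbert H /\ isometric X (NH H).
Proof.
move=> [BX [I [J [U [V [UU [VV XE]]]]]]].
have [H' [F [hH' Fl Fs Fn _]]] :=
  hilbert_ultrapower_structure p_cvg2 E_fin E_jvn VV zero_space_hilbert.
have : isometric (ultrapower UU X) (NH H').
  apply: isometric_trans XE _.
  apply: isometric_trans (isometric_ultrapower VV isometric_nakano_zero) _.
  exact/isometric_sym/(isometricI Fl Fs Fn).
move=> /isometricE[T [T' [Tl _ T'K _ [Tn _]]]].
exact: (isometric_of_ultrapower p_neq2 p_cvg2 E_fin E_jvn BX hH' Tl Tn T'K).
Qed.

(** Both E +m H and E +m 0 inject into [W], taken to be E +m H, so over one ultrafilter their
    ultrapowers have Hilbert bases indexed by the same type. *)
Lemma isometric_elementary_class (X H : normedModType (scalars R k)) :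
  hilbert H -> isometric X (NH H) -> elementary_class NE X.
Proof.
move=> hH XH; split.
  exact: isometric_banach (isometric_sym XH) (nakano_sum_hilbert_banach p_cvg2 E_fin E_jvn hH).
have [U [UU bU]] := ultraFilterLemma (@big_base_filter (NH H)).
pose w0 (z : NH zero_space) : NH H := npair (npart z) 0.
have w0inj : injective w0.
  move=> x y /(congr1 (@npart R k p E H)); rewrite /w0 !npart_npair => xy.
  rewrite -[x]npairK -[y]npairK xy; congr npair.
  exact: etrans (zero_spaceE _) (esym (zero_spaceE _)).
have [H1 [[BH1 _] iso1 [e1 be1]]] :=
  big_ultrapower_basis p_cvg2 E_fin E_nonzero E_jvn UU bU hH (@inj_id (NH H)).
have [H2 [[BH2 _] iso2 [e2 be2]]] :=
  big_ultrapower_basis p_cvg2 E_fin E_nonzero E_jvn UU bU zero_space_hilbert w0inj.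
exists _, _, U, U, UU, UU.
apply: isometric_trans (isometric_ultrapower UU XH) _; apply: isometric_trans iso1 _.
apply: isometric_trans (isometric_nakano_hilbert (hilbert_basis_isometric BH1 BH2 be1 be2)) _.
apply: isometric_trans (isometric_sym iso2) _.
exact/isometric_ultrapower/isometric_sym/isometric_nakano_zero.
Qed.

Lemma nakano_direct_sum_banach : banach NE.
Proof.
exact: isometric_banach (isometric_sym isometric_nakano_zero)
  (nakano_sum_hilbert_banach p_cvg2 E_fin E_jvn zero_space_hilbert).
Qed.

(** Unit vectors on successive coordinates would converge along an ultrafilter finer than [\oo], to
    a limit with all coordinates 0 and yet norm 1. *)
Lemma nakano_direct_sum_infinite : ~ finite_dim NE.
Proof.
move=> fd; have [u u1] := unit_vectors E_nonzero.
have [G GU oG] := ultra_nat.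
pose x n : NE := nakano_single p (u n).
have modx n : modular (nakano_single p (u n)) = 1 by rewrite modular_single u1 powR1.
have x1 n : rnorm (x n) = 1.
  by rewrite rnorm_luxemburg; apply/doubling_modular_eq1; [exact: nakano_doubling|exact: modx].
have [|l xl] := finite_dim_compact (x := x) (M := 1) fd GU; first by move=> n; rewrite x1.
have l0 : l = 0.
  apply: (@nakano_sumP R k p E) => n; apply: rnorm_eq0; apply/eqP.
  rewrite eq_le rnorm_ge0 andbT; apply/ler_addgt0Pr => e e0; rewrite add0r.
  have ev : \forall m \near G, (n < m)%N by apply: oG; exact: nbhs_infty_gt.
  have [m [nm xm]] := filter_ex (filterI ev (norm_cvg_near e0 xl)).
  apply: le_trans (ltW xm); rewrite rnorm_luxemburg.
  apply: le_trans (nakano_coord_le n _).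
  have -> : (x m - l : nakano_sum p E) n = - (l : nakano_sum p E) n.
    rewrite nakanoDE nakanoNE nakano_single_out ?add0r //.
    by rewrite gtn_eqF.
  by rewrite rnormN.
have := norm_cvg_rnorm xl; rewrite l0 rnorm0.
have -> : (fun m => rnorm (x m)) = (fun=> 1 : R) by apply/funext => m; exact: x1.
have c1 : (fun=> 1 : R) @ G --> (1 : R) by exact: cvg_cst.
move=> x0; have one0 : (1 : R) = 0 := cvg_unique (@Rhausdorff R) c1 (x0 _).
by have := oner_neq0 R; rewrite one0 eqxx.
Qed.

End ElementaryClass.

(** * Density characters and categoricity *)

Section FirstUncountable.

Lemma countable_set_fun (T : Type) (A : set T) : countable A ->
  exists f : T -> nat, forall x y, A x -> A y -> f x = f y -> x = y.
Proof.
move=> /countable_injP[f finj]; exists f => x y Ax Ay.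
by apply: finj; apply/mem_set.
Qed.

Lemma countable_of_fun (T : Type) (A : set T) (f : T -> nat) :
  (forall x y, A x -> A y -> f x = f y -> x = y) -> countable A.
Proof.
by move=> finj; apply/countable_injP; exists f => x y /set_mem Ax /set_mem Ay; exact: finj.
Qed.

Lemma countable_setU2 (T : Type) (A B : set T) :
  countable A -> countable B -> countable (A `|` B).
Proof.
move=> cA cB; rewrite -bigcup2E; apply: bigcup_countable => // n _.
by case: n => [|[|n]] //=; exact: countable0.
Qed.

Lemma countable_image (T U : Type) (A : set T) (f : T -> U) : countable A -> countable (f @` A).
Proof. by apply: sub_countable; exact: card_image_le. Qed.

Lemma uncountable_nat_bool : ~ countable [set: nat -> bool].
Proof.
move=> /countable_set_fun[f finj].
pose d n := `[< exists g : nat -> bool, f g = n /\ g n = false >].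
have := erefl (d (f d)); rewrite {1}/d; case: asboolP => [[g [gd gf]]|nd].
  by have gE : g = d := finj _ _ I I gd; rewrite -{1}gE gf.
by case dd: (d (f d)) => // _; apply: nd; exists d.
Qed.

(** The order type is omega_1. *)
Definition first_uncountable (K : Type) (lt : K -> K -> Prop) :=
  [/\ well_founded lt, (forall a b, [\/ lt a b, a = b | lt b a]),
      ~ countable [set: K] & forall a, countable [set b | lt b a]].

(** In a well-ordering of an uncountable type, keep the elements with countable initial segment. If
    these were countably many, some element would be left out, and the initial segment of the least
    such one, consisting of kept elements, would be countable. *)
Lemma first_uncountable_exists : exists (K : Type) lt, @first_uncountable K lt.
Proof.
have [r rwo] := wochoice.well_ordering_principle {classic (nat -> bool)}.
pose T := {classic (nat -> bool)}.
have minP (A : set T) : A !=set0 -> exists2 x, A x & forall y, A y -> r x y.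
  move=> [x Ax]; have [|z [[zA zl] _]] := rwo (fun x => `[< A x >]).
    by exists x; apply/asboolP.
  by exists z; [exact/asboolP|move=> y Ay; apply: zl; apply/asboolP].
pose lt (x y : T) := ~ r y x.
have tot x y : r x y \/ r y x.
  have [|z [->|->] zl] := minP [set x; y]; first by exists x; left.
    by left; apply: zl; right.
  by right; apply: zl; left.
have anti x y : r x y -> r y x -> x = y.
  move=> xy yx; have rr z : r z z by case: (tot z z).
  (* Both [x] and [y] are least in the pair, and least elements are unique. *)
  have [|z [_ zu]] := rwo (fun z => `[< z = x \/ z = y >]).
    by exists x; apply/asboolP; left.
  rewrite -(zu x) ?(zu y) //.
    by split=> [|t /asboolP[->|->]//]; apply/asboolP; right.
  by split=> [|t /asboolP[->|->]//]; apply/asboolP; left.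
have ltwf : well_founded lt.
  move=> x; apply: contrapT => nx.
  have [|z nz zl] := minP [set x | ~ Acc lt x]; first by exists x.
  apply: nz; constructor => y yz; apply: contrapT => ny; exact/yz/zl.
pose K := {x : T | countable [set y | lt y x]}.
pose ltK (a b : K) := lt (sval a) (sval b).
have svalinj (a b : K) : sval a = sval b -> a = b.
  case: a b => [a aP] [b bP] /= ab; subst b; congr exist; exact: Prop_irrelevance.
exists K, ltK; split.
- move=> a; move ea: (sval a) => x; elim: (ltwf x) a ea => {}x _ IH a ax; constructor => c ca.
  by apply: (IH (sval c)) => //; rewrite -ax.
- move=> a b; have [ab|ab] := pselect (lt (sval a) (sval b)); first by constructor 1.
  have [ba|ba] := pselect (lt (sval b) (sval a)); first by constructor 3.
  by constructor 2; apply/svalinj/anti; apply: contrapT.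
- move=> /countable_set_fun[f finj].
  have Kc : countable [set x : T | countable [set y | lt y x]].
    pose g x := if pselect (countable [set y | lt y x]) is left h then f (exist _ x h) else 0%N.
    apply: (@countable_of_fun _ _ g) => x y xc yc; rewrite /g.
    case: pselect => // xc'; case: pselect => // yc' /(finj _ _ I I).
    by move=> /(congr1 sval).
  have [all|/existsNP[x xn]] := pselect (forall x : T, countable [set y | lt y x]).
    apply: uncountable_nat_bool; apply: sub_countable Kc; apply: subset_card_le => x _.
    exact: all.
  have [|z nz zl] := minP [set x : T | ~ countable [set y | lt y x]]; first by exists x.
  apply: nz; apply: sub_countable Kc; apply: subset_card_le => y yz /=.
  by apply: contrapT => ny; apply: yz; exact: zl.
- move=> a; apply: sub_countable (svalP a); apply: (@card_le_fun _ _ _ _ sval) => //.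
  by move=> x y _ _; exact: svalinj.
Qed.

Variables (K : Type) (lt : K -> K -> Prop).
Hypothesis KP : @first_uncountable K lt.

(** Transfinite recursion picks, for each [a], distinct elements of [B] avoiding the countably many
    used before. Choosing sequences instead of points embeds [K * nat], which replaces the cardinal
    identity for this product. *)
Lemma first_uncountable_embed (V : Type) (B : set V) : ~ countable B ->
  exists f : K -> nat -> V, (forall a n, B (f a n)) /\
    forall a n b m, f a n = f b m -> a = b /\ n = m.
Proof.
have [ltwf tot _ ltc] := KP => nB.
have [v0 _] : B !=set0.
  by apply/set0P/negP => /eqP B0; apply: nB; rewrite B0.
pose good (A : set V) (s : nat -> V) := (forall n, (B `\` A) (s n)) /\ injective s.
have /choice[c cP] : forall A, exists s, countable A -> good A s.
  move=> A; have [cA|nA] := pselect (countable A); last by exists (fun=> v0).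
  have inf : infinite_set (B `\` A).
    move=> /finite_set_countable BA; apply: nB.
    apply: sub_countable (countable_setU2 BA cA); apply: subset_card_le => x Bx.
    by have [Ax|Ax] := pselect (A x); [right|left].
  pose V' : pointedType := HB.pack V (gen_eqMixin V) (gen_choiceMixin V) (isPointed.Build V v0).
  have [f [fA finj]] := @card_leE nat V' _ _ ((infiniteP _).1 inf).
  by exists f => _; split=> [n|n m]; [exact: fA|exact: finj].
pose F a (f : forall b, lt b a -> nat -> V) := c [set v | exists b (h : lt b a) n, f b h n = v].
pose f := Fix ltwf (fun=> nat -> V) F.
have fE a : f a = c [set v | exists b, lt b a /\ exists n, f b n = v].
  rewrite /f Fix_eq => [|x g h gh]; last first.
    congr F; apply/functional_extensionality_dep => y; apply/functional_extensionality_dep => h'; exact: gh.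
  rewrite /F; congr c; apply/seteqP; split=> v.
    by move=> [b [ba [n <-]]]; exists b; split => //; exists n.
  by move=> [b [ba [n <-]]]; exists b, ba, n.
have fP a : good [set v | exists b, lt b a /\ exists n, f b n = v] (f a).
  rewrite fE; apply: cP.
  have -> : [set v | exists b, lt b a /\ exists n, f b n = v] =
      \bigcup_(b in [set b | lt b a]) range (f b).
    apply/seteqP; split=> v; first by move=> [b [ba [n <-]]]; exists b => //; exists n.
    by move=> [b ba [n _ <-]]; exists b; split => //; exists n.
  by apply: bigcup_countable => // b _; exact: countable_image.
have neq a n b m : lt b a -> f a n <> f b m.
  by move=> ba ab; have [fa _] := fP a; have [_] := fa n; apply; exists b; split => //; exists m.
exists f; split=> [a n|a n b m ab]; first by have [/(_ n)[]] := fP a.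
case: (tot a b) => [h|h|h]; [by case: (neq _ m _ n h)| |by case: (neq _ n _ m h)].
by subst b; have [_ /(_ _ _ ab)] := fP a.
Qed.

Lemma first_uncountable_le (V : Type) (B : set V) : ~ countable B -> ([set: K] #<= B)%card.
Proof.
move=> /first_uncountable_embed[f [fB finj]].
by apply: (@card_le_fun _ _ _ _ (f^~ 0%N)) => // a b _ _ /finj[].
Qed.

(** A point is sent to the pair of some [a] with the point in [D a] and its number there;
    [first_uncountable_embed] with [B] all of [K] embeds these pairs into [K]. *)
Lemma first_uncountable_bigcup (V : Type) (D : K -> set V) :
  (forall a, countable (D a)) -> (\bigcup_a D a #<= [set: K])%card.
Proof.
move=> Dc; have [_ _ Ku _] := KP; have [f [_ finj]] := first_uncountable_embed Ku.
have [a0 _] : [set: K] !=set0.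
  by apply/set0P/negP => /eqP K0; apply: Ku; rewrite K0.
have /choice[g gP] a := countable_set_fun (Dc a).
have /choice[r rP] v : exists a, (\bigcup_a D a) v -> D a v.
  by have [[a _ Da]|] := pselect ((\bigcup_a D a) v); [exists a|exists a0].
apply: (@card_le_fun _ _ _ _ (fun v => f (r v) (g (r v) v))) => // v w /rP vr /rP.
by move=> + /finj[rvw]; rewrite -rvw => wr; exact: gP.
Qed.

(** Otherwise [K] would be the union, over the countable set [G], of countable segments. *)
Lemma first_uncountable_bounded (G : set K) : countable G ->
  exists a, forall v, G v -> lt v a.
Proof.
have [_ tot Ku ltc] := KP => Gc; apply: contrapT => /forallNP nb; apply: Ku.
have -> : [set: K] = \bigcup_(v in G) ([set b | lt b v] `|` [set v]).
  apply/seteqP; split=> // a _; have /existsNP[v /not_implyP[Gv va]] := nb a.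
  by exists v => //; case: (tot a v) => [|->|]; [left|right|].
by apply: bigcup_countable => // v _; apply: countable_setU2 => //; exact: countable1.
Qed.

End FirstUncountable.

Section Density.
Context {R : realType} {k : scalar_kind}.
Implicit Types V W : normedModType (scalars R k).

Definition approximable V (S : set V) (x : V) := forall e : R, 0 < e ->
  exists2 d, S d & rnorm (x - d) < e.

Lemma densityP V (S : set V) : dense S <-> forall x, approximable S x.
Proof.
split=> [Sd x e e0|Sx O [x Ox] Oo].
  have [||d [xd Sd']] := Sd (ball x (scalar_of_real e : scalars R k))°.
  - exists x; apply: nbhsx_ballx; rewrite -(@scalar_of_real0 R k).
    by rewrite lt_neqAle scalar_of_real_le (ltW e0) andbT (inj_eq (@scalar_of_real_inj R k)) lt_eqF.
  - exact: open_interior.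
  - by exists d => //; apply/ball_rnorm; exact: interior_subset xd.
have /nbhs_ballP[c /= c0 cO] : nbhs x O by exact: open_nbhs_nbhs.
have cE : scalar_of_real (scalar_re c) = c := scalar_reK (ltW c0).
have [|d Sd xd] := Sx x (scalar_re c).
  rewrite lt_neqAle; apply/andP; split; last by rewrite -(@scalar_of_real_le R k) cE scalar_of_real0 ltW.
  by apply: contraTneq c0 => e0; rewrite -cE -e0 scalar_of_real0 ltxx.
by exists d; split => //; apply: cO; rewrite -cE; exact/ball_rnorm.
Qed.

Lemma approximable_limit V (S : set V) (x : V) :
  (forall e : R, 0 < e -> exists2 y, approximable S y & rnorm (x - y) < e) ->
  approximable S x.
Proof.
move=> Sx e e0; have e20 : 0 < e / 2 by rewrite divr_gt0.
have [y /(_ _ e20)[d Sd yd] xy] := Sx _ e20; exists d => //.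
rewrite -(subrKA y); apply: le_lt_trans (ler_rnormD _ _) _.
by rewrite [e]splitr ltrD.
Qed.

Lemma approximable_cvg V (S : set V) (u : nat -> V) (l : V) :
  (forall n, approximable S (u n)) -> norm_cvg \oo u l -> approximable S l.
Proof.
move=> Su ul; apply: approximable_limit => e e0.
have [n un] := filter_ex (norm_cvg_near e0 ul).
by exists (u n) => //; rewrite rnormB_sym.
Qed.

Lemma scalar_separable : exists q : nat -> scalars R k,
  forall (c : scalars R k) (e : R), 0 < e -> exists n, rnorm (c - q n) < e.
Proof.
suff [Q QP] : exists Q : rat * rat -> scalars R k,
    forall c (e : R), 0 < e -> exists r, rnorm (c - Q r) < e.
  exists (fun n => if choice.unpickle n is Some r then Q r else 0) => c e /(QP c)[r cr].
  by exists (choice.pickle r); rewrite choice.pickleK.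
have near (a e : R) : 0 < e -> exists q : rat, `|a - ratr q| < e.
  move=> e0; have [|q] := @rat_in_itvoo R (a - e) (a + e); first by lra.
  by rewrite in_itv /= => /andP[aq qa]; exists q; rewrite ltr_norml; apply/andP; split; lra.
case: k.
  by exists (fun r => ratr r.1 : R) => c e /(near c)[q cq]; exists (q, 0).
exists (fun r => Complex (ratr r.1) (ratr r.2) : R[i]) => -[a b] e e0.
have e20 : 0 < e / 2 by rewrite divr_gt0.
have [q aq] := near a _ e20; have [r br] := near b _ e20; exists (q, r).
rewrite /rnorm /=; set x := a - _; set y := b - _.
apply: (@le_lt_trans _ _ (`|x| + `|y|)); last by rewrite [e]splitr ltrD.
rewrite -[leRHS]ger0_norm ?addr_ge0 // -[leRHS]sqrtr_sqr ler_sqrt ?sqr_ge0 //.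
rewrite [leRHS]sqrrD !real_normK ?num_real // -addrA lerD2l lerDr.
by rewrite mulrn_wge0 // mulr_ge0.
Qed.

Lemma countable_span V (S : set V) : countable S -> exists D : set V, [/\ countable D,
  approximable D 0, (forall c v, S v -> approximable D (c *: v)) &
  forall x y, approximable D x -> approximable D y -> approximable D (x + y)].
Proof.
move=> /countable_set_fun[f finj]; have [q qP] := scalar_separable.
have /choice[g gP] n : exists v : V, forall w, S w -> f w = n -> v = w.
  have [[w [Sw fw]]|nw] := pselect (exists w, S w /\ f w = n); last first.
    by exists 0 => w Sw fw; case: nw; exists w.
  by exists w => w' Sw' fw'; apply: finj => //; rewrite fw.
(* Coefficients from a countable dense set and generators are both given by their numbers, so
   countability of the combinations is that of [seq (nat * nat)]. *)
pose comb (s : seq (nat * nat)) : V := \sum_(i <- s) q i.1 *: g i.2.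
exists (range comb); split.
- by apply: countable_image; exact: countableP.
- by move=> e e0; exists 0; [exists [::] => //; rewrite /comb big_nil|rewrite subrr rnorm0].
- move=> c v Sv e e0.
  have v0 : 0 < rnorm v + 1 by rewrite ltr_wpDl ?rnorm_ge0.
  have [|n cn] := qP c (e / (rnorm v + 1)); first by rewrite divr_gt0.
  exists (q n *: v).
    by exists [:: (n, f v)] => //; rewrite /comb big_seq1 /= (gP _ v Sv).
  rewrite -scalerBl rnormZ; move: cn; rewrite ltr_pdivlMr // => /(le_lt_trans _); apply.
  by rewrite ler_wpM2l ?rnorm_ge0 // lerDl.
- move=> x y Dx Dy e e0; have e20 : 0 < e / 2 by rewrite divr_gt0.
  have [_ [s _ <-] xs] := Dx _ e20; have [_ [t _ <-] yt] := Dy _ e20.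
  exists (comb s + comb t); first by exists (s ++ t) => //; rewrite /comb big_cat.
  rewrite opprD addrACA; apply: le_lt_trans (ler_rnormD _ _) _.
  by rewrite [e]splitr ltrD.
Qed.

Lemma isometric_density V W (kappa : Type) :
  isometric V W -> has_density V kappa -> has_density W kappa.
Proof.
move=> /isometricE[f [g [fl fK gK gl [fn gn]]]] [[D [Dd Dk]] le].
have ap (X Y : normedModType (scalars R k)) (h : X -> Y) (h' : Y -> X) (S : set X) :
    (forall a x y, h (a *: x + y) = a *: h x + h y) -> cancel h' h ->
    (forall x, rnorm (h x) = rnorm x) -> dense S -> dense (h @` S).
  move=> hl hK hn /densityP Sd; apply/densityP => y e e0.
  have [d Sd' yd] := Sd (h' y) e e0; exists (h d); first by exists d.
  by rewrite -[y]hK -(isometric_linearB hl) hn.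
split.
  exists (f @` D); split; first exact: ap Dd.
  apply: card_eq_trans Dk; apply: inj_card_eq => x y _ _; exact: (can_inj fK).
move=> S Sd; apply: card_le_trans (le _ (ap _ _ _ _ _ gl fK gn Sd)) _.
exact: card_image_le.
Qed.

End Density.

Section HilbertSubspaces.
Context {R : realType} {k : scalar_kind}.

Lemma fourier_dense (H : normedModType (scalars R k)) (B : choiceType) (e : B -> H) :
  banach H -> hilbert_basis e -> forall h (c : R), 0 < c ->
  exists a G, rnorm (h - fourier_sum e a G) < c.
Proof.
move=> BH [ip [ipE eu eo ec]] h c c0; pose a b := ip h (e b).
have supP := parseval ipE eu eo ec h BH; have c20 : 0 < c ^+ 2 by rewrite exprn_gt0.
have : rnorm h ^+ 2 - c ^+ 2 < sup (coef_sums a) by rewrite -supP ltrBlDr ltrDl.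
move=> /sup_gt[|_ [G uG ->] hG].
  by exists 0; exists [::] => //; rewrite big_nil.
exists a, G; rewrite -(@ltr_pXn2r _ 2) ?nnegrE ?rnorm_ge0 ?(ltW c0) //.
rewrite (fourier_sum_residual ipE eu eo) //.
by move: hG; lra.
Qed.

(** The subspace is the orthogonal complement of the basis vectors outside the image of [j]. It is
    closed because coefficients are continuous. *)
Lemma hilbert_basis_restrict (H : normedModType (scalars R k)) (B : choiceType) (e : B -> H)
    (C : Type) (j : C -> B) : banach H -> hilbert_basis e -> injective j ->
  exists (H0 : normedModType (scalars R k)) (e0 : {classic C} -> H0),
    hilbert H0 /\ hilbert_basis e0.
Proof.
move=> BH [ip [ipE eu eo ec]] jinj.
pose out b := forall c, j c <> b.
have S00 b : out b -> ip 0 (e b) = 0 by move=> _; exact: ip0l.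
have SP a x y : (forall b, out b -> ip x (e b) = 0) -> (forall b, out b -> ip y (e b) = 0) ->
    forall b, out b -> ip (a *: x + y) (e b) = 0.
  by move=> x0 y0 b ob; rewrite ipDl ipZl x0 // y0 // mulr0 addr0.
pose H0 : normedModType (scalars R k) := subspace (LinearSubspace S00 SP).
have BH0 : banach H0.
  apply: geometric_banach => u uc.
  have [n|l lP] := banach_geometric (u := fun n => subval (u n)) (C := 1) BH.
    by rewrite mul1r; exact: uc.
  have l0 b : out b -> ip l (e b) = 0.
    move=> ob; apply: rnorm_eq0; apply/eqP; rewrite eq_le rnorm_ge0 andbT.
    apply/ler_addgt0Pr => c c0; rewrite add0r.
    have [|n nc] := @near_expr_half R (c / 2); first by rewrite divr_gt0.
    have -> : ip l (e b) = ip (l - subval (u n)) (e b).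
      by rewrite ipDl ipNl (subvalP (u n) b ob) subr0.
    apply: le_trans (ip_unit_le ipE eu eo _ _) _; apply: le_trans (lP n) _.
    by move: nc; rewrite ltr_pdivlMr // mulr1 mulrC => /ltW.
  exists (Subspace (S := LinearSubspace S00 SP) l0) => n.
  apply: le_trans (lP n) _.
  by rewrite mulr1 ler_wpM2r ?(ltW (expr_half_gt0 _)) // ler_nat.
have [|||ip0 ip0E ip0P] := @dot_of_form R k H0 (fun x y => ip (subval x) (subval y)).
- by move=> a x y z; rewrite subvalD subvalZ ipDl ipZl.
- by move=> x y; exact: ipC.
- by move=> x; exact: ipE.
have ej c b : out b -> ip (e (j c)) (e b) = 0.
  by move=> ob; apply: eo; apply/eqP; exact: ob.
pose e0 (c : {classic C}) : H0 := Subspace (S := LinearSubspace S00 SP) (ej c).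
exists H0, e0; split; first by split => //; exists ip0.
exists ip0; split => // [c|c d cd|x xe].
- by rewrite ip0P; exact: eu.
- rewrite ip0P; apply: eo; apply: contraNneq cd => /jinj ->; exact: eqxx.
apply: subspaceP; apply: ec => b; have [ob|/existsNP[c /contrapT <-]] := pselect (out b).
  exact: (subvalP x).
by rewrite -(ip0P x (e0 c)) xe.
Qed.

End HilbertSubspaces.

Section Categoricity.
Context {R : realType} {k : scalar_kind} (p : exponents R).
Variable E : nat -> normedModType (scalars R k).
Local Notation NH := (nakano_sum_hilbert p E).
Local Notation NE := (nakano_direct_sum p E).

(** Distinct basis vectors are at distance [sqrt 2], so no point is within [1/2] of two of them. *)
Lemma hilbert_basis_le_dense (H : normedModType (scalars R k)) (B : choiceType) (e : B -> H)
    (D : set (NH H)) : hilbert_basis e -> dense D -> ([set: B] #<= D)%card.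
Proof.
move=> [ip [ipE eu eo _]] /densityP Dd.
have /choice[d dP] b : exists d, D d /\ rnorm (npair 0 (e b) - d) < 2^-1.
  by have [|d Dd' bd] := Dd (npair 0 (e b)) 2^-1; [by rewrite invr_gt0|exists d].
apply: (@card_le_fun _ _ _ _ d) => [b _|b c _ _ dbc]; first exact: (dP b).1.
apply: contrapT => /eqP bc.
have n2 : rnorm (e b - e c) ^+ 2 = 2.
  rewrite -(rnorm_ip ipE) !(ipDl, ipDr, ipNl, ipNr) !eu !eo // 1?eq_sym //.
  by rewrite !oppr0 !addr0 opprK add0r -(scalar_of_real1 (k := k)) -scalar_of_realD scalar_of_realK.
have n1 : rnorm (e b - e c) < 1.
  rewrite -(rnorm_npair0l p E).
  have -> : npair 0 (e b - e c) = (npair 0 (e b) - d b) + (d b - npair 0 (e c)) :> NH H.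
    by rewrite subrKA -[- npair _ _]scaleN1r -npairZ -npairD scaler0 addr0 scaleN1r.
  apply: le_lt_trans (ler_rnormD _ _) _.
  have := (dP b).2; have := (dP c).2; rewrite -dbc rnormB_sym.
  by move=> h1 h2; rewrite (splitr 1) ltrD // div1r.
by have := exprn_ile1 2 (rnorm_ge0 _) (ltW n1); rewrite n2; lra.
Qed.

Hypothesis E_fin : forall n, finite_dim (E n).

(** E is separable, since each [E n] has a finite spanning list and truncations converge; so only
    the number of basis vectors involved matters. *)
Lemma nakano_countable_approx (H : normedModType (scalars R k)) (B : choiceType) (e : B -> H)
    (P : set B) : countable P -> exists2 D : set (NH H), countable D &
  forall x a G, (forall b, b \in G -> P b) ->
    approximable D (npair x (fourier_sum e a G) : NH H).
Proof.
move=> Pc; pose s n := sval (cid (finite_dim_list (E_fin n))).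
have sP n v : list_span (s n) v by rewrite /s; case: cid.
pose gens : set (NH H) := (\bigcup_n (fun v => npair (nakano_single p v) 0) @` [set` s n])
  `|` (fun b => npair 0 (e b)) @` P.
have gc : countable gens.
  apply: countable_setU2; last exact: countable_image.
  apply: bigcup_countable => // n _; apply: countable_image.
  exact/finite_set_countable/finite_seq.
have [D [Dc D0 DZ DD]] := countable_span gc.
exists D; first exact: Dc.
move=> x a G GP.
have single n (v : E n) : approximable D (npair (nakano_single p v) 0 : NH H).
  have : {subset s n <= s n} by [].
  elim: {1 2}(s n) v (sP n v) => [|w t IH] v /=.
    by move=> -> _; rewrite -(scale0r (0 : E n)) nakano_singleZ scale0r.
  move=> [c [y [ty ->]]] st.
  have -> : npair (nakano_single p (y + c *: w)) 0 =
      npair (nakano_single p y) 0 + c *: npair (nakano_single p w) 0 :> NH H.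
    by rewrite -npairZ -npairD scaler0 addr0 nakano_singleD nakano_singleZ.
  apply: (DD); first by apply: IH => // u ut; apply: st; rewrite inE ut orbT.
  apply: (DZ); left; exists n => //; exists w => //; exact: (st w (mem_head _ _)).
have trunc N : approximable D (npair (nakano_trunc N x) 0 : NH H).
  elim: N => [|N IH]; first by rewrite /nakano_trunc big_ord0.
  rewrite nakano_truncS.
  have -> : npair (nakano_trunc N x + nakano_single p (x N)) 0 =
      npair (nakano_trunc N x) 0 + npair (nakano_single p (x N)) 0 :> NH H.
    by rewrite -npairD addr0.
  exact: (DD _ _ IH (single N (x N))).
have -> : npair x (fourier_sum e a G) = npair x 0 + npair 0 (fourier_sum e a G) :> NH H.
  by rewrite -npairD addr0 add0r.
apply: (DD); first exact: (@approximable_cvg _ _ (NH H) D _ _ trunc (@cvg_nakano_trunc _ _ _ _ H x)).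
elim: G GP => [|b G IH] GP; first by rewrite /fourier_sum big_nil.
rewrite /fourier_sum big_cons -/(fourier_sum e a G).
have -> : npair 0 (a b *: e b + fourier_sum e a G) =
    a b *: npair 0 (e b) + npair 0 (fourier_sum e a G) :> NH H.
  by rewrite -npairZ -npairD scaler0 addr0.
apply: (DD); first by apply: (DZ); right; exists b => //; apply: GP; rewrite inE eqxx.
by apply: IH => c cG; apply: GP; rewrite inE cG orbT.
Qed.

Lemma dense_of_approximable (H : normedModType (scalars R k)) (B : choiceType) (e : B -> H)
    (D : set (NH H)) : banach H -> hilbert_basis e ->
  (forall x a G, approximable D (npair x (fourier_sum e a G) : NH H)) -> dense D.
Proof.
move=> BH be DP; apply/densityP => z; apply: approximable_limit => c c0.
have [a [G hG]] := fourier_dense BH be (hpart z) c0.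
exists (npair (npart z) (fourier_sum e a G)); first exact: DP.
rewrite -{1}[z]npairK.
have -> : npair (npart z) (hpart z) - npair (npart z) (fourier_sum e a G) =
    npair 0 (hpart z - fourier_sum e a G) :> NH H.
  by rewrite -[- npair _ _]scaleN1r -npairZ -npairD !scaleN1r subrr.
by rewrite rnorm_npair0l.
Qed.

Hypothesis p_neq2 : forall n, p n != 2.
Hypothesis p_cvg2 : p n @[n --> \oo] --> (2 : R).
Hypothesis E_nonzero : forall n, exists x : E n, x != 0.
Hypothesis E_jvn : jordan_von_neumann (E n) @[n --> \oo] --> (1 : R).

Section FirstUncountableBasis.
Variables (K : Type) (lt : K -> K -> Prop).
Hypothesis KP : first_uncountable lt.

(** The finitely many indices of a Fourier sum lie below one [c], so the countable sets built for
    the segments below each [c] have a dense union. *)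
Lemma first_uncountable_density (H : normedModType (scalars R k)) (e : {classic K} -> H) :
  banach H -> hilbert_basis e -> has_density (NH H) K.
Proof.
move=> BH be; have KD D : dense D -> ([set: K] #<= D)%card := hilbert_basis_le_dense be.
split => //; have [_ _ _ ltc] := KP.
have /choice[D DP] (c : K) : exists D : set (NH H), countable D /\
    forall x a G, (forall b : {classic K}, b \in G -> lt b c) ->
      approximable D (npair x (fourier_sum e a G) : NH H).
  by have [D Dc DP] := nakano_countable_approx e (ltc c); exists D.
have Dd : dense (\bigcup_c D c).
  apply: (dense_of_approximable BH be) => x a G.
  have [c cP] := first_uncountable_bounded KP (finite_set_countable (finite_seq G)).
  move=> r /((DP c).2 x a G cP)[d Dd xd]; exists d => //; by exists c.
exists (\bigcup_c D c); split => //; apply: Cantor_Bernstein; last exact: KD.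
exact: (first_uncountable_bigcup KP (fun c => (DP c).1)).
Qed.

(** A countable basis would give a countable dense set, against the density [K]; so [K] embeds into
    the basis. Conversely, the basis embeds into a dense set of size [K]. *)
Lemma first_uncountable_basis (H : normedModType (scalars R k)) :
  hilbert H -> has_density (NH H) K -> exists e : {classic K} -> H, hilbert_basis e.
Proof.
move=> [BH [ip ipE]] [[D [Dd DK]] min].
have [|S [_ oS Sc]] := orthonormal_extend (S0 := set0) ipE; first by split.
have [e be] := hilbert_basis_of_set ipE oS Sc (card_setT S).
apply: (hilbert_basis_of_set ipE oS Sc); apply: Cantor_Bernstein.
  apply: (first_uncountable_le KP) => Scount.
  have Tc : countable [set: S] by rewrite (eq_countable (card_setT S)).
  have [D' D'c D'P] := nakano_countable_approx e Tc.
  have [_ _ Ku _] := KP; apply: Ku; apply: sub_countable D'c; apply: min.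
  by apply: (dense_of_approximable BH be) => x a G; exact: D'P.
have /card_eqPle[_ SS] := card_setT S; have /card_eqPle[DK' _] := DK.
by apply: card_le_trans SS _; apply: card_le_trans DK'; exact: hilbert_basis_le_dense be Dd.
Qed.

End FirstUncountableBasis.

Lemma nakano_categorical : exists kappa : Type, ~ countable [set: kappa] /\
  exists Y, [/\ elementary_class NE Y, has_density Y kappa &
    forall Z, elementary_class NE Z -> has_density Z kappa -> isometric Z Y].
Proof.
have [K [lt KP]] := first_uncountable_exists; exists K; split; first by case: KP.
have [U [UU bU]] := ultraFilterLemma (@big_base_filter (NH (@zero_space R k))).
have [H [[BH _] _ [e be]]] :=
  big_ultrapower_basis p_cvg2 E_fin E_nonzero E_jvn UU bU zero_space_hilbert (@inj_id _).
(* The basis of the big Hilbert space is uncountable and contains a copy of [K]; restricting to it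
   yields a Hilbert space of dimension [K]. *)
have [j jinj] : exists j : K -> node (NH (@zero_space R k)) -> bool, injective j.
  have nc : ~ countable [set: node (NH (@zero_space R k)) -> bool].
    move=> c; apply: uncountable_nat_bool; apply: sub_countable c.
    apply: (@card_le_fun _ _ _ _ (fun g x => let: Node n _ _ := x in g n)) => // g h _ _ gh.
    by apply/funext => n; exact: (congr1 (fun h => h (Node n [::] 0)) gh).
  have [f [_ finj]] := first_uncountable_embed KP nc.
  by exists (f^~ 0%N) => a b /finj[].
have [H0 [e0 [hH0 be0]]] := hilbert_basis_restrict BH be jinj.
exists (NH H0); split.
- exact: (isometric_elementary_class p_cvg2 E_fin E_nonzero E_jvn hH0 (isometric_refl _)).
- exact: first_uncountable_density KP _ _ hH0.1 be0.
move=> Z /(elementary_class_isometric p_neq2 p_cvg2 E_fin E_jvn)[HZ [hHZ ZH]] Zk.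
have [eZ beZ] := first_uncountable_basis KP hHZ (isometric_density ZH Zk).
apply: isometric_trans ZH _; apply: isometric_nakano_hilbert.
exact: hilbert_basis_isometric hHZ.1 hH0.1 beZ be0.
Qed.

End Categoricity.

Theorem corollary4p4 (R : realType) (k : scalar_kind) (p : exponents R)
    (E : nat -> normedModType (scalars R k))
    (p_neq2 : forall n, p n != 2)
    (p_cvg2 : p n @[n --> \oo] --> (2 : R))
    (E_finite_dim : forall n, finite_dim (E n))
    (E_nonzero : forall n, exists x : E n, x != 0)
    (E_jordan_von_neumann : jordan_von_neumann (E n) @[n --> \oo] --> (1 : R)) :
  (forall X : normedModType (scalars R k),
     elementary_class (nakano_direct_sum p E) X <->
     exists H : normedModType (scalars R k),
       hilbert H /\ isometric X (nakano_sum_hilbert p E H)) /\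
  uncountably_categorical (nakano_direct_sum p E).
Proof.
split=> [X|].
  split; first exact: elementary_class_isometric.
  by move=> [H [hH XH]]; exact: isometric_elementary_class hH XH.
split; [exact: nakano_direct_sum_banach|exact: nakano_direct_sum_infinite|].
exact: nakano_categorical.
Qed.
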